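(* Let $N\ge1$, $\alpha\in\mathbb{C}$ with $(q^{1-\alpha};q)_\infty\neq0$, and let $u_0,\ldots,u_N,z\in\mathbb{C}$ with $u_0,\ldots,u_N,\ z-u_0,\ z+u_1\notin\Lambda_\tau$. Put $u=u_0+\cdots+u_N$. Then $$\hat\mu_N(u_0,\ldots,u_N;\alpha;\tau)-\hat\mu_N(u_0-z,u_1+z,u_2,\ldots,u_N;\alpha;\tau)$$ $$=\frac{e^{\pi i(\alpha-1)u+\pi i\alpha\tau}\vartheta(\alpha\tau)\vartheta(z)\vartheta(z-u_0+u_1)(q;q)_\infty}{\vartheta(z-u_0)\vartheta(z+u_1)\vartheta(u_0)\cdots\vartheta(u_N)(q^{1-\alpha};q)_\infty}\sum_{n\in\mathbb{Z}^{N-1}}q^{\frac12{}^t n\widehat S n}\prod_{j=1}^{N-1}e^{2\pi in_j(u_0+u_1-u_{j+1})}\;{}_1\phi_1\!\left(q^{1-\alpha};0;q;e^{2\pi i(u_0+u_1+\alpha\tau)}q^{|n|}\right),$$ where for $N=1$ the sum over $\mathbb{Z}^0$ consists of the single term $n=()$ with $|n|=0$.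
   Context: Fix $\tau$ with $\operatorname{Im}\tau>0$, $q=e^{2\pi i\tau}$, $\Lambda_\tau=\mathbb{Z}+\tau\mathbb{Z}$, $q^\beta:=e^{2\pi i\beta\tau}$. $(x;q)_\infty=\prod_{j\ge0}(1-xq^j)$, $(x;q)_n=\prod_{j=0}^{n-1}(1-xq^j)$. $\vartheta(u)=\vartheta(u;\tau)=-ie^{-\pi iu}q^{1/8}(q;q)_\infty(e^{2\pi iu};q)_\infty(qe^{-2\pi iu};q)_\infty$. For $n\in\mathbb{Z}^k$, $|n|$ is the sum of its entries. $\widehat S$ is the $(N-1)\times(N-1)$ matrix with entries $1+\delta_{jk}$ (2 on the diagonal, 1 elsewhere). ${}_1\phi_1(b;0;q;x)=\sum_{n\ge0}\frac{(b;q)_n}{(q;q)_n}(-1)^nq^{n(n-1)/2}x^n$. The multivariable generalized $\mu$-function is $$\hat\mu_N(u_0,\ldots,u_N;\alpha;\tau)=e^{\pi i(\alpha-1)u}\sum_{n\in\mathbb{Z}^N}\frac{e^{\pi iu_0}\,(e^{2\pi iu_0}q^{\alpha+|n|};q)_\infty}{(e^{2\pi iu_0}q^{|n|};q)_\infty}\prod_{j=1}^N\frac{(-1)^{n_j}e^{-2\pi in_ju_j}q^{n_j(n_j+1)/2}}{\vartheta(u_j;\tau)},\quad u=u_0+\cdots+u_N.$$ *)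

(* Defs.v *)
From Stdlib Require Import Reals ZArith List.
From Coquelicot Require Import Coquelicot.
Import ListNotations.
Open Scope C_scope.

Definition cexp (z : C) : C :=
  (exp (Re z) * cos (Im z), exp (Re z) * sin (Im z))%R.

Definition Ci : C := (0%R, 1%R).
Definition CPI : C := RtoC PI.

Definition Clim (s : nat -> C) : C :=
  @lim (CompleteNormedModule.CompleteSpace _ C_CompleteNormedModule)
       (filtermap s eventually).

Definition qpow (tau beta : C) : C := cexp (2 * CPI * Ci * beta * tau).
Definition qq (tau : C) : C := qpow tau 1.

Fixpoint csum (n : nat) (f : nat -> C) : C :=
  match n with O => 0 | S n => csum n f + f n end.
Fixpoint cprod (n : nat) (f : nat -> C) : C :=
  match n with O => 1 | S n => cprod n f * f n end.

Definition qpoch (x q : C) (n : nat) : C := cprod n (fun j => 1 - x * q ^ j).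
Definition qpoch_inf (x q : C) : C := Clim (qpoch x q).

Definition vtheta (u tau : C) : C :=
  let q := qq tau in
  - Ci * cexp (- CPI * Ci * u) * qpow tau (/ 8)
    * qpoch_inf q q * qpoch_inf (cexp (2 * CPI * Ci * u)) q
    * qpoch_inf (q * cexp (- 2 * CPI * Ci * u)) q.

Definition in_lattice (tau w : C) : Prop :=
  exists a b : Z, w = RtoC (IZR a) + RtoC (IZR b) * tau.

Definition signZ (m : Z) : C := if Z.even m then 1 else - (1).

Definition zsum (M : nat) (g : Z -> C) : C :=
  csum (2 * M + 1) (fun j => g (Z.of_nat j - Z.of_nat M)%Z).

Fixpoint boxsum (k M : nat) (f : list Z -> C) : C :=
  match k with
  | O => f nil
  | S k => zsum M (fun m => boxsum k M (fun l => f (m :: l)))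
  end.

(* sum over Z^k, as limit of the box partial sums (the series in question are
   absolutely convergent); for k = 0 it is the single term f nil *)
Definition Zk_sum (k : nat) (f : list Z -> C) : C :=
  Clim (fun M => boxsum k M f).

Definition abs_n (n : list Z) : Z := fold_right Z.add 0%Z n.
Definition IZC (m : Z) : C := RtoC (IZR m).

(* n_j, 1-based *)
Definition nj (n : list Z) (j : nat) : Z := nth (j - 1) n 0%Z.

Definition hat_mu (N : nat) (u : nat -> C) (alpha tau : C) : C :=
  let q := qq tau in
  let U := csum (S N) u in
  cexp (CPI * Ci * (alpha - 1) * U) *
  Zk_sum N (fun n =>
    cexp (CPI * Ci * u O)
    * qpoch_inf (cexp (2 * CPI * Ci * u O) * qpow tau (alpha + IZC (abs_n n))) q
    / qpoch_inf (cexp (2 * CPI * Ci * u O) * qpow tau (IZC (abs_n n))) q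
    * cprod N (fun i =>
        let j := S i in
        let m := nj n j in
        signZ m * cexp (- 2 * CPI * Ci * IZC m * u j)
        * qpow tau (IZC m * IZC (m + 1) / 2) / vtheta (u j) tau)).

Definition phi11 (b q x : C) : C :=
  Clim (fun K => csum K (fun n =>
     qpoch b q n / qpoch q q n * signZ (Z.of_nat n)
     * q ^ (n * (n - 1) / 2) * x ^ n)).
(* note: n*(n-1)/2 is exact in nat since n(n-1) is even *)

Definition hatS (j k : nat) : Z := if Nat.eqb j k then 2%Z else 1%Z.
Definition quadS (k : nat) (n : list Z) : C :=
  csum k (fun a => csum k (fun b =>
     IZC (hatS (S a) (S b)) * IZC (nj n (S a)) * IZC (nj n (S b)))).

(* Main.v *)
Require Import Defs.
From Stdlib Require Import Reals ZArith List Lra Lia Psatz Permutation.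
From Coquelicot Require Import Coquelicot.
Open Scope C_scope.

(** Write [e(w) = exp(2 pi i w)], [q = e(tau)] and [a = q^alpha].

    For [N = 1] and [|a| < 1] one expands [(a x)_oo / (x)_oo] in partial fractions
    [sum_k rho_k / (1 - x q^k)], up to a factor free of [x].  This turns the mu-function into a
    combination of Appell-Lerch quotients [A(u, v + k tau) / theta(v + k tau)], whose difference under
    [(u, v) -> (u - z, v + z)] is Zwegers' theta quotient; quasi-periodicity of theta then produces
    the series [1phi1].  Zwegers' formula is obtained without complex analysis: in
    [theta(v + z) A(u, v) - theta(v) A(u - z, v + z)] the coefficient of [e(s v)] is, up to the
    corresponding coefficient of [theta(v + z - u)], independent of [s], so this expression is
    [K theta(v + z - u)]; the special values [v = 0] and [v = - z] show that [A(u, 0) theta(u)] is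
    constant, and [u -> 0] gives the constant [(q)_oo^3].

    Since [(a x / q)_oo = (1 - a x / q) (a x)_oo], both sides satisfy the same first order recursion
    relating [alpha] to [alpha + 1], which removes the restriction [|a| < 1].

    For general [N], summing over [n_1] first gives the case [N = 1] with [u_0] replaced by
    [u_0 + (n_2 + ... + n_N) tau]. *)

(** * Limits of complex sequences *)

(** [Clim] gives some value to every sequence, so each identity needs a proof of convergence.
    Interchanges of sums are therefore stated as limits of partial sums, and expressions are
    identified by uniqueness of limits. Convergence rests on Tannery's theorem, mostly with a
    Gaussian factor ([superexp_small]) times a factor of at most exponential growth ([exp_bounded])
    as majorant. One-variable series are indexed by all of Z, with 1/(q;q)_k extended by 0 to k < 0,
    so that a functional equation becomes a shift of the index without boundary terms. Signs are
    written e(n/2), hence identities between terms are polynomial identities between exponents, up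
    to an integer. A function with a first order equation under w -> w + tau is pinned down by its
    limit along w + n tau; no analyticity is involved. The parameter is b = alpha tau, and |a| < 1
    reads 0 < Im b, which makes the sum of the rho_k converge. The prefactor of [vtheta] is stripped
    off until the end, so that no e(v/2) occurs in between. *)

Definition Ctends (s : nat -> C) (l : C) : Prop :=
  forall eps : R, (0 < eps)%R ->
  exists n0, forall n, (n0 <= n)%nat -> (Cmod (s n - l) < eps)%R.

Lemma Cmod_sub_sym (x y : C) : Cmod (x - y) = Cmod (y - x).
Proof. rewrite <- Cmod_opp. f_equal. ring. Qed.

Lemma Cmod_triangle_sub (x y z : C) : (Cmod (x - z) <= Cmod (x - y) + Cmod (y - z))%R.
Proof. replace (x - z) with ((x - y) + (y - z)) by ring. apply Cmod_triangle. Qed.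

Lemma Ctends_unique (s : nat -> C) (l l' : C) : Ctends s l -> Ctends s l' -> l = l'.
Proof.
  intros H H'.
  assert (E : Cmod (l - l') = 0%R).
  { apply Rle_antisym; [|apply Cmod_ge_0].
    apply Rnot_lt_le. intros Hp.
    destruct (H (Cmod (l - l') / 2)%R) as [n Hn]; [lra|].
    destruct (H' (Cmod (l - l') / 2)%R) as [n' Hn']; [lra|].
    specialize (Hn (Nat.max n n') ltac:(lia)). specialize (Hn' (Nat.max n n') ltac:(lia)).
    pose proof (Cmod_triangle_sub l (s (Nat.max n n')) l').
    rewrite (Cmod_sub_sym l (s _)) in H0. lra. }
  apply Cmod_eq_0 in E. replace l with ((l - l') + l') by ring. rewrite E. ring.
Qed.

(** The balls of the uniform structure on [C] need not be the discs of [Cmod]. The equivalence of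
    the two kinds of balls makes facts about filters available for the epsilon definition. *)
Lemma Ctends_filterlim (s : nat -> C) (l : C) :
  Ctends s l <-> filterlim s eventually (@locally (NormedModule.UniformSpace _ C_NormedModule) l).
Proof.
  rewrite (@filterlim_locally_ball_norm C_AbsRing nat C_NormedModule eventually _).
  unfold ball_norm. split.
  - intros H eps. destruct (H eps (cond_pos eps)) as [n Hn]. exists n. exact Hn.
  - intros H eps He. destruct (H (mkposreal eps He)) as [n Hn]. exists n. exact Hn.
Qed.

(** The [lim] of a complete space is specified only for Cauchy filters. A convergent sequence yields
    one, so [complete_cauchy] makes [Clim s] a limit of it, and uniqueness of limits does the
    rest. *)
Lemma Clim_eq (s : nat -> C) (l : C) : Ctends s l -> Clim s = l.
Proof.
  intros H. apply Ctends_filterlim in H.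
  apply (Ctends_unique s); [|apply Ctends_filterlim; exact H].
  apply Ctends_filterlim.
  apply (proj2 (@filterlim_locally nat (NormedModule.UniformSpace _ C_NormedModule) eventually _ s (Clim s))).
  intros eps.
  refine (@complete_cauchy (CompleteNormedModule.CompleteSpace _ C_CompleteNormedModule)
    (filtermap s eventually) _ _ eps).
  intros e. exists l.
  exact (proj1 (@filterlim_locally nat (NormedModule.UniformSpace _ C_NormedModule)
    eventually _ s l) H e).
Qed.

Definition Ccauchy (s : nat -> C) : Prop :=
  forall eps : R, (0 < eps)%R ->
  exists n0, forall n m, (n0 <= n)%nat -> (n <= m)%nat -> (Cmod (s m - s n) < eps)%R.

Lemma Ccauchy_tends (s : nat -> C) : Ccauchy s -> Ctends s (Clim s).
Proof.
  intros H.
  assert (exists l, Ctends s l) as [l Hl].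
  { destruct (proj1 (@filterlim_locally_cauchy nat
      (CompleteNormedModule.CompleteSpace _ C_CompleteNormedModule) eventually _ s)) as [l Hl].
    - intros eps.
      destruct (H (eps / 2)%R) as [n0 Hn0].
      { pose proof (cond_pos eps). lra. }
      exists (fun n => (n0 <= n)%nat). split; [now exists n0|].
      intros u v Hu Hv.
      apply (@norm_compat1 C_AbsRing C_NormedModule).
      change (Cmod (s v - s u) < eps)%R.
      pose proof (cond_pos eps).
      destruct (Nat.le_ge_cases u v) as [Huv|Huv].
      + specialize (Hn0 u v Hu Huv). lra.
      + rewrite Cmod_sub_sym. specialize (Hn0 v u Hv Huv). lra.
    - exists l. apply Ctends_filterlim. exact Hl. }
  rewrite (Clim_eq s l Hl). exact Hl.
Qed.

Lemma Ctends_ext (s t : nat -> C) (l : C) : (forall n, s n = t n) -> Ctends s l -> Ctends t l.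
Proof.
  intros E H eps He. destruct (H eps He) as [n0 Hn]. exists n0. intros n Hle.
  rewrite <- E. auto.
Qed.

Lemma Ctends_const (c : C) : Ctends (fun _ => c) c.
Proof.
  intros eps He. exists 0%nat. intros n _.
  replace (c - c) with (RtoC 0) by ring. rewrite Cmod_0. exact He.
Qed.

Lemma Ctends_plus (s t : nat -> C) (l m : C) :
  Ctends s l -> Ctends t m -> Ctends (fun n => s n + t n) (l + m).
Proof.
  intros H H' eps He.
  destruct (H (eps / 2)%R) as [n Hn]; [lra|].
  destruct (H' (eps / 2)%R) as [n' Hn']; [lra|].
  exists (Nat.max n n'). intros k Hk.
  specialize (Hn k ltac:(lia)). specialize (Hn' k ltac:(lia)).
  replace (s k + t k - (l + m)) with ((s k - l) + (t k - m)) by ring.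
  pose proof (Cmod_triangle (s k - l) (t k - m)). lra.
Qed.

Lemma Ctends_scal (c : C) (s : nat -> C) (l : C) :
  Ctends s l -> Ctends (fun n => c * s n) (c * l).
Proof.
  intros H eps He. pose proof (Cmod_ge_0 c).
  destruct (H (eps / (Cmod c + 1))%R) as [n0 Hn].
  { apply Rdiv_lt_0_compat; lra. }
  exists n0. intros n Hle. specialize (Hn n Hle).
  replace (c * s n - c * l) with (c * (s n - l)) by ring. rewrite Cmod_mult.
  apply Rle_lt_trans with ((Cmod c + 1) * Cmod (s n - l))%R.
  { pose proof (Cmod_ge_0 (s n - l)). nra. }
  apply (Rmult_lt_compat_l (Cmod c + 1)) in Hn; [|lra].
  replace ((Cmod c + 1) * (eps / (Cmod c + 1)))%R with eps in Hn by (field; lra). exact Hn.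
Qed.

Lemma Ctends_minus (s t : nat -> C) (l m : C) :
  Ctends s l -> Ctends t m -> Ctends (fun n => s n - t n) (l - m).
Proof.
  intros H H'. apply (Ctends_scal (-(1))) in H'.
  pose proof (Ctends_plus _ _ _ _ H H') as P.
  replace (l - m) with (l + - (1) * m) by ring.
  eapply Ctends_ext; [|exact P]. intros n. cbv beta. ring.
Qed.

Lemma Ctends_bounded (s : nat -> C) (l : C) :
  Ctends s l -> exists n0, forall n, (n0 <= n)%nat -> (Cmod (s n) <= Cmod l + 1)%R.
Proof.
  intros H. destruct (H 1%R) as [n0 Hn]; [lra|]. exists n0. intros n Hle.
  specialize (Hn n Hle).
  pose proof (Cmod_triangle (s n - l) l) as T.
  replace (s n - l + l) with (s n) in T by ring. lra.
Qed.

Lemma Ctends_mult (s t : nat -> C) (l m : C) :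
  Ctends s l -> Ctends t m -> Ctends (fun n => s n * t n) (l * m).
Proof.
  intros H H'. destruct (Ctends_bounded _ _ H) as [n0 Hb].
  assert (A : Ctends (fun n => s n * (t n - m)) 0).
  { intros eps He. pose proof (Cmod_ge_0 l).
    destruct (H' (eps / (Cmod l + 1))%R) as [n1 Hn].
    { apply Rdiv_lt_0_compat; lra. }
    exists (Nat.max n0 n1). intros n Hle.
    specialize (Hb n ltac:(lia)). specialize (Hn n ltac:(lia)).
    replace (s n * (t n - m) - 0) with (s n * (t n - m)) by ring. rewrite Cmod_mult.
    apply Rle_lt_trans with ((Cmod l + 1) * Cmod (t n - m))%R.
    { pose proof (Cmod_ge_0 (t n - m)). nra. }
    apply (Rmult_lt_compat_l (Cmod l + 1)) in Hn; [|lra].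
    replace ((Cmod l + 1) * (eps / (Cmod l + 1)))%R with eps in Hn by (field; lra). exact Hn. }
  pose proof (Ctends_plus _ _ _ _ A (Ctends_scal m _ _ H)) as P.
  replace (l * m) with (0 + m * l) by ring.
  eapply Ctends_ext; [|exact P]. intros n. cbv beta. ring.
Qed.

Lemma Ctends_Cmod_le (s : nat -> C) (l : C) (B : R) :
  Ctends s l -> (forall n, (Cmod (s n) <= B)%R) -> (Cmod l <= B)%R.
Proof.
  intros H Hb. apply Rnot_lt_le. intros Hlt.
  destruct (H (Cmod l - B)%R) as [n Hn]; [lra|]. specialize (Hn n (le_n n)). specialize (Hb n).
  pose proof (Cmod_triangle (l - s n) (s n)) as T.
  replace (l - s n + s n) with l in T by ring.
  rewrite Cmod_sub_sym in T. lra.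
Qed.

Lemma Ctends_le_Cmod (s : nat -> C) (l : C) (B : R) :
  Ctends s l -> (forall n, (B <= Cmod (s n))%R) -> (B <= Cmod l)%R.
Proof.
  intros H Hb. apply Rnot_lt_le. intros Hlt.
  destruct (H (B - Cmod l)%R) as [n Hn]; [lra|]. specialize (Hn n (le_n n)). specialize (Hb n).
  pose proof (Cmod_triangle (s n - l) l) as T.
  replace (s n - l + l) with (s n) in T by ring. lra.
Qed.

Lemma Ctends_squeeze (s : nat -> C) (l : C) (b : nat -> R) :
  (forall n, (Cmod (s n - l) <= b n)%R) -> Ctends (fun n => RtoC (b n)) 0 -> Ctends s l.
Proof.
  intros Hb H eps He. destruct (H eps He) as [n0 Hn]. exists n0. intros n Hle.
  specialize (Hn n Hle). specialize (Hb n).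
  replace (RtoC (b n) - 0) with (RtoC (b n)) in Hn by ring. rewrite Cmod_R in Hn.
  pose proof (Rle_abs (b n)). lra.
Qed.

Lemma geometric_small (K r eps : R) : (0 <= r < 1)%R -> (0 < eps)%R ->
  exists n0, forall n, (n0 <= n)%nat -> (Rabs (K * r ^ n) < eps)%R.
Proof.
  intros Hr He.
  assert (0 < eps / (Rabs K + 1))%R.
  { apply Rdiv_lt_0_compat; [lra|]. pose proof (Rabs_pos K). lra. }
  destruct (pow_lt_1_zero r) with (y := (eps / (Rabs K + 1))%R) as [n0 Hn]; auto.
  { rewrite Rabs_pos_eq; lra. }
  exists n0. intros n Hle. specialize (Hn n Hle).
  rewrite Rabs_mult. pose proof (Rabs_pos K).
  apply Rle_lt_trans with ((Rabs K + 1) * Rabs (r ^ n))%R.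
  { pose proof (Rabs_pos (r ^ n)). nra. }
  apply (Rmult_lt_compat_l (Rabs K + 1)) in Hn; [|lra].
  replace ((Rabs K + 1) * (eps / (Rabs K + 1)))%R with eps in Hn by (field; lra). exact Hn.
Qed.

Lemma geometric_tends_0 (K r : R) : (0 <= r < 1)%R -> Ctends (fun n => RtoC (K * r ^ n)) 0.
Proof.
  intros Hr eps He. destruct (geometric_small K r eps Hr He) as [n0 Hn].
  exists n0. intros n Hle.
  replace (RtoC (K * r ^ n) - 0) with (RtoC (K * r ^ n)) by ring.
  rewrite Cmod_R. auto.
Qed.

(** * Sums along an exhaustion *)

Fixpoint lsum {I : Type} (l : list I) (f : I -> C) : C :=
  match l with nil => 0 | i :: l' => f i + lsum l' f end.
Fixpoint rsum {I : Type} (l : list I) (g : I -> R) : R :=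
  match l with nil => 0%R | i :: l' => (g i + rsum l' g)%R end.

(** Permutations and an explicit complement replace set inclusion: they split a partial sum in two
    without deciding equality of indices. Intervals of Z and boxes of Z^k are both instances. *)
Definition exhaustion {I : Type} (E : nat -> list I) : Prop :=
  forall K M, (K <= M)%nat -> exists D, Permutation (E M) (E K ++ D).

Definition Csum {I : Type} (E : nat -> list I) (f : I -> C) : C :=
  Clim (fun M => lsum (E M) f).

Definition rsummable {I : Type} (E : nat -> list I) (g : I -> R) : Prop :=
  (forall i, (0 <= g i)%R) /\ exists B, forall M, (rsum (E M) g <= B)%R.

Definition dominated {I : Type} (E : nat -> list I) (f : I -> C) (g : I -> R) : Prop :=
  forall M i, In i (E M) -> (Cmod (f i) <= g i)%R.

Definition summable {I : Type} (E : nat -> list I) (f : I -> C) : Prop :=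
  rsummable E (fun i => Cmod (f i)).

Lemma lsum_app {I : Type} (l l' : list I) (f : I -> C) :
  lsum (l ++ l') f = lsum l f + lsum l' f.
Proof. induction l as [|i l IH]; simpl; [ring|rewrite IH; ring]. Qed.

Lemma rsum_app {I : Type} (l l' : list I) (f : I -> R) :
  rsum (l ++ l') f = (rsum l f + rsum l' f)%R.
Proof. induction l as [|i l IH]; simpl; [ring|rewrite IH; ring]. Qed.

Lemma lsum_perm {I : Type} (l l' : list I) (f : I -> C) :
  Permutation l l' -> lsum l f = lsum l' f.
Proof. induction 1; simpl; try rewrite IHPermutation; try congruence; ring. Qed.

Lemma rsum_perm {I : Type} (l l' : list I) (f : I -> R) :
  Permutation l l' -> rsum l f = rsum l' f.
Proof. induction 1; simpl; try rewrite IHPermutation; try congruence; ring. Qed.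

Lemma lsum_ext {I : Type} (l : list I) (f g : I -> C) :
  (forall i, In i l -> f i = g i) -> lsum l f = lsum l g.
Proof.
  induction l as [|i l IH]; simpl; intros H; [reflexivity|].
  rewrite H by auto. rewrite IH; auto.
Qed.

Lemma rsum_ext {I : Type} (l : list I) (f g : I -> R) :
  (forall i, In i l -> f i = g i) -> rsum l f = rsum l g.
Proof.
  induction l as [|i l IH]; simpl; intros H; [reflexivity|].
  rewrite H by auto. rewrite IH; auto.
Qed.

Lemma lsum_plus {I : Type} (l : list I) (f g : I -> C) :
  lsum l (fun i => f i + g i) = lsum l f + lsum l g.
Proof. induction l as [|i l IH]; simpl; [ring|rewrite IH; ring]. Qed.

Lemma lsum_scal {I : Type} (c : C) (l : list I) (f : I -> C) :
  lsum l (fun i => c * f i) = c * lsum l f.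
Proof. induction l as [|i l IH]; simpl; [ring|rewrite IH; ring]. Qed.

Lemma lsum_minus {I : Type} (l : list I) (f g : I -> C) :
  lsum l (fun i => f i - g i) = lsum l f - lsum l g.
Proof. induction l as [|i l IH]; simpl; [ring|rewrite IH; ring]. Qed.

Lemma rsum_scal {I : Type} (c : R) (l : list I) (f : I -> R) :
  rsum l (fun i => c * f i)%R = (c * rsum l f)%R.
Proof. induction l as [|i l IH]; simpl; [ring|rewrite IH; ring]. Qed.

Lemma rsum_nonneg {I : Type} (l : list I) (g : I -> R) :
  (forall i, (0 <= g i)%R) -> (0 <= rsum l g)%R.
Proof. intros H. induction l as [|i l IH]; simpl; [lra|specialize (H i); lra]. Qed.

Lemma rsum_le {I : Type} (l : list I) (g h : I -> R) :
  (forall i, In i l -> (g i <= h i)%R) -> (rsum l g <= rsum l h)%R.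
Proof.
  induction l as [|i l IH]; simpl; intros H; [lra|].
  specialize (IH (fun i Hi => H i (or_intror Hi))). specialize (H i (or_introl eq_refl)). lra.
Qed.

Lemma lsum_Cmod_le {I : Type} (l : list I) (f : I -> C) (g : I -> R) :
  (forall i, In i l -> (Cmod (f i) <= g i)%R) -> (Cmod (lsum l f) <= rsum l g)%R.
Proof.
  induction l as [|i l IH]; simpl; intros H; [rewrite Cmod_0; lra|].
  specialize (IH (fun i Hi => H i (or_intror Hi))). specialize (H i (or_introl eq_refl)).
  pose proof (Cmod_triangle (f i) (lsum l f)). lra.
Qed.

Lemma lsum_tends {I : Type} (l : list I) (F : nat -> I -> C) (f : I -> C) :
  (forall i, In i l -> Ctends (fun n => F n i) (f i)) ->
  Ctends (fun n => lsum l (F n)) (lsum l f).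
Proof.
  induction l as [|i l IH]; simpl; intros H; [apply Ctends_const|].
  apply Ctends_plus; auto.
Qed.

Lemma exhaustion_diff_le {I : Type} (E : nat -> list I) (f : I -> C) (g : I -> R) (K M : nat) :
  exhaustion E -> (K <= M)%nat -> dominated E f g ->
  (Cmod (lsum (E M) f - lsum (E K) f) <= rsum (E M) g - rsum (E K) g)%R.
Proof.
  intros HE Hle Hd. destruct (HE K M Hle) as [D HD].
  rewrite (lsum_perm _ _ _ HD), (rsum_perm _ _ _ HD), lsum_app, rsum_app.
  replace (lsum (E K) f + lsum D f - lsum (E K) f) with (lsum D f) by ring.
  replace (rsum (E K) g + rsum D g - rsum (E K) g)%R with (rsum D g) by ring.
  apply lsum_Cmod_le. intros i Hi. apply (Hd M).
  apply (Permutation_in _ (Permutation_sym HD)). apply in_or_app. auto.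
Qed.

Lemma rsum_incr {I : Type} (E : nat -> list I) (g : I -> R) (K M : nat) :
  exhaustion E -> (K <= M)%nat -> (forall i, (0 <= g i)%R) -> (rsum (E K) g <= rsum (E M) g)%R.
Proof.
  intros HE Hle Hg. destruct (HE K M Hle) as [D HD].
  rewrite (rsum_perm _ _ _ HD), rsum_app. pose proof (rsum_nonneg D g Hg). lra.
Qed.

(** Bounded partial sums have a supremum, and any stage within [eps] of it works. That stage is
    extracted classically. *)
Lemma rsummable_tail {I : Type} (E : nat -> list I) (g : I -> R) (eps : R) :
  exhaustion E -> rsummable E g -> (0 < eps)%R ->
  exists K, forall M, (K <= M)%nat -> (rsum (E M) g - rsum (E K) g < eps)%R.
Proof.
  intros HE [Hg [B HB]] He.
  destruct (completeness (fun x => exists M, x = rsum (E M) g)) as [m [Hm1 Hm2]].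
  - exists B. intros x [M ->]. apply HB.
  - exists (rsum (E 0%nat) g). now exists 0%nat.
  - assert (exists K, (m - eps < rsum (E K) g)%R) as [K HK].
    { apply Classical_Prop.NNPP. intros Hn.
      assert (m <= m - eps)%R; [|lra]. apply Hm2. intros x [M ->].
      apply Rnot_lt_le. intros Hlt. apply Hn. now exists M. }
    exists K. intros M HM. assert (rsum (E M) g <= m)%R by (apply Hm1; now exists M). lra.
Qed.

Lemma dominated_summable {I : Type} (E : nat -> list I) (f : I -> C) (g : I -> R) :
  dominated E f g -> rsummable E g -> summable E f.
Proof.
  intros Hd [Hg [B HB]]. split; [intros; apply Cmod_ge_0|].
  exists B. intros M. eapply Rle_trans; [|apply (HB M)]. apply rsum_le. apply Hd.
Qed.

Lemma dominated_Cmod (I : Type) (E : nat -> list I) (f : I -> C) : dominated E f (fun i => Cmod (f i)).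
Proof. intros M i _. apply Rle_refl. Qed.

Lemma summable_tends {I : Type} (E : nat -> list I) (f : I -> C) :
  exhaustion E -> summable E f -> Ctends (fun M => lsum (E M) f) (Csum E f).
Proof.
  intros HE Hs. apply Ccauchy_tends. intros eps He.
  destruct (rsummable_tail E _ (eps / 2)%R HE Hs) as [K HK]; [lra|].
  exists K. intros n m Hn Hm.
  pose proof (HK m ltac:(lia)).
  pose proof (exhaustion_diff_le E f _ n m HE Hm (dominated_Cmod _ E f)).
  pose proof (rsum_incr E (fun i => Cmod (f i)) K n HE Hn (fun i => Cmod_ge_0 (f i))).
  lra.
Qed.

Lemma Csum_eq {I : Type} (E : nat -> list I) (f : I -> C) (l : C) :
  Ctends (fun M => lsum (E M) f) l -> Csum E f = l.
Proof. apply Clim_eq. Qed.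

Lemma Csum_ext {I : Type} (E : nat -> list I) (f g : I -> C) :
  (forall i, f i = g i) -> Csum E f = Csum E g.
Proof.
  intros H. unfold Csum. f_equal. apply FunctionalExtensionality.functional_extensionality.
  intros M. apply lsum_ext. auto.
Qed.

Lemma Csum_minus {I : Type} (E : nat -> list I) (f g : I -> C) :
  exhaustion E -> summable E f -> summable E g ->
  Csum E (fun i => f i - g i) = Csum E f - Csum E g.
Proof.
  intros HE Hf Hg. apply Csum_eq.
  eapply Ctends_ext; [|apply Ctends_minus; apply summable_tends; eassumption].
  intros M. symmetry. apply lsum_minus.
Qed.

Lemma Csum_scal {I : Type} (E : nat -> list I) (c : C) (f : I -> C) :
  exhaustion E -> summable E f -> Csum E (fun i => c * f i) = c * Csum E f.
Proof.
  intros HE Hf. apply Csum_eq.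
  eapply Ctends_ext; [|apply Ctends_scal; apply summable_tends; eassumption].
  intros M. symmetry. apply lsum_scal.
Qed.

Lemma summable_scal {I : Type} (E : nat -> list I) (c : C) (f : I -> C) :
  summable E f -> summable E (fun i => c * f i).
Proof.
  intros [_ [B HB]]. split; [intros; apply Cmod_ge_0|].
  exists (Cmod c * B)%R. intros M.
  rewrite (rsum_ext _ _ (fun i => Cmod c * Cmod (f i))%R) by (intros; apply Cmod_mult).
  rewrite rsum_scal. apply Rmult_le_compat_l; [apply Cmod_ge_0|apply HB].
Qed.

Lemma Csum_Cmod_le {I : Type} (E : nat -> list I) (f : I -> C) (B : R) :
  exhaustion E -> (forall M, (rsum (E M) (fun i => Cmod (f i)) <= B)%R) -> (Cmod (Csum E f) <= B)%R.
Proof.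
  intros HE HB. eapply Ctends_Cmod_le.
  - apply summable_tends; [assumption|]. split; [intros; apply Cmod_ge_0|]. now exists B.
  - intros M. cbv beta. eapply Rle_trans; [|apply (HB M)].
    apply lsum_Cmod_le. intros. lra.
Qed.

(** Cut at a stage K after which the majorant sums to less than eps/4. Up to K only finitely many
    finite sums have to converge; beyond K the tails of [F n] and of [f] cost eps/4 each. Uniformity
    in the stage M yields both the diagonal limit and the limit of infinite sums. *)
Lemma tannery_uniform {I : Type} (E : nat -> list I) (F : nat -> I -> C) (f : I -> C) (g : I -> R) :
  exhaustion E -> rsummable E g -> (forall n, dominated E (F n) g) ->
  (forall M i, In i (E M) -> Ctends (fun n => F n i) (f i)) ->
  forall eps, (0 < eps)%R -> exists n0, forall n M, (n0 <= n)%nat ->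
  (Cmod (lsum (E M) (F n) - lsum (E M) f) < eps)%R.
Proof.
  intros HE Hg HF Hlim eps He.
  assert (Hf : dominated E f g).
  { intros M i Hi. eapply Ctends_Cmod_le; [apply (Hlim M i Hi)|].
    intros n. cbv beta. apply (HF n M i Hi). }
  destruct (rsummable_tail E g (eps / 4)%R HE Hg) as [K HK]; [lra|].
  assert (T : exists n0, forall n M, (n0 <= n)%nat -> (M <= K)%nat ->
     (Cmod (lsum (E M) (F n) - lsum (E M) f) < eps / 4)%R).
  { clear HK. induction K as [|K [n0 IH]].
    - destruct (lsum_tends (E 0%nat) F f (Hlim 0%nat) (eps / 4)%R) as [n0 Hn]; [lra|].
      exists n0. intros n M Hn0 HM. replace M with 0%nat by lia. auto.
    - destruct (lsum_tends (E (S K)) F f (Hlim (S K)) (eps / 4)%R) as [n1 Hn]; [lra|].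
      exists (Nat.max n0 n1). intros n M Hn0 HM.
      destruct (Nat.eq_dec M (S K)) as [->|]; [apply Hn|apply IH]; lia. }
  destruct T as [n0 Hn]. exists n0. intros n M Hle.
  destruct (Nat.le_ge_cases M K) as [HM|HM].
  - specialize (Hn n M Hle HM). lra.
  - specialize (Hn n K Hle (le_n K)). specialize (HK M HM).
    pose proof (exhaustion_diff_le E (F n) g K M HE HM (HF n)) as A.
    pose proof (exhaustion_diff_le E f g K M HE HM Hf) as B.
    set (a := lsum (E M) (F n)) in *. set (b := lsum (E K) (F n)) in *.
    set (c := lsum (E M) f) in *. set (d := lsum (E K) f) in *.
    pose proof (Cmod_triangle_sub a b c). pose proof (Cmod_triangle_sub b d c).
    rewrite (Cmod_sub_sym d c) in *. lra.
Qed.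

Lemma limit_summable {I : Type} (E : nat -> list I) (F : nat -> I -> C) (f : I -> C) (g : I -> R) :
  rsummable E g -> (forall n, dominated E (F n) g) ->
  (forall M i, In i (E M) -> Ctends (fun n => F n i) (f i)) -> summable E f.
Proof.
  intros Hg HF Hlim. apply (dominated_summable E f g); [|assumption].
  intros M i Hi. eapply Ctends_Cmod_le; [apply (Hlim M i Hi)|].
  intros n. cbv beta. apply (HF n M i Hi).
Qed.

(** Serves series over Z^(k+1), whose box sums truncate the first coordinate and the others at the
    same M. *)
Lemma tannery_diagonal {I : Type} (E : nat -> list I) (F : nat -> I -> C) (f : I -> C) (g : I -> R) :
  exhaustion E -> rsummable E g -> (forall n, dominated E (F n) g) ->
  (forall M i, In i (E M) -> Ctends (fun n => F n i) (f i)) ->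
  Ctends (fun M => lsum (E M) (F M)) (Csum E f).
Proof.
  intros HE Hg HF Hlim.
  assert (Hs : summable E f) by (eapply limit_summable; eassumption).
  assert (A : Ctends (fun M => lsum (E M) (F M) - lsum (E M) f) 0).
  { intros eps He.
    destruct (tannery_uniform E F f g HE Hg HF Hlim eps He) as [n0 Hn].
    exists n0. intros n Hle. specialize (Hn n n Hle).
    replace (lsum (E n) (F n) - lsum (E n) f - 0) with (lsum (E n) (F n) - lsum (E n) f) by ring.
    exact Hn. }
  pose proof (Ctends_plus _ _ _ _ A (summable_tends E f HE Hs)) as P.
  replace (Csum E f) with (0 + Csum E f) by ring.
  eapply Ctends_ext; [|exact P]. intros n. cbv beta. ring.
Qed.

Lemma tannery {I : Type} (E : nat -> list I) (F : nat -> I -> C) (f : I -> C) (g : I -> R) :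
  exhaustion E -> rsummable E g -> (forall n, dominated E (F n) g) ->
  (forall M i, In i (E M) -> Ctends (fun n => F n i) (f i)) ->
  Ctends (fun n => Csum E (F n)) (Csum E f).
Proof.
  intros HE Hg HF Hlim eps He.
  assert (Hs : summable E f) by (eapply limit_summable; eassumption).
  destruct (tannery_uniform E F f g HE Hg HF Hlim (eps / 2)%R) as [n0 Hn]; [lra|].
  exists n0. intros n Hle.
  apply Rle_lt_trans with (eps / 2)%R; [|lra].
  assert (Hsn : summable E (F n)) by (eapply dominated_summable; eauto).
  eapply Ctends_Cmod_le.
  - apply Ctends_minus; [apply (summable_tends E (F n) HE Hsn)|apply (summable_tends E f HE Hs)].
  - intros M. cbv beta. left. apply Hn. exact Hle.
Qed.

Lemma Csum_lsum {I J : Type} (E : nat -> list I) (l : list J) (f : I -> J -> C) :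
  exhaustion E -> (forall j, summable E (fun i => f i j)) ->
  summable E (fun i => lsum l (f i)) /\
  Csum E (fun i => lsum l (f i)) = lsum l (fun j => Csum E (fun i => f i j)).
Proof.
  intros HE Hs.
  assert (Hl : summable E (fun i => lsum l (f i))).
  { induction l as [|j l [_ [B HB]]]; simpl.
    - split; [intros; apply Cmod_ge_0|]. exists 0%R. intros M. induction (E M) as [|i l IH]; simpl.
      + lra.
      + rewrite Cmod_0 in *. lra.
    - destruct (Hs j) as [_ [B' HB']]. split; [intros; apply Cmod_ge_0|].
      exists (B' + B)%R. intros M. specialize (HB M). specialize (HB' M).
      clear - HB HB'.
      apply Rle_trans with (rsum (E M) (fun i => Cmod (f i j)) +
                            rsum (E M) (fun i => Cmod (lsum l (f i))))%R; [|lra].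
      clear. induction (E M) as [|i k IH]; simpl; [lra|].
      pose proof (Cmod_triangle (f i j) (lsum l (f i))). lra. }
  split; [exact Hl|]. apply Csum_eq.
  assert (T : Ctends (fun M => lsum l (fun j => lsum (E M) (fun i => f i j)))
             (lsum l (fun j => Csum E (fun i => f i j)))).
  { apply lsum_tends. intros j _. apply summable_tends; auto. }
  eapply Ctends_ext; [|exact T]. intros M. cbv beta. clear.
  induction (E M) as [|i k IH]; simpl.
  - induction l as [|j l IH]; simpl; [reflexivity|rewrite IH; ring].
  - rewrite <- IH, <- lsum_plus. reflexivity.
Qed.

(** Tannery's theorem for the partial sums over j, with [g] as majorant. The outer sum over j stays
    a limit of partial sums, so its absolute convergence never has to be established. *)
Lemma Csum_fubini {I J : Type} (E : nat -> list I) (D : nat -> list J)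
  (f : I -> J -> C) (g : I -> R) :
  exhaustion E -> exhaustion D -> rsummable E g ->
  (forall i M, (rsum (D M) (fun j => Cmod (f i j)) <= g i)%R) ->
  (forall j, dominated E (fun i => f i j) g) ->
  Ctends (fun n => lsum (D n) (fun j => Csum E (fun i => f i j))) (Csum E (fun i => Csum D (f i))).
Proof.
  intros HE HD Hg Hb Hj.
  assert (Hs : forall j, summable E (fun i => f i j)).
  { intros j. eapply dominated_summable; [apply Hj|exact Hg]. }
  assert (T : Ctends (fun n => Csum E (fun i => lsum (D n) (f i))) (Csum E (fun i => Csum D (f i)))).
  { apply (tannery E _ _ g HE Hg).
    - intros n M i _. eapply Rle_trans; [|apply (Hb i n)]. apply lsum_Cmod_le. intros; lra.
    - intros M i _. apply summable_tends; [assumption|].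
      split; [intros; apply Cmod_ge_0|]. exists (g i). apply Hb. }
  eapply Ctends_ext; [|exact T].
  intros n. cbv beta. apply Csum_lsum; auto.
Qed.

(** * Sums over the integers and over boxes *)

Definition zl (M : nat) : list Z :=
  map (fun j => (Z.of_nat j - Z.of_nat M)%Z) (seq 0 (2 * M + 1)).

Lemma csum_lsum (n : nat) (f : nat -> C) : csum n f = lsum (seq 0 n) f.
Proof.
  induction n as [|n IH]; [reflexivity|].
  rewrite seq_S, lsum_app. simpl. rewrite IH. ring.
Qed.

Lemma lsum_map {I J : Type} (h : J -> I) (l : list J) (f : I -> C) :
  lsum (map h l) f = lsum l (fun j => f (h j)).
Proof. induction l as [|i l IH]; simpl; [reflexivity|rewrite IH; reflexivity]. Qed.

Lemma rsum_map {I J : Type} (h : J -> I) (l : list J) (f : I -> R) :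
  rsum (map h l) f = rsum l (fun j => f (h j)).
Proof. induction l as [|i l IH]; simpl; [reflexivity|rewrite IH; reflexivity]. Qed.

Lemma zsum_lsum (M : nat) (g : Z -> C) : zsum M g = lsum (zl M) g.
Proof. unfold zsum, zl. rewrite csum_lsum, lsum_map. reflexivity. Qed.

Lemma in_zl (M : nat) (m : Z) : In m (zl M) <-> (Z.abs m <= Z.of_nat M)%Z.
Proof.
  unfold zl. rewrite in_map_iff. split.
  - intros [j [<- Hj]]. apply in_seq in Hj. lia.
  - intros H. exists (Z.to_nat (m + Z.of_nat M)). rewrite in_seq. lia.
Qed.

Lemma NoDup_zl (M : nat) : NoDup (zl M).
Proof.
  unfold zl. apply NoDup_map_NoDup_ForallPairs; [|apply seq_NoDup].
  intros a b _ _ H. lia.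
Qed.

Lemma NoDup_incl_complement {I : Type} (l l' : list I) :
  NoDup l -> incl l l' -> exists D, Permutation l' (l ++ D).
Proof.
  revert l'. induction l as [|a l IH]; intros l' Hn Hi; [now exists l'|].
  destruct (in_split a l' (Hi a (or_introl eq_refl))) as [l1 [l2 ->]].
  inversion Hn as [|a' l0 Ha Hl]; subst.
  destruct (IH (l1 ++ l2) Hl) as [D HD].
  - intros x Hx. specialize (Hi x (or_intror Hx)).
    apply in_app_or in Hi. apply in_or_app. destruct Hi as [H|[H|H]]; auto.
    subst. contradiction.
  - exists D. simpl. rewrite <- HD. symmetry. apply Permutation_middle.
Qed.

Lemma exhaustion_of_incl {I : Type} (E : nat -> list I) :
  (forall M, NoDup (E M)) -> (forall K M, (K <= M)%nat -> incl (E K) (E M)) -> exhaustion E.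
Proof. intros H1 H2 K M HKM. apply NoDup_incl_complement; auto. Qed.

Lemma exhaustion_zl : exhaustion zl.
Proof.
  apply exhaustion_of_incl; [apply NoDup_zl|].
  intros K M H m. rewrite !in_zl. lia.
Qed.

(** One inclusion makes every late stage of [E'] contain a given stage of [E]; the other confines
    the excess to the tail of [E], where the absolute sum is small. Applied to translated intervals
    of Z. *)
Lemma Csum_cofinal {I : Type} (E E' : nat -> list I) (f : I -> C) :
  exhaustion E -> summable E f ->
  (forall K, exists M0, forall M, (M0 <= M)%nat -> exists D, Permutation (E' M) (E K ++ D)) ->
  (forall M, exists L D, Permutation (E L) (E' M ++ D)) ->
  Ctends (fun M => lsum (E' M) f) (Csum E f).
Proof.
  intros HE Hs H1 H2 eps He.
  destruct (rsummable_tail E _ (eps / 2)%R HE Hs) as [K1 HK1]; [lra|].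
  destruct (summable_tends E f HE Hs (eps / 2)%R) as [K2 HK2]; [lra|].
  set (K := Nat.max K1 K2).
  destruct (H1 K) as [M0 HM0]. exists M0. intros M HM.
  destruct (HM0 M HM) as [D HD]. destruct (H2 M) as [L [D' HD']].
  assert (A : (Cmod (lsum (E' M) f - lsum (E K) f) < eps / 2)%R).
  { rewrite (lsum_perm _ _ _ HD), lsum_app.
    replace (lsum (E K) f + lsum D f - lsum (E K) f) with (lsum D f) by ring.
    apply Rle_lt_trans with (rsum D (fun i => Cmod (f i))).
    { apply lsum_Cmod_le. intros. lra. }
    assert (P1 : rsum (E' M) (fun i => Cmod (f i)) =
       (rsum (E K) (fun i => Cmod (f i)) + rsum D (fun i => Cmod (f i)))%R).
    { rewrite (rsum_perm _ _ _ HD). apply rsum_app. }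
    assert (P2 : rsum (E L) (fun i => Cmod (f i)) =
       (rsum (E' M) (fun i => Cmod (f i)) + rsum D' (fun i => Cmod (f i)))%R).
    { rewrite (rsum_perm _ _ _ HD'). apply rsum_app. }
    pose proof (rsum_nonneg D' (fun i => Cmod (f i)) (fun i => Cmod_ge_0 (f i))).
    pose proof (HK1 (Nat.max K L) ltac:(lia)).
    pose proof (rsum_incr E (fun i => Cmod (f i)) L (Nat.max K L) HE ltac:(lia)
       (fun i => Cmod_ge_0 (f i))).
    pose proof (rsum_incr E (fun i => Cmod (f i)) K1 K HE ltac:(lia)
       (fun i => Cmod_ge_0 (f i))).
    lra. }
  specialize (HK2 K ltac:(lia)).
  pose proof (Cmod_triangle_sub (lsum (E' M) f) (lsum (E K) f) (Csum E f)). lra.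
Qed.

Lemma shifted_zl_incl (k : Z) (M L : nat) :
  (M + Z.abs_nat k <= L)%nat -> exists D, Permutation (zl L) (map (fun n => (n + k)%Z) (zl M) ++ D).
Proof.
  intros HL. apply NoDup_incl_complement.
  - apply NoDup_map_NoDup_ForallPairs; [|apply NoDup_zl]. intros a b _ _ H. lia.
  - intros m Hm. apply in_map_iff in Hm. destruct Hm as [n [<- Hn]].
    rewrite in_zl in *. lia.
Qed.

Lemma rsum_shift_le (k : Z) (M : nat) (g : Z -> R) (B : R) :
  (forall n, (0 <= g n)%R) -> (forall L, (rsum (zl L) g <= B)%R) ->
  (rsum (zl M) (fun n => g (n + k)%Z) <= B)%R.
Proof.
  intros Hg HB. destruct (shifted_zl_incl k M _ (le_n _)) as [D HD].
  specialize (HB (M + Z.abs_nat k)%nat).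
  rewrite (rsum_perm _ _ _ HD), rsum_app, rsum_map in HB.
  pose proof (rsum_nonneg D g Hg). lra.
Qed.

Lemma summable_shift (k : Z) (f : Z -> C) :
  summable zl f -> summable zl (fun n => f (n + k)%Z).
Proof.
  intros [H [B HB]]. split; [intros; apply Cmod_ge_0|].
  exists B. intros M. apply (rsum_shift_le k M (fun n => Cmod (f n))); auto.
Qed.

Lemma Csum_shift (k : Z) (f : Z -> C) :
  summable zl f -> Csum zl (fun n => f (n + k)%Z) = Csum zl f.
Proof.
  intros Hs. apply Csum_eq.
  apply (Ctends_ext (fun M => lsum (map (fun n => (n + k)%Z) (zl M)) f)).
  { intros M. apply lsum_map. }
  apply Csum_cofinal; [apply exhaustion_zl|assumption| |].
  - intros K. exists (K + Z.abs_nat k)%nat. intros M HM.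
    apply NoDup_incl_complement; [apply NoDup_zl|].
    intros m Hm. apply in_map_iff. exists (m - k)%Z. rewrite in_zl in *. split; lia.
  - intros M. exists (M + Z.abs_nat k)%nat. apply shifted_zl_incl. lia.
Qed.

(** The form taken by a termwise limit in which only one term survives. *)
Lemma Csum_single (k : Z) (c : C) : Csum zl (fun n => if Z.eqb n k then c else 0) = c.
Proof.
  apply Csum_eq. intros eps He. exists (Z.abs_nat k). intros M HM.
  assert (Hin : In k (zl M)) by (rewrite in_zl; lia).
  destruct (in_split _ _ Hin) as [l1 [l2 E]].
  pose proof (NoDup_zl M) as Hnd. rewrite E in Hnd. apply NoDup_remove_2 in Hnd.
  assert (Z0 : forall l, ~ In k l -> lsum l (fun n => if Z.eqb n k then c else 0) = 0).
  { induction l as [|a l IH]; simpl; intros Hn; [reflexivity|].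
    destruct (Z.eqb_spec a k); [tauto|]. rewrite IH by tauto. ring. }
  rewrite E, lsum_app. simpl. rewrite Z.eqb_refl, !Z0.
  - replace (0 + (c + 0) - c) with (RtoC 0) by ring. rewrite Cmod_0. exact He.
  - intros H. apply Hnd. apply in_or_app. auto.
  - intros H. apply Hnd. apply in_or_app. auto.
Qed.

Lemma summable_finite (f : Z -> C) (k : Z) : (forall n, n <> k -> f n = 0) -> summable zl f.
Proof.
  intros Hf. split; [intros; apply Cmod_ge_0|]. exists (Cmod (f k)). intros M.
  assert (Z0 : forall l, ~ In k l -> rsum l (fun n => Cmod (f n)) = 0%R).
  { induction l as [|a l IH]; simpl; intros Hn; [reflexivity|].
    rewrite IH by tauto. rewrite Hf by (intros ->; tauto). rewrite Cmod_0. ring. }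
  assert (A : forall l, NoDup l -> (rsum l (fun n => Cmod (f n)) <= Cmod (f k))%R).
  { induction l as [|a l IH]; simpl; intros Hn; [apply Cmod_ge_0|].
    inversion Hn; subst. destruct (Z.eq_dec a k) as [->|Hak].
    - rewrite Z0 by assumption. lra.
    - rewrite (Hf a Hak), Cmod_0. specialize (IH H2). lra. }
  apply A, NoDup_zl.
Qed.

Fixpoint box (k M : nat) : list (list Z) :=
  match k with
  | O => nil :: nil
  | S k => flat_map (fun m => map (cons m) (box k M)) (zl M)
  end.

Lemma lsum_flat_map {I J : Type} (h : J -> list I) (l : list J) (f : I -> C) :
  lsum (flat_map h l) f = lsum l (fun j => lsum (h j) f).
Proof. induction l as [|j l IH]; simpl; [reflexivity|rewrite lsum_app, IH; reflexivity]. Qed.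

Lemma rsum_flat_map {I J : Type} (h : J -> list I) (l : list J) (f : I -> R) :
  rsum (flat_map h l) f = rsum l (fun j => rsum (h j) f).
Proof. induction l as [|j l IH]; simpl; [reflexivity|rewrite rsum_app, IH; reflexivity]. Qed.

Lemma boxsum_lsum (k M : nat) (f : list Z -> C) : boxsum k M f = lsum (box k M) f.
Proof.
  revert f. induction k as [|k IH]; intros f; simpl; [ring|].
  rewrite zsum_lsum, lsum_flat_map. apply lsum_ext. intros m _.
  rewrite lsum_map. apply IH.
Qed.

Lemma in_box (k M : nat) (l : list Z) :
  In l (box k M) <-> List.length l = k /\ List.Forall (fun m => In m (zl M)) l.
Proof.
  revert l. induction k as [|k IH]; intros l; simpl.
  - split.
    + intros [<-|[]]. auto.
    + intros [H _]. apply length_zero_iff_nil in H. auto.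
  - rewrite in_flat_map. split.
    + intros [m [Hm H]]. apply in_map_iff in H. destruct H as [l' [<- Hl']].
      apply IH in Hl'. simpl. split; [f_equal; tauto|constructor; tauto].
    + intros [H1 H2]. destruct l as [|m l]; [discriminate|].
      inversion H2; subst. exists m. split; [assumption|].
      apply in_map. apply IH. simpl in H1. split; [lia|assumption].
Qed.

Lemma NoDup_box (k M : nat) : NoDup (box k M).
Proof.
  induction k as [|k IH]; simpl; [repeat constructor; intros []|].
  generalize (NoDup_zl M). generalize (zl M). induction l as [|m l IHl]; simpl; intros Hn.
  - constructor.
  - inversion Hn; subst. apply NoDup_app.
    + apply NoDup_map_NoDup_ForallPairs; [|assumption]. intros a b _ _ H. congruence.
    + auto.
    + intros x Hx Hx'. apply in_map_iff in Hx. destruct Hx as [y [<- _]].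
      apply in_flat_map in Hx'. destruct Hx' as [m' [Hm' Hx']].
      apply in_map_iff in Hx'. destruct Hx' as [y' [E _]]. congruence.
Qed.

Lemma exhaustion_box (k : nat) : exhaustion (box k).
Proof.
  apply exhaustion_of_incl; [apply NoDup_box|].
  intros K M H l. rewrite !in_box. intros [H1 H2]. split; [assumption|].
  eapply Forall_impl; [|exact H2]. intros m Hm. apply in_zl in Hm. apply in_zl. lia.
Qed.

(** * Growth of functions on the integers *)

Definition zpow (r : R) (n : Z) : R := (r ^ Z.abs_nat n)%R.

Lemma rsum_zpow_le (r : R) (M : nat) : (0 <= r < 1)%R -> (rsum (zl M) (zpow r) <= 2 / (1 - r))%R.
Proof.
  intros Hr.
  (* The partial sum is exactly (1 + r - 2 r^(M+1)) / (1 - r); replacing 1 + r by 2 keeps the same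
     increment from M to M + 1. *)
  assert (A : (rsum (zl M) (zpow r) <= (2 - 2 * r ^ (M + 1)) / (1 - r))%R).
  { induction M as [|M IH].
    - unfold zl, zpow. simpl. apply (Rmult_le_reg_r (1 - r)); [lra|].
      unfold Rdiv. rewrite Rmult_assoc, Rinv_l by lra. lra.
    - assert (P : Permutation (zl (S M)) ((- Z.of_nat (S M))%Z :: Z.of_nat (S M) :: zl M)).
      { apply NoDup_Permutation; [apply NoDup_zl| |].
        - constructor; [|constructor; [|apply NoDup_zl]].
          + intros [H|H]; [lia|apply in_zl in H; lia].
          + intros H. apply in_zl in H. lia.
        - intros m. cbn [In]. rewrite !in_zl. lia. }
      rewrite (rsum_perm _ _ _ P). cbn [rsum]. unfold zpow at 1 2.
      replace (Z.abs_nat (- Z.of_nat (S M))) with (M + 1)%nat by lia.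
      replace (Z.abs_nat (Z.of_nat (S M))) with (M + 1)%nat by lia.
      replace ((2 - 2 * r ^ (S M + 1)) / (1 - r))%R
        with (r ^ (M + 1) + r ^ (M + 1) + (2 - 2 * r ^ (M + 1)) / (1 - r))%R.
      + lra.
      + replace (S M + 1)%nat with (S (M + 1)) by lia. simpl. field. lra. }
  eapply Rle_trans; [exact A|]. apply Rmult_le_compat_r.
  - left. apply Rinv_0_lt_compat. lra.
  - assert (0 <= r ^ (M + 1))%R by (apply pow_le; lra). lra.
Qed.

Lemma rsummable_zpow (K r : R) :
  (0 <= K)%R -> (0 <= r < 1)%R -> rsummable zl (fun n => K * zpow r n)%R.
Proof.
  intros HK Hr. split.
  - intros n. apply Rmult_le_pos; [assumption|]. apply pow_le. lra.
  - exists (K * (2 / (1 - r)))%R. intros M. rewrite rsum_scal.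
    apply Rmult_le_compat_l; [assumption|]. now apply rsum_zpow_le.
Qed.

(** The property of q^(n^2/2) that survives multiplication by any [exp_bounded] function, by
    [superexp_mult]; a decay rate fixed in advance would not. *)
Definition superexp_small (f : Z -> C) : Prop :=
  forall r, (0 < r)%R -> exists K, forall n, (Cmod (f n) <= K * zpow r n)%R.

Definition exp_bounded (f : Z -> C) : Prop :=
  exists K A, (1 <= A)%R /\ forall n, (Cmod (f n) <= K * zpow A n)%R.

Lemma bound_const_nonneg (f : Z -> C) (K r : R) :
  (forall n, (Cmod (f n) <= K * zpow r n)%R) -> (0 <= K)%R.
Proof.
  intros H. specialize (H 0%Z). unfold zpow in H. simpl in H. pose proof (Cmod_ge_0 (f 0%Z)). lra.
Qed.

Lemma superexp_summable (f : Z -> C) : superexp_small f -> summable zl f.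
Proof.
  intros H. destruct (H (/ 2)%R) as [K HK]; [lra|].
  apply (dominated_summable zl f (fun n => K * zpow (/ 2) n)%R).
  - intros M n _. apply HK.
  - apply rsummable_zpow; [|lra]. apply (bound_const_nonneg f K _ HK).
Qed.

Lemma superexp_ext (f g : Z -> C) : (forall n, f n = g n) -> superexp_small f -> superexp_small g.
Proof. intros E H r Hr. destruct (H r Hr) as [K HK]. exists K. intros n. rewrite <- E. auto. Qed.

Lemma superexp_mult (f g : Z -> C) :
  superexp_small f -> exp_bounded g -> superexp_small (fun n => f n * g n).
Proof.
  intros Hf [K [A [HA HK]]] r Hr.
  destruct (Hf (r / A)%R) as [K' HK']; [apply Rdiv_lt_0_compat; lra|].
  exists (K' * K)%R. intros n. rewrite Cmod_mult.
  replace (K' * K * zpow r n)%R with ((K' * zpow (r / A) n) * (K * zpow A n))%R.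
  - apply Rmult_le_compat; auto using Cmod_ge_0.
  - unfold zpow. replace (r ^ Z.abs_nat n)%R with ((r / A) ^ Z.abs_nat n * A ^ Z.abs_nat n)%R.
    + ring.
    + rewrite <- Rpow_mult_distr. f_equal. field. lra.
Qed.

Lemma exp_bounded_mult (f g : Z -> C) :
  exp_bounded f -> exp_bounded g -> exp_bounded (fun n => f n * g n).
Proof.
  intros [K [A [HA HK]]] [K' [A' [HA' HK']]].
  exists (K * K')%R, (A * A')%R. split; [nra|]. intros n. rewrite Cmod_mult.
  replace (K * K' * zpow (A * A') n)%R with ((K * zpow A n) * (K' * zpow A' n))%R.
  - apply Rmult_le_compat; auto using Cmod_ge_0.
  - unfold zpow. rewrite Rpow_mult_distr. ring.
Qed.

Lemma exp_bounded_of_bounded (f : Z -> C) (K : R) :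
  (forall n, (Cmod (f n) <= K)%R) -> exp_bounded f.
Proof.
  intros H. exists K, 1%R. split; [lra|]. intros n. unfold zpow. rewrite pow1.
  specialize (H n). lra.
Qed.

Lemma superexp_scal (c : C) (f : Z -> C) : superexp_small f -> superexp_small (fun n => c * f n).
Proof.
  intros H. apply (superexp_ext (fun n => f n * c)); [intros; ring|].
  apply superexp_mult; [assumption|]. apply (exp_bounded_of_bounded _ (Cmod c)). intros; lra.
Qed.

(** * The exponential e(w) = exp(2 pi i w) *)

Definition ee (w : C) : C := cexp (2 * CPI * Ci * w).

Lemma cexp_plus (a b : C) : cexp (a + b) = cexp a * cexp b.
Proof.
  unfold cexp, Cmult, Cplus, Re, Im. simpl.
  rewrite exp_plus, cos_plus, sin_plus. apply f_equal2; ring.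
Qed.

Lemma Cmod_cexp (a : C) : Cmod (cexp a) = exp (Re a).
Proof.
  unfold Cmod, cexp. simpl.
  replace ((exp (Re a) * cos (Im a)) * ((exp (Re a) * cos (Im a)) * 1) +
    (exp (Re a) * sin (Im a)) * ((exp (Re a) * sin (Im a)) * 1))%R
    with (Rsqr (exp (Re a)) * (Rsqr (sin (Im a)) + Rsqr (cos (Im a))))%R by (unfold Rsqr; ring).
  rewrite sin2_cos2, Rmult_1_r. apply sqrt_Rsqr. left. apply exp_pos.
Qed.

Lemma ee_plus (a b : C) : ee (a + b) = ee a * ee b.
Proof. unfold ee. rewrite <- cexp_plus. f_equal. ring. Qed.

Lemma ee_0 : ee 0 = 1.
Proof.
  unfold ee. replace (2 * CPI * Ci * 0) with (RtoC 0) by ring.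
  unfold cexp. simpl. rewrite exp_0, cos_0, sin_0.
  unfold RtoC. apply f_equal2; ring.
Qed.

Lemma Cmod_ee (w : C) : Cmod (ee w) = exp (- (2 * PI * Im w)).
Proof.
  unfold ee. rewrite Cmod_cexp. f_equal.
  unfold CPI, Ci, RtoC, Re, Im, Cmult. simpl. ring.
Qed.

Lemma ee_neq_0 (w : C) : ee w <> 0.
Proof. intros H. pose proof (exp_pos (- (2 * PI * Im w))). rewrite <- Cmod_ee, H, Cmod_0 in H0. lra. Qed.

Lemma ee_opp (w : C) : ee (- w) = / ee w.
Proof.
  assert (H : ee (- w) * ee w = 1).
  { rewrite <- ee_plus. replace (- w + w) with (RtoC 0) by ring. apply ee_0. }
  replace (ee (- w)) with (ee (- w) * ee w * / ee w) by (field; apply ee_neq_0).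
  rewrite H. ring.
Qed.

Lemma ee_minus (a b : C) : ee (a - b) = ee a / ee b.
Proof. unfold Cminus. rewrite ee_plus, ee_opp. reflexivity. Qed.

Lemma IZC_plus (a b : Z) : IZC (a + b) = IZC a + IZC b.
Proof. unfold IZC. rewrite plus_IZR. apply RtoC_plus. Qed.

Lemma IZC_minus (a b : Z) : IZC (a - b) = IZC a - IZC b.
Proof. unfold IZC. rewrite minus_IZR. apply RtoC_minus. Qed.

Lemma IZC_opp (a : Z) : IZC (- a) = - IZC a.
Proof. unfold IZC. rewrite opp_IZR. apply RtoC_opp. Qed.

Lemma ee_half : ee (1 / 2) = - (1).
Proof.
  unfold ee. replace (2 * CPI * Ci * (1 / 2)) with (CPI * Ci) by field.
  unfold cexp, CPI, Ci, RtoC, Cmult, Re, Im. simpl.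
  replace (PI * 0 - 0 * 1)%R with 0%R by ring. replace (PI * 1 + 0 * 0)%R with PI by ring.
  rewrite exp_0, cos_PI, sin_PI. unfold Copp. simpl. apply f_equal2; ring.
Qed.

Lemma signZ_succ (n : Z) : signZ (n + 1) = - signZ n.
Proof.
  unfold signZ. rewrite Z.even_add. destruct (Z.even n); simpl; ring.
Qed.

Lemma signZ_pred (n : Z) : signZ (n - 1) = - signZ n.
Proof.
  unfold signZ. rewrite Z.even_sub. destruct (Z.even n); simpl; ring.
Qed.

(** Moves signs into the exponent, so that comparing two terms means comparing two polynomials in
    the summation indices. *)
Lemma signZ_ee (n : Z) : signZ n = ee (IZC n / 2).
Proof.
  revert n. apply Z.peano_ind.
  - replace (IZC 0 / 2) with (RtoC 0) by (unfold IZC; field). rewrite ee_0. reflexivity.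
  - intros n IH. replace (Z.succ n) with (n + 1)%Z by lia. rewrite signZ_succ, IH, IZC_plus.
    replace ((IZC n + IZC 1) / 2) with (IZC n / 2 + 1 / 2) by (unfold IZC; field).
    rewrite ee_plus, ee_half. ring.
  - intros n IH. replace (Z.pred n) with (n - 1)%Z by lia. rewrite signZ_pred, IH, IZC_minus.
    replace ((IZC n - IZC 1) / 2) with (IZC n / 2 - 1 / 2) by (unfold IZC; field).
    rewrite ee_minus, ee_half. field.
Qed.

Lemma ee_IZC (n : Z) : ee (IZC n) = 1.
Proof.
  replace (IZC n) with (IZC n / 2 + IZC n / 2) by field.
  rewrite ee_plus, <- signZ_ee. unfold signZ. destruct (Z.even n); ring.
Qed.

(** The modulus forces Im w = 0; then cos(2 pi x) = 1 - 2 sin(pi x)^2 turns the condition into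
    sin(pi x) = 0. *)
Lemma ee_eq_1 (w : C) : ee w = 1 -> exists k, w = IZC k.
Proof.
  intros H. assert (H1 := Cmod_ee w). rewrite H, Cmod_1 in H1.
  assert (Hi : Im w = 0%R).
  { assert (E : (- (2 * PI * Im w))%R = 0%R).
    { apply exp_inv. rewrite exp_0. auto. }
    pose proof PI_RGT_0. apply Rmult_eq_reg_l with (2 * PI)%R; lra. }
  assert (Hc : cos (2 * (PI * Re w)) = 1%R).
  { apply (f_equal Re) in H. unfold ee, cexp in H. simpl in H.
    unfold CPI, Ci, RtoC, Cmult, Re, Im in *. simpl in *.
    rewrite Hi in H.
    match type of H with (exp ?a * cos ?b)%R = _ =>
      replace a with 0%R in H by ring; replace b with (2 * (PI * fst w))%R in H by ring end.
    rewrite exp_0 in H. lra. }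
  rewrite cos_2a_sin in Hc.
  assert (Hs : sin (PI * Re w) = 0%R) by nra.
  apply sin_eq_0_0 in Hs. destruct Hs as [k Hk]. exists k.
  assert (Hr : Re w = IZR k).
  { pose proof PI_RGT_0. apply Rmult_eq_reg_l with PI; lra. }
  destruct w as [a b]. unfold Re, Im in *. simpl in *. subst. reflexivity.
Qed.

Lemma qpow_ee (tau b : C) : qpow tau b = ee (b * tau).
Proof. unfold qpow, ee. change Defs.Ci with Ci. f_equal. ring. Qed.

Lemma qq_ee (tau : C) : qq tau = ee tau.
Proof. unfold qq. rewrite qpow_ee. f_equal. ring. Qed.

Lemma ee_pow (w : C) (n : nat) : ee w ^ n = ee (IZC (Z.of_nat n) * w).
Proof.
  induction n as [|n IH].
  - simpl. rewrite <- ee_0. f_equal. unfold IZC. simpl. ring.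
  - rewrite Cpow_S, IH, <- ee_plus. f_equal.
    replace (Z.of_nat (S n)) with (Z.of_nat n + 1)%Z by lia. rewrite IZC_plus. unfold IZC. ring.
Qed.

Lemma Cmod_ee_tau_lt_1 (tau : C) : (0 < Im tau)%R -> (Cmod (ee tau) < 1)%R.
Proof.
  intros H. rewrite Cmod_ee, <- exp_0. apply exp_increasing.
  pose proof PI_RGT_0. assert (0 < PI * Im tau)%R by (apply Rmult_lt_0_compat; lra). lra.
Qed.

Lemma Im_plus (a b : C) : Im (a + b) = (Im a + Im b)%R.
Proof. reflexivity. Qed.

Lemma Im_IZC_mult (n : Z) (c : C) : Im (IZC n * c) = (IZR n * Im c)%R.
Proof. unfold IZC, RtoC, Im, Cmult. simpl. ring. Qed.

Lemma exp_IZR_le_zpow (b : R) (n : Z) : (exp (b * IZR n) <= zpow (exp (Rabs b)) n)%R.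
Proof.
  unfold zpow. rewrite <- Rpower_pow by apply exp_pos. unfold Rpower. rewrite ln_exp.
  assert (b * IZR n <= INR (Z.abs_nat n) * Rabs b)%R.
  { rewrite INR_IZR_INZ, Zabs2Nat.id_abs, abs_IZR.
    pose proof (Rle_abs (b * IZR n)). rewrite Rabs_mult in H. lra. }
  destruct H as [H|H]; [left; now apply exp_increasing|rewrite H; lra].
Qed.

Lemma exp_bounded_ee (w : Z -> C) (c d : C) :
  (forall n, w n = c * IZC n + d) -> exp_bounded (fun n => ee (w n)).
Proof.
  intros Hw. exists (exp (- (2 * PI * Im d))), (exp (Rabs (- (2 * PI * Im c)))). split.
  - rewrite <- exp_0. pose proof (Rabs_pos (- (2 * PI * Im c))).
    destruct H as [H|H]; [left; now apply exp_increasing|rewrite H; lra].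
  - intros n. rewrite Cmod_ee, Hw.
    replace (- (2 * PI * Im (c * IZC n + d)))%R
      with (- (2 * PI * Im d) + - (2 * PI * Im c) * IZR n)%R.
    2:{ rewrite (Cmult_comm c), Im_plus, Im_IZC_mult. ring. }
    rewrite exp_plus. apply Rmult_le_compat_l; [left; apply exp_pos|]. apply exp_IZR_le_zpow.
Qed.

Lemma superexp_ee (w : Z -> C) (t c d : C) :
  (0 < Im t)%R -> (forall n, w n = t * (IZC n * IZC n) / 2 + c * IZC n + d) ->
  superexp_small (fun n => ee (w n)).
Proof.
  intros Ht Hw r Hr.
  set (p := (PI * Im t)%R).
  assert (Hp : (0 < p)%R) by (apply Rmult_lt_0_compat; [apply PI_RGT_0|assumption]).
  set (b := (2 * PI * Im c)%R).
  set (s := (Rabs b + Rabs (ln r))%R).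
  (* The maximum of s x - p x^2 over real x is s^2/(4p). Here x = |n|, and s collects the linear
     coefficient and the logarithm of the rate r. *)
  exists (exp (- (2 * PI * Im d) + s * s / (4 * p)))%R. intros n.
  rewrite Cmod_ee, Hw. unfold zpow. rewrite <- Rpower_pow by assumption. unfold Rpower.
  rewrite <- exp_plus.
  assert (A : (- (2 * PI * Im (t * (IZC n * IZC n) / 2 + c * IZC n + d)) <=
    - (2 * PI * Im d) + s * s / (4 * p) + INR (Z.abs_nat n) * ln r)%R).
  { replace (- (2 * PI * Im (t * (IZC n * IZC n) / 2 + c * IZC n + d)))%R
      with (- (2 * PI * Im d) - p * (IZR n * IZR n) - b * IZR n)%R.
    2:{ replace (t * (IZC n * IZC n) / 2) with (IZC n * (IZC n * (t * / 2))) by (unfold Cdiv; ring).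
        rewrite (Cmult_comm c), !Im_plus, !Im_IZC_mult.
        replace (Im (t * / 2)) with (Im t * / 2)%R.
        - unfold p, b. field.
        - unfold Im, RtoC, Cinv, Cmult. simpl. field. }
    rewrite INR_IZR_INZ, Zabs2Nat.id_abs, abs_IZR.
    set (x := Rabs (IZR n)).
    assert (Hx : (IZR n * IZR n = x * x)%R).
    { unfold x. rewrite <- Rabs_mult. symmetry. apply Rabs_pos_eq. nra. }
    rewrite Hx.
    assert (Hx0 : (0 <= x)%R) by apply Rabs_pos.
    assert (H1 : (- b * IZR n <= Rabs b * x)%R).
    { unfold x. rewrite <- Rabs_mult. pose proof (Rle_abs (- (b * IZR n))).
      rewrite Rabs_Ropp in H. lra. }
    assert (H2 : (- ln r * x <= Rabs (ln r) * x)%R).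
    { apply Rmult_le_compat_r; [assumption|]. rewrite <- Rabs_Ropp. apply Rle_abs. }
    assert (H3 : (s * x - p * (x * x) <= s * s / (4 * p))%R).
    { assert (0 <= (s - 2 * p * x) * (s - 2 * p * x) / (4 * p))%R.
      { apply Rmult_le_pos; [apply Rle_0_sqr|]. left. apply Rinv_0_lt_compat. lra. }
      replace ((s - 2 * p * x) * (s - 2 * p * x) / (4 * p))%R
        with (s * s / (4 * p) - s * x + p * (x * x))%R in H by (field; lra). lra. }
    unfold s in H3 at 1. lra. }
  destruct A as [A|A]; [left; now apply exp_increasing|rewrite A; lra].
Qed.

(** * The lattice and the denominators 1 - e(u + n tau) *)

Lemma lattice_shift (tau u : C) (k : Z) : ~ in_lattice tau u -> ~ in_lattice tau (u + IZC k * tau).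
Proof.
  intros H [a [b Hab]]. apply H. exists a, (b - k)%Z.
  replace u with (u + IZC k * tau - IZC k * tau) by ring. rewrite Hab, minus_IZR, RtoC_minus.
  unfold IZC. ring.
Qed.

Lemma lattice_opp (tau u : C) : ~ in_lattice tau u -> ~ in_lattice tau (- u).
Proof.
  intros H [a [b Hab]]. apply H. exists (- a)%Z, (- b)%Z.
  replace u with (- - u) by ring. rewrite Hab, !opp_IZR, !RtoC_opp. ring.
Qed.

Lemma one_minus_ee_neq_0 (tau u : C) (n : Z) : ~ in_lattice tau u -> 1 - ee (u + IZC n * tau) <> 0.
Proof.
  intros H E. apply (lattice_shift tau u n) in H. apply H.
  destruct (ee_eq_1 (u + IZC n * tau)) as [k Hk].
  { replace (ee _) with (1 - (1 - ee (u + IZC n * tau))) by ring. rewrite E. ring. }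
  exists k, 0%Z. rewrite Hk. unfold IZC. ring.
Qed.

(* Away from finitely many [n] the numbers [e(u + n tau)] are either at most 1/2 or at
   least 2 in modulus. *)
Lemma inv_one_minus_ee_bounded (tau u : C) :
  (0 < Im tau)%R -> exists K, forall n, 1 - ee (u + IZC n * tau) <> 0 ->
  (Cmod (/ (1 - ee (u + IZC n * tau))) <= K)%R.
Proof.
  intros Ht.
  pose proof PI_RGT_0 as Hpi.
  set (p := (2 * PI * Im tau)%R).
  assert (Hp : (0 < p)%R) by (apply Rmult_lt_0_compat; lra).
  set (b := (2 * PI * Im u)%R).
  assert (Hmod : forall n, Cmod (ee (u + IZC n * tau)) = exp (- b - p * IZR n)).
  { intros n. rewrite Cmod_ee, Im_plus, Im_IZC_mult. f_equal. unfold b, p. ring. }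
  (* For |n| > N the exponent - b - p n is at most -1 or at least 1, and exp 1 >= 2 then gives the
     two bounds. *)
  assert (exists N : Z, ((Rabs b + 1) / p <= IZR N)%R) as [N HN].
  { exists (up ((Rabs b + 1) / p)). left. apply archimed. }
  assert (HN' : (Rabs b + 1 <= p * IZR N)%R).
  { apply (Rmult_le_compat_l p) in HN; [|lra].
    replace (p * ((Rabs b + 1) / p))%R with (Rabs b + 1)%R in HN by (field; lra). exact HN. }
  assert (E1 : (2 <= exp 1)%R) by (pose proof (exp_ineq1_le 1); lra).
  assert (Fin : forall L : list Z, exists K, forall n, In n L ->
     1 - ee (u + IZC n * tau) <> 0 -> (Cmod (/ (1 - ee (u + IZC n * tau))) <= K)%R).
  { induction L as [|m L [K HK]]; [exists 0%R; intros n []|].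
    exists (Rmax (Cmod (/ (1 - ee (u + IZC m * tau)))) K). intros n [<-|Hn] H0.
    - apply Rmax_l.
    - eapply Rle_trans; [apply HK; assumption|apply Rmax_r]. }
  destruct (Fin (zl (Z.to_nat N))) as [K HK].
  exists (Rmax K 2). intros n H0.
  destruct (Z_le_gt_dec (Z.abs n) (Z.of_nat (Z.to_nat N))) as [Hn|Hn].
  { eapply Rle_trans; [apply HK; [now apply in_zl|assumption]|apply Rmax_l]. }
  eapply Rle_trans; [|apply Rmax_r].
  rewrite Cmod_inv by assumption.
  assert (HNn : (N < Z.abs n)%Z) by lia.
  assert (Hlow : (/ 2 <= Cmod (1 - ee (u + IZC n * tau)))%R).
  { pose proof (Rle_abs b) as B1. pose proof (Rle_abs (- b)) as B2. rewrite Rabs_Ropp in B2.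
    pose proof (IZR_lt _ _ HNn) as B3.
    destruct (Z_le_gt_dec 0 n) as [Hs|Hs].
    - rewrite Z.abs_eq in B3 by lia.
      assert (exp (- b - p * IZR n) <= / 2)%R.
      { apply Rle_trans with (exp (- (1))).
        - left. apply exp_increasing. assert (p * IZR N < p * IZR n)%R by nra. lra.
        - rewrite exp_Ropp. apply Rinv_le_contravar; lra. }
      rewrite <- Hmod in H.
      pose proof (Cmod_triangle (1 - ee (u + IZC n * tau)) (ee (u + IZC n * tau))) as T.
      replace (1 - ee (u + IZC n * tau) + ee (u + IZC n * tau)) with (RtoC 1) in T by ring.
      rewrite Cmod_1 in T. lra.
    - rewrite Z.abs_neq, opp_IZR in B3 by lia.
      assert (2 <= exp (- b - p * IZR n))%R.
      { apply Rle_trans with (exp 1); [assumption|].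
        left. apply exp_increasing. assert (p * IZR N < p * - IZR n)%R by nra. lra. }
      rewrite <- Hmod in H.
      pose proof (Cmod_triangle (1 - ee (u + IZC n * tau)) (- (1))) as T.
      replace (1 - ee (u + IZC n * tau) + - (1)) with (- ee (u + IZC n * tau)) in T by ring.
      rewrite !Cmod_opp, Cmod_1 in T. lra. }
  replace 2%R with (/ / 2)%R by field. apply Rinv_le_contravar; lra.
Qed.

(** * q-Pochhammer symbols *)

(** Each factor is at most 1 + |x| |q|^j <= exp(|x| |q|^j), and the exponents form a geometric
    sum. *)
Lemma qpoch_bound (x q : C) (n : nat) :
  (Cmod q < 1)%R ->
  (Cmod (qpoch x q n) <= exp (Cmod x * (1 - Cmod q ^ n) / (1 - Cmod q)))%R.
Proof.
  intros Hq. pose proof (Cmod_ge_0 q). induction n as [|n IH].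
  - unfold qpoch. simpl. rewrite Cmod_1. replace (Cmod x * (1 - 1) / (1 - Cmod q))%R with 0%R.
    + rewrite exp_0. lra.
    + field. lra.
  - unfold qpoch in *. simpl cprod. rewrite Cmod_mult.
    replace (Cmod x * (1 - Cmod q ^ S n) / (1 - Cmod q))%R
      with (Cmod x * (1 - Cmod q ^ n) / (1 - Cmod q) + Cmod x * Cmod q ^ n)%R.
    + rewrite exp_plus. apply Rmult_le_compat; try apply Cmod_ge_0; [assumption|].
      eapply Rle_trans; [|apply exp_ineq1_le].
      eapply Rle_trans; [apply Cmod_triangle|].
      rewrite Cmod_1, Cmod_opp, Cmod_mult, Cmod_pow. lra.
    + simpl. field. lra.
Qed.

Definition qpoch_majorant (x q : C) : R := exp (Cmod x / (1 - Cmod q)).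

Lemma qpoch_le_majorant (x q : C) (n : nat) :
  (Cmod q < 1)%R -> (Cmod (qpoch x q n) <= qpoch_majorant x q)%R.
Proof.
  intros Hq. eapply Rle_trans; [now apply qpoch_bound|].
  assert (A : (Cmod x * (1 - Cmod q ^ n) / (1 - Cmod q) <= Cmod x / (1 - Cmod q))%R).
  { pose proof (Cmod_ge_0 q). pose proof (Cmod_ge_0 x).
    apply Rmult_le_compat_r; [left; apply Rinv_0_lt_compat; lra|].
    assert (0 <= Cmod q ^ n)%R by (apply pow_le; lra). nra. }
  unfold qpoch_majorant. destruct A as [A|A]; [left; now apply exp_increasing|rewrite A; lra].
Qed.

Lemma qpoch_tends (x q : C) : (Cmod q < 1)%R -> Ctends (qpoch x q) (qpoch_inf x q).
Proof.
  intros Hq. apply Ccauchy_tends.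
  pose proof (Cmod_ge_0 q) as Hq0. pose proof (Cmod_ge_0 x) as Hx0.
  set (B := qpoch_majorant x q). assert (HB : (0 < B)%R) by apply exp_pos.
  (* Consecutive products differ by at most B |x| |q|^j; these bounds add up to a telescoping
     geometric sum. *)
  assert (A : forall n k, (Cmod (qpoch x q (n + k) - qpoch x q n) <=
     B * Cmod x / (1 - Cmod q) * (Cmod q ^ n - Cmod q ^ (n + k)))%R).
  { intros n k. induction k as [|k IH].
    - rewrite Nat.add_0_r. replace (qpoch x q n - qpoch x q n) with (RtoC 0) by ring.
      rewrite Cmod_0. lra.
    - replace (n + S k)%nat with (S (n + k)) by lia.
      eapply Rle_trans; [apply (Cmod_triangle_sub _ (qpoch x q (n + k)))|].
      assert (S1 : (Cmod (qpoch x q (S (n + k)) - qpoch x q (n + k)) <=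
         B * (Cmod x * Cmod q ^ (n + k)))%R).
      { replace (qpoch x q (S (n + k)) - qpoch x q (n + k))
          with (qpoch x q (n + k) * - (x * q ^ (n + k))) by (unfold qpoch; simpl; ring).
        rewrite Cmod_mult, Cmod_opp, Cmod_mult, Cmod_pow.
        apply Rmult_le_compat_r; [|now apply qpoch_le_majorant].
        apply Rmult_le_pos; [assumption|apply pow_le; assumption]. }
      simpl (Cmod q ^ S (n + k))%R.
      replace (B * Cmod x / (1 - Cmod q) * (Cmod q ^ n - Cmod q * Cmod q ^ (n + k)))%R
        with (B * (Cmod x * Cmod q ^ (n + k)) +
          B * Cmod x / (1 - Cmod q) * (Cmod q ^ n - Cmod q ^ (n + k)))%R by (field; lra).
      lra. }
  intros eps He.
  destruct (geometric_small (B * Cmod x / (1 - Cmod q)) (Cmod q) eps (conj Hq0 Hq) He)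
    as [n0 Hn0].
  exists n0. intros n m Hn Hm. specialize (Hn0 n Hn). cbv beta in Hn0.
  replace m with (n + (m - n))%nat by lia.
  eapply Rle_lt_trans; [apply A|].
  assert (0 <= B * Cmod x / (1 - Cmod q))%R.
  { apply Rmult_le_pos; [nra|left; apply Rinv_0_lt_compat; lra]. }
  assert (0 <= Cmod q ^ (n + (m - n)))%R by (apply pow_le; assumption).
  match type of Hn0 with (Rabs ?a < _)%R => pose proof (Rle_abs a) end. nra.
Qed.

Lemma qpoch_S_left (x q : C) (n : nat) : qpoch x q (S n) = (1 - x) * qpoch (x * q) q n.
Proof.
  unfold qpoch. induction n as [|n IH]; [simpl; ring|].
  change (cprod (S (S n)) (fun j => 1 - x * q ^ j))
    with (cprod (S n) (fun j => 1 - x * q ^ j) * (1 - x * q ^ (S n))).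
  rewrite IH. simpl. ring.
Qed.

Lemma qpoch_inf_step (x q : C) :
  (Cmod q < 1)%R -> qpoch_inf x q = (1 - x) * qpoch_inf (x * q) q.
Proof.
  intros Hq. apply Clim_eq.
  pose proof (Ctends_scal (1 - x) _ _ (qpoch_tends (x * q) q Hq)) as T.
  intros eps He. destruct (T eps He) as [n0 Hn]. exists (S n0). intros n Hle.
  destruct n as [|n]; [lia|]. rewrite qpoch_S_left. apply Hn. lia.
Qed.

Lemma qpoch_inf_split (x q : C) (n : nat) :
  (Cmod q < 1)%R -> qpoch_inf x q = qpoch x q n * qpoch_inf (x * q ^ n) q.
Proof.
  intros Hq. induction n as [|n IH].
  - unfold qpoch. simpl. rewrite Cmult_1_r, Cmult_1_l. reflexivity.
  - rewrite IH, (qpoch_inf_step (x * q ^ n)) by assumption.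
    unfold qpoch. simpl. replace (x * q ^ n * q) with (x * (q * q ^ n)) by ring. ring.
Qed.

Lemma qpoch_inf_le_majorant (x q : C) :
  (Cmod q < 1)%R -> (Cmod (qpoch_inf x q) <= qpoch_majorant x q)%R.
Proof.
  intros Hq. eapply Ctends_Cmod_le; [now apply qpoch_tends|].
  intros n. now apply qpoch_le_majorant.
Qed.

Lemma qpoch_neq_0 (x q : C) (n : nat) : (forall j, 1 - x * q ^ j <> 0) -> qpoch x q n <> 0.
Proof.
  intros H. unfold qpoch. induction n as [|n IH]; simpl.
  - intros E. injection E. lra.
  - apply Cmult_neq_0; auto.
Qed.

(** Finitely many nonzero factors are split off, until the numbers |y| |q|^j sum to at most 1/2. The
    Weierstrass inequality (a product of factors 1 - a_j is at least 1 minus the sum of the a_j)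
    then keeps the remaining products above 1/2. *)
Lemma qpoch_inf_neq_0 (x q : C) :
  (Cmod q < 1)%R -> (forall j, 1 - x * q ^ j <> 0) -> qpoch_inf x q <> 0.
Proof.
  intros Hq Hx. pose proof (Cmod_ge_0 q) as Hq0.
  assert (exists m, (Cmod (x * q ^ m) / (1 - Cmod q) <= / 2)%R) as [m Hm].
  { destruct (geometric_small (Cmod x / (1 - Cmod q)) (Cmod q) (/ 2)%R (conj Hq0 Hq))
      as [m Hm]; [lra|].
    exists m. specialize (Hm m (le_n m)). cbv beta in Hm.
    match type of Hm with (Rabs ?a < _)%R => pose proof (Rle_abs a) end.
    rewrite Cmod_mult, Cmod_pow.
    replace (Cmod x * Cmod q ^ m / (1 - Cmod q))%R
      with (Cmod x / (1 - Cmod q) * Cmod q ^ m)%R by (field; lra). lra. }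
  set (y := x * q ^ m) in *.
  assert (Hy0 := Cmod_ge_0 y).
  assert (Hyq : (Cmod y <= / 2 * (1 - Cmod q))%R).
  { apply (Rmult_le_compat_r (1 - Cmod q)) in Hm; [|lra].
    replace (Cmod y / (1 - Cmod q) * (1 - Cmod q))%R with (Cmod y) in Hm by (field; lra). exact Hm. }
  rewrite (qpoch_inf_split x q m Hq). apply Cmult_neq_0; [now apply qpoch_neq_0|].
  apply Cmod_gt_0. apply Rlt_le_trans with (/ 2)%R; [lra|].
  eapply Ctends_le_Cmod; [now apply qpoch_tends|].
  assert (A : forall n, (1 - Cmod y / (1 - Cmod q) * (1 - Cmod q ^ n) <= Cmod (qpoch y q n))%R).
  { intros n. induction n as [|n IH].
    - unfold qpoch. simpl. rewrite Cmod_1. lra.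
    - replace (qpoch y q (S n)) with (qpoch y q n * (1 - y * q ^ n)) by (unfold qpoch; simpl; ring).
      rewrite Cmod_mult.
      assert (0 <= Cmod q ^ n)%R by (apply pow_le; assumption).
      assert (Cmod q ^ n <= 1)%R by (rewrite <- (pow1 n); apply pow_incr; lra).
      assert (F : (1 - Cmod y * Cmod q ^ n <= Cmod (1 - y * q ^ n))%R).
      { pose proof (Cmod_triangle (1 - y * q ^ n) (y * q ^ n)) as T.
        replace (1 - y * q ^ n + y * q ^ n) with (RtoC 1) in T by ring.
        rewrite Cmod_1, Cmod_mult, Cmod_pow in T. lra. }
      set (s := (Cmod y / (1 - Cmod q) * (1 - Cmod q ^ n))%R) in *.
      assert (Hs : (0 <= s <= / 2)%R).
      { unfold s. assert (0 <= Cmod y / (1 - Cmod q))%R.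
        { apply Rmult_le_pos; [assumption|left; apply Rinv_0_lt_compat; lra]. }
        split; [apply Rmult_le_pos; lra|]. nra. }
      replace (Cmod y / (1 - Cmod q) * (1 - Cmod q ^ S n))%R with (s + Cmod y * Cmod q ^ n)%R
        by (unfold s; simpl; field; lra).
      assert (Hyn : (0 <= Cmod y * Cmod q ^ n <= / 2)%R) by (split; nra).
      apply Rle_trans with ((1 - s) * (1 - Cmod y * Cmod q ^ n))%R; [nra|].
      apply Rmult_le_compat; lra. }
  intros n. eapply Rle_trans; [|apply A].
  assert (0 <= Cmod q ^ n)%R by (apply pow_le; assumption).
  assert (0 <= Cmod y / (1 - Cmod q))%R.
  { apply Rmult_le_pos; [assumption|left; apply Rinv_0_lt_compat; lra]. }
  nra.
Qed.

Lemma Csum_fubini_Z (f : Z -> Z -> C) (g : Z -> R) :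
  rsummable zl g -> (forall i M, (rsum (zl M) (fun j => Cmod (f i j)) <= g i)%R) ->
  Ctends (fun n => lsum (zl n) (fun j => Csum zl (fun i => f i j)))
    (Csum zl (fun i => Csum zl (f i))).
Proof.
  intros Hg Hb. apply (Csum_fubini zl zl f g); try apply exhaustion_zl; try assumption.
  (* A single entry is at most the sum over the interval of radius |j|, which [Hb] bounds. *)
  intros j M i _. eapply Rle_trans; [|apply (Hb i (Z.abs_nat j))].
  destruct (in_split j (zl (Z.abs_nat j))) as [l1 [l2 ->]].
  { apply in_zl. lia. }
  rewrite rsum_app. simpl.
  pose proof (rsum_nonneg l1 (fun j => Cmod (f i j)) (fun j => Cmod_ge_0 _)).
  pose proof (rsum_nonneg l2 (fun j => Cmod (f i j)) (fun j => Cmod_ge_0 _)). lra.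
Qed.

(** The shift s(i) is free, so it can be chosen to collect, for fixed j, the terms with one power of
    the variable: the product of two Laurent series is regrouped by powers. *)
Lemma Csum_product (c t : Z -> C) (s : Z -> Z) :
  summable zl c -> summable zl t ->
  Ctends (fun n => lsum (zl n) (fun j => Csum zl (fun i => c i * t (j + s i)%Z)))
    (Csum zl c * Csum zl t).
Proof.
  intros Hc Ht. destruct Ht as [Ht0 [T HT]].
  assert (Ht : summable zl t) by (split; eauto).
  assert (HT0 : (0 <= T)%R).
  { eapply Rle_trans; [|apply (HT 0%nat)]. apply rsum_nonneg. auto. }
  replace (Csum zl c * Csum zl t) with (Csum zl (fun i => Csum zl (fun j => c i * t (j + s i)%Z))).
  - apply (Csum_fubini_Z _ (fun i => Cmod (c i) * T)%R).
    + destruct Hc as [_ [B HB]]. split.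
      * intros i. apply Rmult_le_pos; [apply Cmod_ge_0|assumption].
      * exists (T * B)%R. intros M.
        rewrite (rsum_ext _ _ (fun i => T * Cmod (c i))%R) by (intros; ring).
        rewrite rsum_scal. now apply Rmult_le_compat_l.
    + intros i M. rewrite (rsum_ext _ _ (fun j => Cmod (c i) * Cmod (t (j + s i)%Z))%R)
        by (intros; apply Cmod_mult).
      rewrite rsum_scal. apply Rmult_le_compat_l; [apply Cmod_ge_0|].
      apply (rsum_shift_le (s i) M (fun n => Cmod (t n))); auto.
  - transitivity (Csum zl (fun i => Csum zl t * c i)).
    + apply Csum_ext. intros i. rewrite Csum_scal.
      * rewrite (Csum_shift (s i) t Ht). ring.
      * apply exhaustion_zl.
      * now apply (summable_shift (s i)).
    + rewrite Csum_scal; [ring|apply exhaustion_zl|assumption].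
Qed.

Lemma eq_of_Ctends_const (a b : C) : Ctends (fun _ => a) b -> a = b.
Proof. intros H. exact (Ctends_unique _ _ _ (Ctends_const a) H). Qed.

(** * Euler's expansions and the triple product *)

Definition ph (tau w : C) : C := qpoch_inf (ee w) (ee tau).

Lemma ph_step (tau w : C) : (0 < Im tau)%R -> ph tau w = (1 - ee w) * ph tau (w + tau).
Proof.
  intros Ht. unfold ph. rewrite qpoch_inf_step by now apply Cmod_ee_tau_lt_1.
  rewrite <- ee_plus. reflexivity.
Qed.

Lemma ph_neq_0 (tau w : C) :
  (0 < Im tau)%R -> (forall j : nat, 1 - ee (w + IZC (Z.of_nat j) * tau) <> 0) -> ph tau w <> 0.
Proof.
  intros Ht H. apply qpoch_inf_neq_0; [now apply Cmod_ee_tau_lt_1|].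
  intros j. rewrite ee_pow, <- ee_plus. apply H.
Qed.

Lemma ee_upper_neq_1 (w : C) : (0 < Im w)%R -> 1 - ee w <> 0.
Proof.
  intros H E. pose proof (Cmod_ee_tau_lt_1 w H).
  replace (ee w) with (1 - (1 - ee w)) in H0 by ring. rewrite E in H0.
  replace (1 - 0) with (RtoC 1) in H0 by ring. rewrite Cmod_1 in H0. lra.
Qed.

Lemma ph_upper_neq_0 (tau w : C) : (0 < Im tau)%R -> (0 < Im w)%R -> ph tau w <> 0.
Proof.
  intros Ht Hw. apply ph_neq_0; [assumption|]. intros j. apply ee_upper_neq_1.
  rewrite Im_plus, Im_IZC_mult. pose proof (IZR_le _ _ (Zle_0_nat j)). nra.
Qed.

Lemma ph_0 (tau : C) : (0 < Im tau)%R -> ph tau 0 = 0.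
Proof. intros Ht. rewrite ph_step, ee_0 by assumption. ring. Qed.

Lemma Cmod_ee_le_1 (w : C) : (0 <= Im w)%R -> (Cmod (ee w) <= 1)%R.
Proof.
  intros [H|H].
  - left. now apply Cmod_ee_tau_lt_1.
  - rewrite Cmod_ee, <- H, Rmult_0_r, Ropp_0, exp_0. lra.
Qed.

Lemma ph_bound (tau w : C) : (0 < Im tau)%R -> (0 <= Im w)%R ->
  (Cmod (ph tau w) <= exp (1 / (1 - Cmod (ee tau))))%R.
Proof.
  intros Ht Hw. pose proof (Cmod_ee_tau_lt_1 tau Ht) as Hq.
  eapply Rle_trans; [now apply qpoch_inf_le_majorant|]. unfold qpoch_majorant.
  assert (A : (Cmod (ee w) / (1 - Cmod (ee tau)) <= 1 / (1 - Cmod (ee tau)))%R).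
  { apply Rmult_le_compat_r; [left; apply Rinv_0_lt_compat; lra|now apply Cmod_ee_le_1]. }
  destruct A as [A|A]; [left; now apply exp_increasing|rewrite A; lra].
Qed.

(* [1/(q;q)_k], extended by [0] to negative [k]. *)
Definition rq (tau : C) (k : Z) : C := ph tau (IZC (k + 1) * tau) / ph tau tau.

(** Valid at k = 0 as well, where the factor 1 - q^0 vanishes and forces the value 0 at -1. This is
    what removes boundary terms from index shifts. *)
Lemma rq_pred (tau : C) (k : Z) :
  (0 < Im tau)%R -> rq tau (k - 1) = (1 - ee (IZC k * tau)) * rq tau k.
Proof.
  intros Ht. unfold rq. replace (k - 1 + 1)%Z with k by ring.
  rewrite (ph_step tau (IZC k * tau)) by assumption.
  rewrite IZC_plus. replace ((IZC k + IZC 1) * tau) with (IZC k * tau + tau) by (unfold IZC; ring).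
  unfold Cdiv. ring.
Qed.

Lemma rq_0 (tau : C) : (0 < Im tau)%R -> rq tau 0 = 1.
Proof.
  intros Ht. unfold rq. replace (IZC (0 + 1) * tau) with tau by (unfold IZC; simpl; ring).
  field. now apply ph_upper_neq_0.
Qed.

Lemma rq_neg (tau : C) (k : Z) : (0 < Im tau)%R -> (k < 0)%Z -> rq tau k = 0.
Proof.
  intros Ht Hk.
  assert (A : forall n : nat, rq tau (- Z.of_nat n - 1) = 0).
  { induction n as [|n IH].
    - simpl. replace (-1)%Z with (0 - 1)%Z by lia. rewrite rq_pred by assumption.
      replace (IZC 0 * tau) with (RtoC 0) by (unfold IZC; ring). rewrite ee_0. ring.
    - replace (- Z.of_nat (S n) - 1)%Z with (- Z.of_nat n - 1 - 1)%Z by lia.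
      rewrite rq_pred, IH by assumption. ring. }
  replace k with (- Z.of_nat (Z.to_nat (- k - 1)) - 1)%Z by lia. apply A.
Qed.

Lemma rq_bounded (tau : C) : (0 < Im tau)%R -> exists K, forall k, (Cmod (rq tau k) <= K)%R.
Proof.
  intros Ht. exists (exp (1 / (1 - Cmod (ee tau))) / Cmod (ph tau tau))%R. intros k.
  assert (Hp : (0 < Cmod (ph tau tau))%R) by now apply Cmod_gt_0, ph_upper_neq_0.
  destruct (Z_lt_le_dec k 0) as [Hk|Hk].
  - rewrite rq_neg, Cmod_0 by assumption. apply Rmult_le_pos; [left; apply exp_pos|].
    left. now apply Rinv_0_lt_compat.
  - unfold rq. rewrite Cmod_div by now apply ph_upper_neq_0.
    apply Rmult_le_compat_r; [left; now apply Rinv_0_lt_compat|].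
    apply ph_bound; [assumption|]. rewrite Im_IZC_mult.
    apply Rmult_le_pos; [apply IZR_le; lia|lra].
Qed.

Lemma rq_exp_bounded (tau : C) : (0 < Im tau)%R -> exp_bounded (rq tau).
Proof. intros Ht. destruct (rq_bounded tau Ht) as [K HK]. now apply (exp_bounded_of_bounded _ K). Qed.

(** At the points q^n -> 0 a power series retains only its constant term; this normalizes both Euler
    expansions. *)
Lemma Csum_dilate_tends (tau : C) (g : Z -> C) :
  (0 < Im tau)%R -> summable zl g -> (forall k, (k < 0)%Z -> g k = 0) ->
  Ctends (fun n => Csum zl (fun k => g k * ee (IZC k * (IZC (Z.of_nat n) * tau)))) (g 0%Z).
Proof.
  intros Ht Hs Hneg.
  rewrite <- (Csum_single 0 (g 0%Z)).
  apply (tannery zl _ _ (fun k => Cmod (g k))).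
  - apply exhaustion_zl.
  - exact Hs.
  - intros n M k _. rewrite Cmod_mult.
    destruct (Z_lt_le_dec k 0) as [Hk|Hk].
    + rewrite Hneg, Cmod_0 by assumption. lra.
    + rewrite <- (Rmult_1_r (Cmod (g k))) at 2. apply Rmult_le_compat_l; [apply Cmod_ge_0|].
      apply Cmod_ee_le_1. rewrite !Im_IZC_mult.
      apply Rmult_le_pos; [now apply IZR_le|]. apply Rmult_le_pos; [apply IZR_le; lia|lra].
  - intros M k _. destruct (Z.eqb_spec k 0) as [->|Hk0].
    + apply (Ctends_ext (fun _ => g 0%Z)); [|apply Ctends_const].
      intros n. replace (IZC 0 * (IZC (Z.of_nat n) * tau)) with (RtoC 0) by (unfold IZC; ring).
      rewrite ee_0. ring.
    + destruct (Z_lt_le_dec k 0) as [Hk|Hk].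
      * apply (Ctends_ext (fun _ => 0)); [|apply Ctends_const].
        intros n. rewrite Hneg by assumption. ring.
      * apply (Ctends_squeeze _ _ (fun n => Cmod (g k) * Cmod (ee tau) ^ n)%R).
        -- intros n.
           replace (g k * ee (IZC k * (IZC (Z.of_nat n) * tau)) - 0)
             with (g k * ee (IZC k * (IZC (Z.of_nat n) * tau))) by ring.
           rewrite Cmod_mult. apply Rmult_le_compat_l; [apply Cmod_ge_0|].
           rewrite <- Cmod_pow, ee_pow.
           replace (IZC k * (IZC (Z.of_nat n) * tau))
             with (IZC (k - 1) * (IZC (Z.of_nat n) * tau) + IZC (Z.of_nat n) * tau)
             by (rewrite IZC_minus; unfold IZC; ring).
           rewrite ee_plus, Cmod_mult.
           rewrite <- (Rmult_1_l (Cmod (ee (IZC (Z.of_nat n) * tau)))) at 2.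
           apply Rmult_le_compat_r; [apply Cmod_ge_0|]. apply Cmod_ee_le_1.
           rewrite !Im_IZC_mult. apply Rmult_le_pos; [apply IZR_le; lia|].
           apply Rmult_le_pos; [apply IZR_le; lia|lra].
        -- apply geometric_tends_0. split; [apply Cmod_ge_0|now apply Cmod_ee_tau_lt_1].
Qed.

(** Iterating the equation writes F w as [qpoch] of length n times F (w + n tau), and both factors
    converge. Only values along w + n tau enter, not continuity of F. *)
Lemma ph_unique (tau w c : C) (F : C -> C) :
  (0 < Im tau)%R ->
  (forall n : nat, F (w + IZC (Z.of_nat n) * tau) =
     (1 - ee (w + IZC (Z.of_nat n) * tau)) * F (w + IZC (Z.of_nat n) * tau + tau)) ->
  Ctends (fun n => F (w + IZC (Z.of_nat n) * tau)) c -> F w = ph tau w * c.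
Proof.
  intros Ht HF Hc.
  assert (A : forall n, F w = qpoch (ee w) (ee tau) n * F (w + IZC (Z.of_nat n) * tau)).
  { induction n as [|n IH].
    - unfold qpoch. simpl. rewrite Cmult_1_l. f_equal. unfold IZC. ring.
    - rewrite IH, HF. unfold qpoch. simpl cprod. rewrite ee_pow, <- ee_plus.
      replace (w + IZC (Z.of_nat (S n)) * tau) with (w + IZC (Z.of_nat n) * tau + tau).
      + ring.
      + replace (Z.of_nat (S n)) with (Z.of_nat n + 1)%Z by lia. rewrite IZC_plus. unfold IZC. ring. }
  apply eq_of_Ctends_const.
  apply (Ctends_ext (fun n => qpoch (ee w) (ee tau) n * F (w + IZC (Z.of_nat n) * tau))).
  { intros n. symmetry. apply A. }
  apply Ctends_mult; [|assumption]. apply qpoch_tends. now apply Cmod_ee_tau_lt_1.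
Qed.

Lemma euler_term_superexp (tau w : C) : (0 < Im tau)%R ->
  superexp_small (fun k => rq tau k * ee (IZC k / 2 + tau * IZC k * (IZC k - 1) / 2 + IZC k * w)).
Proof.
  intros Ht.
  apply (superexp_ext (fun k => ee (IZC k / 2 + tau * IZC k * (IZC k - 1) / 2 + IZC k * w) * rq tau k)).
  { intros. ring. }
  apply superexp_mult; [|now apply rq_exp_bounded].
  apply (superexp_ee _ tau (1 / 2 - tau / 2 + w) 0); [assumption|]. intros n. field.
Qed.

(** With x = e(w), the difference F(x) - F(qx) brings in 1 - q^k, which lowers 1/(q;q)_k to
    1/(q;q)_(k-1). Shifting k gives F(x) - F(qx) = - x F(qx), the equation of (x;q)_oo. *)
Lemma euler_ph (tau w : C) : (0 < Im tau)%R ->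
  Csum zl (fun k => rq tau k * ee (IZC k / 2 + tau * IZC k * (IZC k - 1) / 2 + IZC k * w))
  = ph tau w.
Proof.
  intros Ht.
  set (F := fun w => Csum zl (fun k => rq tau k *
     ee (IZC k / 2 + tau * IZC k * (IZC k - 1) / 2 + IZC k * w))).
  assert (Hs := fun w => superexp_summable _ (euler_term_superexp tau w Ht)).
  change (F w = ph tau w). rewrite <- (Cmult_1_r (ph tau w)). apply ph_unique; [assumption| |].
  - intros n. generalize (w + IZC (Z.of_nat n) * tau). clear w. intros w.
    assert (A : F w - F (w + tau) = - ee w * F (w + tau)).
    { unfold F. rewrite <- Csum_minus, <- Csum_scal by (auto using exhaustion_zl).
      rewrite <- (Csum_shift (-1) (fun i => - ee w * _)) by (apply summable_scal; auto).
      apply Csum_ext. intros k. replace (k + -1)%Z with (k - 1)%Z by lia.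
      rewrite rq_pred by assumption.
      replace (IZC k / 2 + tau * IZC k * (IZC k - 1) / 2 + IZC k * (w + tau))
        with (IZC k / 2 + tau * IZC k * (IZC k - 1) / 2 + IZC k * w + IZC k * tau) by ring.
      replace (IZC k / 2 + tau * IZC k * (IZC k - 1) / 2 + IZC k * w)
        with (1 / 2 + w + (IZC (k - 1) / 2 + tau * IZC (k - 1) * (IZC (k - 1) - 1) / 2
           + IZC (k - 1) * (w + tau))) by (rewrite IZC_minus; unfold IZC; field).
      rewrite !ee_plus, ee_half. ring. }
    replace (F w) with (F w - F (w + tau) + F (w + tau)) by ring. rewrite A. ring.
  - pose proof (Csum_dilate_tends tau _ Ht (Hs w)) as T. cbv beta in T.
    rewrite rq_0 in T by assumption.
    replace (1 * ee (IZC 0 / 2 + tau * IZC 0 * (IZC 0 - 1) / 2 + IZC 0 * w)) with (RtoC 1) in T.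
    + eapply Ctends_ext; [|apply T].
      * intros n. unfold F. apply Csum_ext. intros k. rewrite <- Cmult_assoc, <- ee_plus.
        do 2 f_equal. ring.
      * intros k Hk. rewrite rq_neg by assumption. ring.
    + replace (IZC 0 / 2 + tau * IZC 0 * (IZC 0 - 1) / 2 + IZC 0 * w) with (RtoC 0)
        by (unfold IZC; field). rewrite ee_0. ring.
Qed.

Lemma one_sided_summable (g : Z -> C) (K r : R) :
  (0 <= r < 1)%R -> (forall k, (k < 0)%Z -> g k = 0) ->
  (forall k : nat, (Cmod (g (Z.of_nat k)) <= K * r ^ k)%R) -> summable zl g.
Proof.
  intros Hr Hneg Hpos.
  assert (HK : (0 <= K)%R).
  { specialize (Hpos 0%nat). simpl in Hpos. pose proof (Cmod_ge_0 (g 0%Z)). lra. }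
  apply (dominated_summable zl g (fun n => K * zpow r n)%R).
  - intros M n _. destruct (Z_lt_le_dec n 0) as [Hn|Hn].
    + rewrite Hneg, Cmod_0 by assumption. apply Rmult_le_pos; [assumption|apply pow_le; lra].
    + replace n with (Z.of_nat (Z.to_nat n)) at 1 by lia. unfold zpow.
      replace (Z.abs_nat n) with (Z.to_nat n) by lia. apply Hpos.
  - now apply rsummable_zpow.
Qed.

Lemma euler_inv_summable (tau y : C) : (0 < Im tau)%R -> (0 < Im y)%R ->
  summable zl (fun k => rq tau k * ee (IZC k * y)).
Proof.
  intros Ht Hy. destruct (rq_bounded tau Ht) as [K HK].
  apply (one_sided_summable _ K (Cmod (ee y))).
  - split; [apply Cmod_ge_0|now apply Cmod_ee_tau_lt_1].
  - intros k Hk. rewrite rq_neg by assumption. ring.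
  - intros k. rewrite Cmod_mult, <- Cmod_pow, ee_pow.
    apply Rmult_le_compat_r; [apply Cmod_ge_0|apply HK].
Qed.

(** With x = e(y) the same computation gives F(x) - F(qx) = x F(x), the equation of 1/(x;q)_oo. The
    condition on y says |x| < 1. *)
Lemma euler_inv (tau y : C) : (0 < Im tau)%R -> (0 < Im y)%R ->
  ph tau y * Csum zl (fun k => rq tau k * ee (IZC k * y)) = 1.
Proof.
  intros Ht Hy.
  set (F := fun y => Csum zl (fun k => rq tau k * ee (IZC k * y))).
  assert (A : forall y, (0 < Im y)%R -> (1 - ee y) * F y = F (y + tau)).
  { clear y Hy. intros y Hy.
    assert (Hy' : (0 < Im (y + tau))%R) by (rewrite Im_plus; lra).
    assert (A : F y - F (y + tau) = ee y * F y).
    { unfold F. rewrite <- Csum_minus, <- Csum_scal by (auto using exhaustion_zl, euler_inv_summable).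
      rewrite <- (Csum_shift (-1) (fun i => ee y * _))
        by (apply summable_scal; auto using euler_inv_summable).
      apply Csum_ext. intros k. replace (k + -1)%Z with (k - 1)%Z by lia.
      rewrite rq_pred by assumption.
      replace (IZC k * (y + tau)) with (IZC k * y + IZC k * tau) by ring.
      replace (IZC k * y) with (y + IZC (k - 1) * y) by (rewrite IZC_minus; unfold IZC; ring).
      rewrite !ee_plus. ring. }
    replace (F (y + tau)) with (F y - (F y - F (y + tau))) by ring. rewrite A. ring. }
  assert (Hn : forall n : nat, (0 < Im (y + IZC (Z.of_nat n) * tau))%R).
  { intros n. rewrite Im_plus, Im_IZC_mult. pose proof (IZR_le _ _ (Zle_0_nat n)). nra. }
  assert (B : forall n, qpoch (ee y) (ee tau) n * F y = F (y + IZC (Z.of_nat n) * tau)).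
  { induction n as [|n IH].
    - unfold qpoch. simpl. rewrite Cmult_1_l. f_equal. unfold IZC. ring.
    - replace (y + IZC (Z.of_nat (S n)) * tau) with (y + IZC (Z.of_nat n) * tau + tau).
      + rewrite <- A, <- IH by auto. unfold qpoch. simpl cprod. rewrite ee_pow, <- ee_plus. ring.
      + replace (Z.of_nat (S n)) with (Z.of_nat n + 1)%Z by lia. rewrite IZC_plus. unfold IZC. ring. }
  apply (Ctends_unique (fun n => F (y + IZC (Z.of_nat n) * tau))).
  - eapply Ctends_ext; [exact B|].
    rewrite (Cmult_comm (ph tau y)).
    eapply Ctends_ext; [|apply Ctends_scal; apply qpoch_tends; now apply Cmod_ee_tau_lt_1].
    intros n. cbv beta. apply Cmult_comm.
  - pose proof (Csum_dilate_tends tau _ Ht (euler_inv_summable tau y Ht Hy)) as T. cbv beta in T.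
    rewrite rq_0 in T by assumption.
    replace (1 * ee (IZC 0 * y)) with (RtoC 1) in T.
    + eapply Ctends_ext; [|apply T].
      * intros n. unfold F. apply Csum_ext. intros k. rewrite <- Cmult_assoc, <- ee_plus.
        do 2 f_equal. ring.
      * intros k Hk. rewrite rq_neg by assumption. ring.
    + replace (IZC 0 * y) with (RtoC 0) by (unfold IZC; ring). rewrite ee_0. ring.
Qed.

(** This is [vtheta] without the factor - i q^(1/8) e(-v/2), hence a Laurent series in e(v) with
    integral exponents. *)
Definition theta (tau v : C) : C := ph tau tau * ph tau v * ph tau (tau - v).

(** The factor (-1)^k q^(k(k-1)/2) e(kv) plays two roles: it is the k-th term of the theta series
    and, by [theta_shift], the multiplier of theta under v -> v + k tau. *)
Definition theta_term (tau v : C) (k : Z) : C :=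
  ee (IZC k / 2 + tau * IZC k * (IZC k - 1) / 2 + IZC k * v).

Lemma theta_term_superexp (tau v : C) : (0 < Im tau)%R -> superexp_small (theta_term tau v).
Proof.
  intros Ht. apply (superexp_ee _ tau (1 / 2 - tau / 2 + v) 0); [assumption|]. intros n. field.
Qed.

Lemma theta_series_shift (tau v : C) (k : Z) : (0 < Im tau)%R ->
  Csum zl (theta_term tau v) = theta_term tau v k * Csum zl (theta_term tau (v + IZC k * tau)).
Proof.
  intros Ht.
  rewrite <- (Csum_shift k), <- Csum_scal
    by auto using exhaustion_zl, superexp_summable, theta_term_superexp.
  apply Csum_ext. intros n. unfold theta_term. rewrite <- ee_plus, IZC_plus. f_equal. field.
Qed.

Lemma theta_step (tau v : C) : (0 < Im tau)%R -> theta tau v = - ee v * theta tau (v + tau).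
Proof.
  intros Ht. unfold theta. rewrite (ph_step tau v) by assumption.
  replace (tau - (v + tau)) with (- v) by ring.
  rewrite (ph_step tau (- v)) by assumption.
  replace (- v + tau) with (tau - v) by ring.
  rewrite ee_opp. field. apply ee_neq_0.
Qed.

(** Put x = e(v) and multiply the series by the expansion of 1/(q/x;q)_oo, valid for |q/x| < 1. The
    coefficient of x^k becomes an Euler series for (q^(k+1);q)_oo = (q;q)_oo / (q;q)_k, so that
    Euler's expansion sums the product to (q;q)_oo (x;q)_oo. *)
Lemma theta_series_half_plane (tau v : C) : (0 < Im tau)%R -> (0 < Im (tau - v))%R ->
  Csum zl (theta_term tau v) = theta tau v.
Proof.
  intros Ht Hv.
  pose proof (euler_inv tau (tau - v) Ht Hv) as HE.
  pose proof (euler_inv_summable tau (tau - v) Ht Hv) as Hc.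
  set (c := fun k => rq tau k * ee (IZC k * (tau - v))) in *.
  assert (Hprod : Csum zl c * Csum zl (theta_term tau v) = ph tau tau * ph tau v).
  { rewrite <- (Csum_eq _ _ _ (Csum_product c (theta_term tau v) (fun i => i) Hc
      (superexp_summable _ (theta_term_superexp tau v Ht)))).
    rewrite <- (euler_ph tau v), <- Csum_scal
      by auto using exhaustion_zl, superexp_summable, euler_term_superexp.
    apply Csum_ext. intros k.
    transitivity (theta_term tau v k * ph tau (IZC (k + 1) * tau)).
    - rewrite <- euler_ph, <- Csum_scal
        by auto using exhaustion_zl, superexp_summable, euler_term_superexp.
      apply Csum_ext. intros j. unfold c, theta_term.
      match goal with |- _ * ee ?a * ee ?b = ee ?x * (_ * ee ?y) =>
        transitivity (rq tau j * ee (a + b)); [rewrite (ee_plus a b); ring|];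
        transitivity (rq tau j * ee (x + y)); [|rewrite (ee_plus x y); ring] end.
      do 2 f_equal. rewrite !IZC_plus. unfold IZC. field.
    - unfold rq, theta_term. field. now apply ph_upper_neq_0. }
  unfold theta. rewrite <- Hprod.
  replace (Csum zl c * Csum zl (theta_term tau v) * ph tau (tau - v))
    with (ph tau (tau - v) * Csum zl c * Csum zl (theta_term tau v)) by ring.
  rewrite HE. ring.
Qed.

(** Series and product have the same multiplier under v -> v + tau, so the identity spreads from the
    half-plane by induction on a bound for Im v / Im tau. *)
Lemma theta_series (tau v : C) : (0 < Im tau)%R -> Csum zl (theta_term tau v) = theta tau v.
Proof.
  intros Ht.
  assert (A : forall n v, (Im v < (INR n + 1) * Im tau)%R ->
     Csum zl (theta_term tau v) = theta tau v).
  { clear v. induction n as [|n IH]; intros v Hv.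
    - apply theta_series_half_plane; [assumption|]. unfold Cminus. rewrite Im_plus.
      simpl in Hv. change (Im (- v)) with (- Im v)%R. lra.
    - assert (Hv' : (Im (v - tau) < (INR n + 1) * Im tau)%R).
      { unfold Cminus. rewrite Im_plus. change (Im (- tau)) with (- Im tau)%R.
        rewrite S_INR in Hv. lra. }
      specialize (IH _ Hv').
      rewrite (theta_series_shift tau (v - tau) 1), (theta_step tau (v - tau)) in IH by assumption.
      replace (v - tau + IZC 1 * tau) with v in IH by (unfold IZC; ring).
      replace (v - tau + tau) with v in IH by ring.
      replace (theta_term tau (v - tau) 1) with (- ee (v - tau)) in IH.
      + apply (f_equal (fun x => - / ee (v - tau) * x)) in IH.
        replace (- / ee (v - tau) * (- ee (v - tau) * theta tau v)) with (theta tau v) in IH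
          by (field; apply ee_neq_0).
        rewrite <- IH. field. apply ee_neq_0.
      + unfold theta_term.
        replace (IZC 1 / 2 + tau * IZC 1 * (IZC 1 - 1) / 2 + IZC 1 * (v - tau))
          with (1 / 2 + (v - tau)) by (unfold IZC; field).
        rewrite ee_plus, ee_half. ring. }
  destruct (INR_unbounded (Im v / Im tau)) as [n Hn].
  apply (A n). apply (Rmult_gt_compat_r (Im tau)) in Hn; [|lra].
  replace (Im v / Im tau * Im tau)%R with (Im v) in Hn by (field; lra). lra.
Qed.

Lemma theta_shift (tau v : C) (k : Z) : (0 < Im tau)%R ->
  theta tau v = theta_term tau v k * theta tau (v + IZC k * tau).
Proof. intros Ht. rewrite <- !theta_series by assumption. now apply theta_series_shift. Qed.

Lemma theta_opp (tau v : C) : (0 < Im tau)%R -> theta tau (- v) = - ee (- v) * theta tau v.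
Proof.
  intros Ht. unfold theta. rewrite (ph_step tau v), (ph_step tau (- v)) by assumption.
  replace (- v + tau) with (tau - v) by ring. replace (tau - - v) with (v + tau) by ring.
  rewrite ee_opp. field. apply ee_neq_0.
Qed.

Lemma theta_0 (tau : C) : (0 < Im tau)%R -> theta tau 0 = 0.
Proof. intros Ht. unfold theta. rewrite ph_0 by assumption. ring. Qed.

Lemma theta_neq_0 (tau v : C) : (0 < Im tau)%R -> ~ in_lattice tau v -> theta tau v <> 0.
Proof.
  intros Ht Hv. unfold theta.
  apply Cmult_neq_0; [apply Cmult_neq_0|].
  - now apply ph_upper_neq_0.
  - apply ph_neq_0; [assumption|]. intros j. now apply one_minus_ee_neq_0.
  - apply ph_neq_0; [assumption|]. intros j.
    replace (tau - v + IZC (Z.of_nat j) * tau) with (- v + IZC (Z.of_nat j + 1) * tau)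
      by (rewrite IZC_plus; unfold IZC; ring).
    now apply one_minus_ee_neq_0, lattice_opp.
Qed.

(** * Appell-Lerch sums *)

Lemma Csum_reflect (f : Z -> C) : summable zl f -> Csum zl (fun n => f (- n)%Z) = Csum zl f.
Proof.
  intros Hs. apply Csum_eq.
  apply (Ctends_ext (fun M => lsum (map Z.opp (zl M)) f)).
  { intros M. apply lsum_map. }
  assert (P : forall M, Permutation (map Z.opp (zl M)) (zl M)).
  { intros M. apply NoDup_Permutation; [|apply NoDup_zl|].
    - apply NoDup_map_NoDup_ForallPairs; [|apply NoDup_zl]. intros a b _ _ H. lia.
    - intros m. rewrite in_map_iff, in_zl. split.
      + intros [x [<- Hx]]. apply in_zl in Hx. lia.
      + intros H. exists (- m)%Z. rewrite in_zl. lia. }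
  eapply Ctends_ext; [|apply (summable_tends zl f exhaustion_zl Hs)].
  intros M. cbv beta. symmetry. apply lsum_perm, P.
Qed.

Lemma inv_one_minus_ee_exp_bounded (tau u : C) : (0 < Im tau)%R -> ~ in_lattice tau u ->
  exp_bounded (fun n => / (1 - ee (u + IZC n * tau))).
Proof.
  intros Ht Hu. destruct (inv_one_minus_ee_bounded tau u Ht) as [K HK].
  apply (exp_bounded_of_bounded _ K). intros n. apply HK. now apply one_minus_ee_neq_0.
Qed.

(** The numerator is (-1)^n q^(n(n+1)/2) e(-nv). The sign of v follows [hat_mu] and is opposite to
    the usual one for Appell-Lerch sums; hence v + z accompanies u - z. *)
Definition appell_term (tau u v : C) (n : Z) : C :=
  theta_term tau (tau - v) n * / (1 - ee (u + IZC n * tau)).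

Definition appell (tau u v : C) : C := Csum zl (appell_term tau u v).

Lemma appell_term_summable (tau u v : C) : (0 < Im tau)%R -> ~ in_lattice tau u ->
  summable zl (appell_term tau u v).
Proof.
  intros Ht Hu. apply superexp_summable, superexp_mult.
  - now apply theta_term_superexp.
  - now apply inv_one_minus_ee_exp_bounded.
Qed.

(** The exponent contains s (u + n tau), so raising s by 1 multiplies each numerator by e(u + n
    tau), the quantity in the denominator. *)
Definition appell_coef (tau u z : C) (s : Z) : C :=
  Csum zl (fun n => ee (IZC s * u + IZC s * IZC n * tau + tau * IZC n * IZC n + IZC n * z)
                    * / (1 - ee (u + IZC n * tau))).

Lemma quadratic_superexp (tau u z : C) (s : Z) : (0 < Im tau)%R ->
  superexp_small (fun n =>
    ee (IZC s * u + IZC s * IZC n * tau + tau * IZC n * IZC n + IZC n * z)).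
Proof.
  intros Ht. apply (superexp_ee _ (2 * tau) (IZC s * tau + z) (IZC s * u)).
  - replace (Im (2 * tau)) with (2 * Im tau)%R; [lra|].
    unfold Im, RtoC, Cmult. simpl. ring.
  - intros n. field.
Qed.

(* The coefficient of [e(s v)] in the product of the two series. *)
Lemma appell_theta_expansion (tau u v z : C) : (0 < Im tau)%R -> ~ in_lattice tau u ->
  Ctends (fun M => lsum (zl M) (fun s => theta_term tau (v + z - u) s * appell_coef tau u z s))
    (appell tau u v * theta tau (v + z)).
Proof.
  intros Ht Hu. rewrite <- theta_series by assumption.
  eapply Ctends_ext; [|apply (Csum_product _ _ (fun i => i));
    [now apply appell_term_summable|now apply superexp_summable, theta_term_superexp]].
  intros M. cbv beta. apply lsum_ext. intros s _.
  unfold appell_coef. rewrite <- Csum_scal.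
  - apply Csum_ext. intros n. unfold appell_term, theta_term.
    match goal with |- ee ?a * ?d * ee ?b = ee ?x * (ee ?y * _) =>
      transitivity (ee (a + b) * d); [rewrite (ee_plus a b); ring|];
      transitivity (ee (IZC n + (x + y)) * d);
      [do 2 f_equal; rewrite IZC_plus; field|
       rewrite (ee_plus (IZC n)), (ee_plus x y), ee_IZC; ring] end.
  - apply exhaustion_zl.
  - apply superexp_summable, superexp_mult.
    + now apply quadratic_superexp.
    + now apply inv_one_minus_ee_exp_bounded.
Qed.

Lemma appell_coef_diff_succ (tau u z : C) (s : Z) : (0 < Im tau)%R -> ~ in_lattice tau u ->
  appell_coef tau u z s - appell_coef tau u z (s + 1) =
  Csum zl (fun n => ee (IZC s * u + IZC s * IZC n * tau + tau * IZC n * IZC n + IZC n * z)).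
Proof.
  intros Ht Hu. unfold appell_coef. rewrite <- Csum_minus.
  - apply Csum_ext. intros n.
    replace (IZC (s + 1) * u + IZC (s + 1) * IZC n * tau + tau * IZC n * IZC n + IZC n * z)
      with (IZC s * u + IZC s * IZC n * tau + tau * IZC n * IZC n + IZC n * z + (u + IZC n * tau))
      by (rewrite IZC_plus; unfold IZC; ring).
    rewrite (ee_plus _ (u + IZC n * tau)). field. now apply one_minus_ee_neq_0.
  - apply exhaustion_zl.
  - apply superexp_summable, superexp_mult;
      [now apply quadratic_superexp|now apply inv_one_minus_ee_exp_bounded].
  - apply superexp_summable, superexp_mult;
      [now apply quadratic_superexp|now apply inv_one_minus_ee_exp_bounded].
Qed.

(* Substitute [n -> - n - s]. *)
Lemma quadratic_sum_symmetry (tau u z : C) (s : Z) : (0 < Im tau)%R ->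
  Csum zl (fun n => ee (IZC s * u + IZC s * IZC n * tau + tau * IZC n * IZC n + IZC n * z)) =
  Csum zl (fun n => ee (IZC s * (u - z) + IZC s * IZC n * tau + tau * IZC n * IZC n + IZC n * - z)).
Proof.
  intros Ht.
  rewrite <- Csum_reflect by now apply superexp_summable, quadratic_superexp.
  rewrite <- (Csum_shift s).
  - apply Csum_ext. intros n. f_equal. rewrite !IZC_opp, !IZC_plus. ring.
  - apply superexp_summable.
    apply (superexp_ee _ (2 * tau) (- IZC s * tau - z) (IZC s * u)).
    + replace (Im (2 * tau)) with (2 * Im tau)%R; [lra|].
      unfold Im, RtoC, Cmult. simpl. ring.
    + intros n. rewrite IZC_opp. field.
Qed.

(** Differencing in s cancels every denominator, and the quadratic sums left over agree for (u, z)
    and (u - z, - z). Both families of coefficients thus have the same increments. *)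
Lemma appell_coef_diff_const (tau u z : C) (s : Z) : (0 < Im tau)%R ->
  ~ in_lattice tau u -> ~ in_lattice tau (u - z) ->
  appell_coef tau u z s - appell_coef tau (u - z) (- z) s =
  appell_coef tau u z 0 - appell_coef tau (u - z) (- z) 0.
Proof.
  intros Ht Hu Huz.
  assert (A : forall s, appell_coef tau u z s - appell_coef tau (u - z) (- z) s =
    appell_coef tau u z (s + 1) - appell_coef tau (u - z) (- z) (s + 1)).
  { clear s. intros s.
    pose proof (appell_coef_diff_succ tau u z s Ht Hu) as H1.
    pose proof (appell_coef_diff_succ tau (u - z) (- z) s Ht Huz) as H2.
    rewrite <- (quadratic_sum_symmetry tau u z s Ht), <- H1 in H2.
    replace (appell_coef tau u z s) with
      (appell_coef tau u z s - appell_coef tau u z (s + 1) + appell_coef tau u z (s + 1)) by ring.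
    rewrite <- H2. ring. }
  revert s. apply Z.peano_ind; [reflexivity| |].
  - intros s IH. rewrite <- IH. symmetry. apply A.
  - intros s IH. rewrite <- IH, A. replace (Z.pred s + 1)%Z with s by lia. reflexivity.
Qed.

(** The second product is the first at (u - z, v + z, - z), and both lead to the same argument v + z
    - u of [theta_term]. Hence the two expansions can be subtracted coefficient by coefficient. *)
Lemma appell_three_term (tau u v z : C) : (0 < Im tau)%R ->
  ~ in_lattice tau u -> ~ in_lattice tau (u - z) ->
  appell tau u v * theta tau (v + z) - appell tau (u - z) (v + z) * theta tau v =
  (appell_coef tau u z 0 - appell_coef tau (u - z) (- z) 0) * theta tau (v + z - u).
Proof.
  intros Ht Hu Huz.
  pose proof (appell_theta_expansion tau u v z Ht Hu) as H1.
  pose proof (appell_theta_expansion tau (u - z) (v + z) (- z) Ht Huz) as H2.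
  replace (v + z + - z) with v in H2 by ring.
  replace (v - (u - z)) with (v + z - u) in H2 by ring.
  pose proof (Ctends_minus _ _ _ _ H1 H2) as H. cbv beta in H.
  eapply Ctends_unique; [exact H|].
  rewrite <- theta_series by assumption.
  eapply Ctends_ext; [|apply Ctends_scal, summable_tends;
    [apply exhaustion_zl|now apply superexp_summable, theta_term_superexp]].
  intros M. cbv beta. rewrite <- lsum_minus, <- lsum_scal. apply lsum_ext. intros s _.
  rewrite <- (appell_coef_diff_const tau u z s) by assumption. ring.
Qed.

Lemma lattice_opp_sub (tau a b : C) : ~ in_lattice tau (a - b) -> ~ in_lattice tau (b - a).
Proof. intros H. replace (b - a) with (- (a - b)) by ring. now apply lattice_opp. Qed.

Lemma appell_0_theta (tau u w : C) : (0 < Im tau)%R ->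
  ~ in_lattice tau u -> ~ in_lattice tau w -> ~ in_lattice tau (u - w) ->
  appell tau u 0 * theta tau u = appell tau w 0 * theta tau w.
Proof.
  intros Ht Hu Hw Huw.
  set (z := u - w).
  assert (Huz : u - z = w) by (unfold z; ring).
  assert (Huz' : ~ in_lattice tau (u - z)) by now rewrite Huz.
  pose proof (appell_three_term tau u 0 z Ht Hu Huz') as H1.
  pose proof (appell_three_term tau u (- z) z Ht Hu Huz') as H2.
  set (d := appell_coef tau u z 0 - appell_coef tau (u - z) (- z) 0) in *.
  rewrite theta_0 in H1 by assumption.
  replace (0 + z - u) with (- w) in H1 by (unfold z; ring).
  replace (0 + z) with z in H1 by ring.
  replace (- z + z) with (RtoC 0) in H2 by ring.
  replace (0 - u) with (- u) in H2 by ring.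
  rewrite theta_0, Huz in H2 by assumption.
  rewrite (theta_opp tau w) in H1 by assumption.
  rewrite (theta_opp tau u), (theta_opp tau z) in H2 by assumption.
  assert (Hez : ee (- w) = ee z * ee (- u)).
  { rewrite <- ee_plus. f_equal. unfold z. ring. }
  assert (Hzu : ee (- z) = / ee z) by apply ee_opp.
  pose proof (theta_neq_0 tau z Ht Huw) as Hz.
  pose proof (ee_neq_0 z) as Hz0.
  rewrite Hez in H1. rewrite Hzu in H2.
  (* Each special value leaves one product, equal to the same multiple of [theta tau w] or of
     [theta tau u]; cross-multiplying removes the unknown [d]. *)
  assert (H1' : appell tau u 0 * theta tau z = - (d * ee z * ee (- u) * theta tau w)).
  { replace (appell tau u 0 * theta tau z)
      with (appell tau u 0 * theta tau z - appell tau (u - z) z * 0) by ring.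
    rewrite H1. ring. }
  assert (H2' : appell tau w 0 * theta tau z = - (d * ee z * ee (- u) * theta tau u)).
  { replace (appell tau w 0 * theta tau z)
      with (ee z * (appell tau u (- z) * 0 - appell tau w 0 * (- / ee z * theta tau z)))
      by (field; assumption).
    rewrite H2. ring. }
  replace (appell tau u 0 * theta tau u)
    with (appell tau u 0 * theta tau z * theta tau u / theta tau z) by (field; assumption).
  replace (appell tau w 0 * theta tau w)
    with (appell tau w 0 * theta tau z * theta tau w / theta tau z) by (field; assumption).
  rewrite H1', H2'. field. assumption.
Qed.

(** * Evaluation of [appell] at v = 0, approaching u = 0 along real points *)

Lemma Cmod_le_Rabs (c : C) : (Cmod c <= Rabs (Re c) + Rabs (Im c))%R.
Proof.
  rewrite <- (Cmod_R (Re c)).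
  replace (Rabs (Im c)) with (Cmod (Ci * Im c)).
  - eapply Rle_trans; [|apply Cmod_triangle]. right. f_equal.
    destruct c as [a b]. unfold Ci, RtoC, Cplus, Cmult, Re, Im. simpl. apply f_equal2; ring.
  - rewrite Cmod_mult, Cmod_Ci, Cmod_R. ring.
Qed.

(** The imaginary part sin(2 pi x) and the real part - 2 sin(pi x)^2 contribute at most 2 pi x
    each. *)
Lemma ee_near_1 (x : R) : (0 < x <= / 2)%R -> (Cmod (ee x - 1) <= 4 * PI * x)%R.
Proof.
  intros Hx. pose proof PI_RGT_0.
  eapply Rle_trans; [apply Cmod_le_Rabs|].
  assert (E : ee x = (cos (2 * (PI * x)), sin (2 * (PI * x)))).
  { unfold ee, cexp, CPI, Ci, RtoC, Cmult, Re, Im. simpl.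
    match goal with |- (exp ?a * cos ?b, _)%R = _ =>
      replace a with 0%R by ring; replace b with (2 * (PI * x))%R by ring end.
    rewrite exp_0. apply f_equal2; ring. }
  rewrite E. unfold Cminus, Copp, Cplus, RtoC, Re, Im. simpl fst. simpl snd.
  assert (Hpx : (0 < PI * x <= PI / 2)%R) by (split; nra).
  assert (S1 : (0 <= sin (2 * (PI * x)) <= 2 * (PI * x))%R).
  { split; [apply sin_ge_0; lra|left; apply sin_lt_x; lra]. }
  assert (S2 : (0 <= sin (PI * x) <= PI * x)%R).
  { split; [apply sin_ge_0; lra|left; apply sin_lt_x; lra]. }
  pose proof (SIN_bound (PI * x)).
  rewrite (Rabs_pos_eq (sin _ + _)) by lra.
  rewrite cos_2a_sin, Rabs_left1 by nra. nra.
Qed.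

(** Real points of (0, 1/2] tending to 0: they avoid the lattice, and e(k x) has modulus 1 there, so
    majorants do not depend on the point. *)
Definition dyadic (n : nat) : R := (/ 2 * (/ 2) ^ n)%R.

Lemma dyadic_range (n : nat) : (0 < dyadic n <= / 2)%R.
Proof.
  unfold dyadic. assert (0 < (/ 2) ^ n)%R by (apply pow_lt; lra).
  assert ((/ 2) ^ n <= 1)%R by (rewrite <- (pow1 n); apply pow_incr; lra). split; nra.
Qed.

Lemma ee_dyadic_tends : Ctends (fun n => ee (dyadic n)) 1.
Proof.
  apply (Ctends_squeeze _ _ (fun n => (4 * PI * / 2) * (/ 2) ^ n)%R).
  - intros k. eapply Rle_trans; [apply ee_near_1, dyadic_range|]. unfold dyadic. lra.
  - apply geometric_tends_0. lra.
Qed.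

Lemma lattice_real (tau : C) (x : R) : (0 < Im tau)%R -> (-1 < x < 1)%R -> x <> 0%R ->
  ~ in_lattice tau x.
Proof.
  intros Ht Hx Hx0 [a [b H]].
  assert (Hb : IZR b = 0%R).
  { apply (f_equal Im) in H. unfold Im, RtoC, Cplus, Cmult in H. simpl in H.
    unfold Im in Ht. apply Rmult_eq_reg_r with (snd tau); lra. }
  rewrite Hb in H. assert (H' : x = IZR a).
  { apply (f_equal Re) in H. unfold Re, RtoC, Cplus, Cmult in H. simpl in H. lra. }
  subst x. destruct Hx as [H1 H2]. apply lt_IZR in H1. apply lt_IZR in H2.
  apply Hx0. f_equal. lia.
Qed.

Lemma lattice_dyadic (tau : C) (n : nat) : (0 < Im tau)%R -> ~ in_lattice tau (dyadic n).
Proof. intros Ht. pose proof (dyadic_range n). apply lattice_real; [assumption|lra|lra]. Qed.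

(** Two exceptional n would give a real nonzero lattice point of modulus below 1, so there is at
    most one. *)
Lemma lattice_dyadic_sub (tau u : C) : (0 < Im tau)%R ->
  exists n0, forall n, (n0 <= n)%nat -> ~ in_lattice tau (u - dyadic n).
Proof.
  intros Ht.
  destruct (Classical_Prop.classic (exists m, in_lattice tau (u - dyadic m))) as [[m [a [b Hm]]]|Hn].
  - exists (S m). intros n Hnm [a' [b' H]].
    pose proof (dyadic_range n) as Rn. pose proof (dyadic_range m) as Rm.
    assert (Hlt : (dyadic n < dyadic m)%R).
    { unfold dyadic. replace n with (m + 1 + (n - m - 1))%nat by lia. rewrite !pow_add.
      assert (0 < (/ 2) ^ m)%R by (apply pow_lt; lra).
      assert (0 < (/ 2) ^ (n - m - 1))%R by (apply pow_lt; lra).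
      assert ((/ 2) ^ (n - m - 1) <= 1)%R by (rewrite <- (pow1 (n - m - 1)); apply pow_incr; lra).
      simpl. nra. }
    apply (lattice_real tau (dyadic n - dyadic m) Ht); [lra|lra|].
    exists (a - a')%Z, (b - b')%Z. rewrite !minus_IZR, !RtoC_minus.
    replace (dyadic n - dyadic m) with ((u - dyadic m) - (u - dyadic n)) by ring.
    rewrite Hm, H. ring.
  - exists 0%nat. intros n _ H. apply Hn. eauto.
Qed.

Lemma ee_real_mult_tends (k : Z) (x : nat -> R) :
  Ctends (fun n => ee (x n)) 1 -> Ctends (fun n => ee (IZC k * x n)) 1.
Proof.
  intros H.
  assert (A : forall m : nat, Ctends (fun n => ee (IZC (Z.of_nat m) * x n)) 1).
  { induction m as [|m IH].
    - apply (Ctends_ext (fun _ => 1)); [|apply Ctends_const].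
      intros n. rewrite <- ee_0. f_equal. unfold IZC. simpl. ring.
    - pose proof (Ctends_mult _ _ _ _ IH H) as P. rewrite Cmult_1_l in P.
      eapply Ctends_ext; [|exact P]. intros n. cbv beta. rewrite <- ee_plus. f_equal.
      replace (Z.of_nat (S m)) with (Z.of_nat m + 1)%Z by lia. rewrite IZC_plus. unfold IZC. ring. }
  destruct (Z_le_gt_dec 0 k) as [Hk|Hk].
  - replace k with (Z.of_nat (Z.to_nat k)) by lia. apply A.
  - specialize (A (Z.to_nat (- k))). replace (Z.of_nat (Z.to_nat (- k))) with (- k)%Z in A by lia.
    intros eps He. destruct (A eps He) as [n0 Hn]. exists n0. intros n Hle. specialize (Hn n Hle).
    assert (U : Cmod (ee (IZC k * x n)) = 1%R).
    { rewrite Cmod_ee, Im_IZC_mult. unfold RtoC, Im. simpl.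
      replace (- (2 * PI * (IZR k * 0)))%R with 0%R by ring. apply exp_0. }
    replace (ee (IZC k * x n) - 1) with (- ee (IZC k * x n) * (ee (IZC (- k) * x n) - 1)).
    + rewrite Cmod_mult, Cmod_opp, U, Rmult_1_l. exact Hn.
    + rewrite IZC_opp. replace (- IZC k * x n) with (- (IZC k * x n)) by ring.
      rewrite ee_opp. field. apply ee_neq_0.
Qed.

(** A real displacement leaves the modulus of every Euler term unchanged, so the moduli of the terms
    at w are a majorant for Tannery's theorem. *)
Lemma ph_real_tends (tau w : C) (x : nat -> R) : (0 < Im tau)%R ->
  Ctends (fun n => ee (x n)) 1 -> Ctends (fun n => ph tau (w + x n)) (ph tau w).
Proof.
  intros Ht Hx. rewrite <- euler_ph by assumption.
  eapply Ctends_ext; [intros n; apply euler_ph; assumption|].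
  apply (tannery zl _ _ (fun k => Cmod (rq tau k *
    ee (IZC k / 2 + tau * IZC k * (IZC k - 1) / 2 + IZC k * w)))).
  - apply exhaustion_zl.
  - now apply superexp_summable, euler_term_superexp.
  - intros n M k _. rewrite Cmult_plus_distr_l, Cplus_assoc, ee_plus, Cmult_assoc.
    rewrite Cmod_mult. right.
    rewrite (Cmod_ee (IZC k * x n)), Im_IZC_mult.
    replace (- (2 * PI * (IZR k * Im (x n))))%R with 0%R
      by (unfold RtoC, Im; simpl; ring).
    rewrite exp_0. ring.
  - intros M k _.
    pose proof (Ctends_scal (rq tau k * ee (IZC k / 2 + tau * IZC k * (IZC k - 1) / 2 + IZC k * w))
      _ _ (ee_real_mult_tends k x Hx)) as T.
    rewrite Cmult_1_r in T. eapply Ctends_ext; [|exact T].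
    intros n. cbv beta. rewrite <- Cmult_assoc, <- ee_plus. do 2 f_equal. ring.
Qed.

(** For k <> 0, |q^k| is at most |q| or at least 1/|q|, and 1/|q| - 1 >= 1 - |q|. *)
Lemma Cmod_one_minus_ge (x : C) (k : Z) (tau : C) :
  (0 < Im tau)%R -> Cmod x = 1%R -> k <> 0%Z ->
  (1 - Cmod (ee tau) <= Cmod (1 - x * ee (IZC k * tau)))%R.
Proof.
  intros Ht Hx Hk.
  pose proof (Cmod_ee_tau_lt_1 tau Ht) as Hq. pose proof (Cmod_ge_0 (ee tau)) as Hq0.
  assert (Hpos : (0 < Cmod (ee tau))%R) by apply Cmod_gt_0, ee_neq_0.
  destruct (Z_le_gt_dec 0 k) as [H|H].
  - assert (A : (Cmod (ee (IZC k * tau)) <= Cmod (ee tau))%R).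
    { replace (IZC k * tau) with (IZC (k - 1) * tau + tau) by (rewrite IZC_minus; unfold IZC; ring).
      rewrite ee_plus, Cmod_mult.
      assert (Cmod (ee (IZC (k - 1) * tau)) <= 1)%R; [|nra].
      apply Cmod_ee_le_1. rewrite Im_IZC_mult. apply Rmult_le_pos; [apply IZR_le; lia|lra]. }
    pose proof (Cmod_triangle (1 - x * ee (IZC k * tau)) (x * ee (IZC k * tau))) as T.
    replace (1 - x * ee (IZC k * tau) + x * ee (IZC k * tau)) with (RtoC 1) in T by ring.
    rewrite Cmod_1, (Cmod_mult x), Hx in T. lra.
  - assert (A : (/ Cmod (ee tau) <= Cmod (ee (IZC k * tau)))%R).
    { replace (IZC k * tau) with (- (IZC (- k - 1) * tau) + - tau)
        by (rewrite IZC_minus, IZC_opp; unfold IZC; ring).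
      rewrite ee_plus, Cmod_mult, !ee_opp, !Cmod_inv by apply ee_neq_0.
      assert (B : (Cmod (ee (IZC (- k - 1) * tau)) <= 1)%R).
      { apply Cmod_ee_le_1. rewrite Im_IZC_mult. apply Rmult_le_pos; [apply IZR_le; lia|lra]. }
      assert (B0 : (0 < Cmod (ee (IZC (- k - 1) * tau)))%R) by apply Cmod_gt_0, ee_neq_0.
      assert (1 <= / Cmod (ee (IZC (- k - 1) * tau)))%R.
      { rewrite <- Rinv_1 at 1. apply Rinv_le_contravar; lra. }
      assert (0 < / Cmod (ee tau))%R by now apply Rinv_0_lt_compat. nra. }
    assert (A' : (2 - Cmod (ee tau) <= / Cmod (ee tau))%R).
    { apply (Rmult_le_reg_r (Cmod (ee tau))); [assumption|]. rewrite Rinv_l by lra. nra. }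
    pose proof (Cmod_triangle (1 - x * ee (IZC k * tau)) (- (1))) as T.
    replace (1 - x * ee (IZC k * tau) + - (1)) with (- (x * ee (IZC k * tau))) in T by ring.
    rewrite !Cmod_opp, Cmod_1, Cmod_mult, Hx in T. lra.
Qed.

(* Only the term [n = 0] of [appell tau w 0] is singular at [w = 0]. *)
Lemma appell_0_residue (tau : C) : (0 < Im tau)%R ->
  Ctends (fun n => (1 - ee (dyadic n)) * appell tau (dyadic n) 0) 1.
Proof.
  intros Ht.
  assert (U : forall n, Cmod (ee (dyadic n)) = 1%R).
  { intros n. rewrite Cmod_ee. unfold RtoC, Im. simpl.
    replace (- (2 * PI * 0))%R with 0%R by ring. apply exp_0. }
  assert (Hq : (0 < 1 - Cmod (ee tau))%R) by (pose proof (Cmod_ee_tau_lt_1 tau Ht); lra).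
  assert (T : Ctends (fun n => Csum zl (fun k => (1 - ee (dyadic n)) * appell_term tau (dyadic n) 0 k))
     (Csum zl (fun k => if Z.eqb k 0 then 1 else 0))).
  (* In the constant, 1 covers k = 0, where the two factors cancel, and 2 / (1 - |q|) covers the
     other k by [Cmod_one_minus_ge]. *)
  { apply (tannery zl _ _ (fun k => (1 + 2 / (1 - Cmod (ee tau))) * Cmod (theta_term tau (tau - 0) k))%R).
    - apply exhaustion_zl.
    - destruct (superexp_summable _ (theta_term_superexp tau (tau - 0) Ht)) as [_ [B HB]].
      assert (0 < 2 / (1 - Cmod (ee tau)))%R by (apply Rdiv_lt_0_compat; lra). split.
      + intros k. apply Rmult_le_pos; [lra|apply Cmod_ge_0].
      + exists ((1 + 2 / (1 - Cmod (ee tau))) * B)%R. intros M. rewrite rsum_scal.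
        apply Rmult_le_compat_l; [lra|apply HB].
    - intros n M k _. unfold appell_term.
      replace ((1 - ee (dyadic n)) *
         (theta_term tau (tau - 0) k * / (1 - ee (dyadic n + IZC k * tau))))
        with ((1 - ee (dyadic n)) * / (1 - ee (dyadic n + IZC k * tau)) *
           theta_term tau (tau - 0) k) by ring.
      rewrite Cmod_mult. apply Rmult_le_compat_r; [apply Cmod_ge_0|].
      assert (0 < 2 / (1 - Cmod (ee tau)))%R by (apply Rdiv_lt_0_compat; lra).
      pose proof (one_minus_ee_neq_0 tau _ k (lattice_dyadic tau n Ht)) as Hn0.
      destruct (Z.eq_dec k 0) as [->|Hk].
      + replace (dyadic n + IZC 0 * tau) with (RtoC (dyadic n)) in * by (unfold IZC; ring).
        rewrite Cinv_r, Cmod_1 by assumption. lra.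
      + rewrite Cmod_mult, Cmod_inv by assumption.
        assert (A1 : (Cmod (1 - ee (dyadic n)) <= 2)%R).
        { eapply Rle_trans; [apply Cmod_triangle|]. rewrite Cmod_opp, Cmod_1, U. lra. }
        assert (A2 : (/ Cmod (1 - ee (dyadic n + IZC k * tau)) <= / (1 - Cmod (ee tau)))%R).
        { apply Rinv_le_contravar; [assumption|]. rewrite ee_plus.
          now apply Cmod_one_minus_ge. }
        apply Rle_trans with (2 * / (1 - Cmod (ee tau)))%R; [|unfold Rdiv in *; lra].
        apply Rmult_le_compat; try apply Cmod_ge_0; try assumption.
        left. apply Rinv_0_lt_compat. now apply Cmod_gt_0.
    - intros M k _. destruct (Z.eqb_spec k 0) as [->|Hk].
      + apply (Ctends_ext (fun _ => 1)); [|apply Ctends_const].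
        intros n. unfold appell_term, theta_term.
        pose proof (one_minus_ee_neq_0 tau _ 0 (lattice_dyadic tau n Ht)) as Hn0.
        replace (dyadic n + IZC 0 * tau) with (RtoC (dyadic n)) in * by (unfold IZC; ring).
        replace (IZC 0 / 2 + tau * IZC 0 * (IZC 0 - 1) / 2 + IZC 0 * (tau - 0)) with (RtoC 0)
          by (unfold IZC; field).
        rewrite ee_0. field. assumption.
      + apply (Ctends_squeeze _ _ (fun n =>
          (Cmod (theta_term tau (tau - 0) k) * / (1 - Cmod (ee tau)) * (4 * PI * / 2)) * (/ 2) ^ n)%R).
        * intros n. unfold appell_term.
          pose proof (one_minus_ee_neq_0 tau _ k (lattice_dyadic tau n Ht)) as Hn0.
          replace ((1 - ee (dyadic n)) *
             (theta_term tau (tau - 0) k * / (1 - ee (dyadic n + IZC k * tau))) - 0)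
            with (theta_term tau (tau - 0) k * / (1 - ee (dyadic n + IZC k * tau)) *
                  (1 - ee (dyadic n))) by ring.
          rewrite !Cmod_mult, Cmod_inv by assumption.
          rewrite (Rmult_assoc (_ * / (1 - _)) _ ((/ 2) ^ n)).
          apply Rmult_le_compat.
          -- apply Rmult_le_pos; [apply Cmod_ge_0|]. left. apply Rinv_0_lt_compat. now apply Cmod_gt_0.
          -- apply Cmod_ge_0.
          -- apply Rmult_le_compat_l; [apply Cmod_ge_0|]. apply Rinv_le_contravar; [assumption|].
             rewrite ee_plus. now apply Cmod_one_minus_ge.
          -- rewrite Cmod_sub_sym. eapply Rle_trans; [apply ee_near_1, dyadic_range|].
             unfold dyadic. lra.
        * apply geometric_tends_0. lra. }
  rewrite Csum_single in T. eapply Ctends_ext; [|exact T].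
  intros n. cbv beta. unfold appell. apply Csum_scal; [apply exhaustion_zl|].
  apply appell_term_summable; [assumption|]. now apply lattice_dyadic.
Qed.

(** At a dyadic point the factor 1 - e(w) of theta cancels the pole of [appell], and each of the
    three factors left tends to (q;q)_oo. By [appell_0_theta] these values eventually equal the one
    at u. *)
Lemma appell_0 (tau u : C) : (0 < Im tau)%R -> ~ in_lattice tau u ->
  appell tau u 0 * theta tau u = ph tau tau * ph tau tau * ph tau tau.
Proof.
  intros Ht Hu.
  assert (Hneg : Ctends (fun n => ee (- dyadic n)%R) 1).
  { eapply Ctends_ext; [|apply (ee_real_mult_tends (-1) dyadic ee_dyadic_tends)].
    intros n. cbv beta. f_equal. rewrite RtoC_opp. unfold IZC. ring. }
  assert (T : Ctends (fun n => appell tau (dyadic n) 0 * theta tau (dyadic n))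
     (1 * (ph tau tau * ph tau tau * ph tau tau))).
  { eapply Ctends_ext; [|apply Ctends_mult; [apply (appell_0_residue tau Ht)|
      apply Ctends_mult; [apply Ctends_scal, (ph_real_tends tau tau _ Ht ee_dyadic_tends)|
      apply (ph_real_tends tau tau _ Ht Hneg)]]].
    intros n. cbv beta. unfold theta. rewrite (ph_step tau (dyadic n)) by assumption.
    rewrite RtoC_opp, (Cplus_comm (dyadic n) tau). unfold Cminus. ring. }
  rewrite Cmult_1_l in T.
  destruct (lattice_dyadic_sub tau u Ht) as [n0 Hn0].
  apply eq_of_Ctends_const. intros eps He. destruct (T eps He) as [n1 Hn1].
  exists (Nat.max n0 n1). intros n Hn.
  rewrite (appell_0_theta tau u (dyadic n)).
  - apply Hn1. lia.
  - assumption.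
  - assumption.
  - now apply lattice_dyadic.
  - apply Hn0. lia.
Qed.

(** At v = 0 the three-term relation loses its second product, since theta vanishes there; its
    constant is then known from [appell_0]. *)
Lemma appell_diff (tau u v z : C) : (0 < Im tau)%R ->
  ~ in_lattice tau u -> ~ in_lattice tau (u - z) ->
  ~ in_lattice tau v -> ~ in_lattice tau (v + z) ->
  appell tau u v / theta tau v - appell tau (u - z) (v + z) / theta tau (v + z) =
  ph tau tau * ph tau tau * ph tau tau * theta tau z * theta tau (v + z - u)
  / (theta tau u * theta tau (z - u) * theta tau v * theta tau (v + z)).
Proof.
  intros Ht Hu Huz Hv Hvz.
  pose proof (appell_three_term tau u 0 z Ht Hu Huz) as H0.
  pose proof (appell_three_term tau u v z Ht Hu Huz) as H.
  set (d := appell_coef tau u z 0 - appell_coef tau (u - z) (- z) 0) in *.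
  replace (0 + z) with z in H0 by ring. rewrite theta_0 in H0 by assumption.
  pose proof (appell_0 tau u Ht Hu) as HR.
  pose proof (theta_neq_0 tau u Ht Hu) as Nu.
  pose proof (theta_neq_0 tau v Ht Hv) as Nv.
  pose proof (theta_neq_0 tau _ Ht Hvz) as Nvz.
  pose proof (theta_neq_0 tau _ Ht (lattice_opp_sub _ _ _ Huz)) as Nzu.
  assert (Hd : d = ph tau tau * ph tau tau * ph tau tau * theta tau z
     / (theta tau u * theta tau (z - u))).
  { rewrite <- HR.
    replace d with (d * theta tau (z - u) / theta tau (z - u)) by (field; assumption).
    rewrite <- H0. field. split; assumption. }
  transitivity ((appell tau u v * theta tau (v + z) - appell tau (u - z) (v + z) * theta tau v)
     / (theta tau v * theta tau (v + z))).
  - field. split; assumption.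
  - rewrite H, Hd. field. repeat split; assumption.
Qed.

(** * Partial fractions of [(a x; q)_oo / (x; q)_oo] *)

(* With [a = e(b)]: [a^k (q/a; q)_k / (q; q)_k], extended by [0] to negative [k]. *)
Definition rho (tau b : C) (k : Z) : C :=
  rq tau k * ee (IZC k * b) * qpoch (ee (tau - b)) (ee tau) (Z.to_nat k).

Lemma rho_neg (tau b : C) (k : Z) : (0 < Im tau)%R -> (k < 0)%Z -> rho tau b k = 0.
Proof. intros Ht Hk. unfold rho. rewrite rq_neg by assumption. ring. Qed.

Lemma rho_0 (tau b : C) : (0 < Im tau)%R -> rho tau b 0 = 1.
Proof.
  intros Ht. unfold rho. rewrite rq_0 by assumption. unfold qpoch. simpl.
  replace (IZC 0 * b) with (RtoC 0) by (unfold IZC; ring). rewrite ee_0. ring.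
Qed.

(** Passing to k + 1 adds the factors a (1 - q^(k+1)/a) and 1/(1 - q^(k+1)). At k = -1 both sides
    vanish, so the recursion holds on all of Z. *)
Lemma rho_succ (tau b : C) (k : Z) : (0 < Im tau)%R ->
  (1 - ee (IZC (k + 1) * tau)) * rho tau b (k + 1) = (ee b - ee (IZC (k + 1) * tau)) * rho tau b k.
Proof.
  intros Ht. destruct (Z_lt_le_dec k 0) as [Hk|Hk].
  - rewrite (rho_neg tau b k) by assumption.
    destruct (Z.eq_dec k (-1)) as [->|Hk1].
    + simpl. replace (IZC 0 * tau) with (RtoC 0) by (unfold IZC; ring). rewrite ee_0. ring.
    + rewrite rho_neg by (assumption || lia). ring.
  - unfold rho. replace (Z.to_nat (k + 1)) with (S (Z.to_nat k)) by lia.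
    pose proof (rq_pred tau (k + 1) Ht) as Hp. replace (k + 1 - 1)%Z with k in Hp by lia.
    rewrite Hp.
    unfold qpoch. simpl cprod. rewrite ee_pow, <- ee_plus, Z2Nat.id by assumption.
    replace (ee (IZC (k + 1) * b)) with (ee b * ee (IZC k * b))
      by (rewrite <- ee_plus; f_equal; rewrite IZC_plus; unfold IZC; ring).
    replace (ee (IZC (k + 1) * tau)) with (ee b * ee (tau - b + IZC k * tau))
      by (rewrite <- ee_plus; f_equal; rewrite IZC_plus; unfold IZC; ring).
    ring.
Qed.

Lemma rho_exp_bounded (tau b : C) : (0 < Im tau)%R -> exp_bounded (rho tau b).
Proof.
  intros Ht. apply exp_bounded_mult; [apply exp_bounded_mult|].
  - now apply rq_exp_bounded.
  - apply (exp_bounded_ee _ b 0). intros n. ring.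
  - apply (exp_bounded_of_bounded _ (qpoch_majorant (ee (tau - b)) (ee tau))).
    intros n. apply qpoch_le_majorant. now apply Cmod_ee_tau_lt_1.
Qed.

Lemma rho_summable (tau b : C) : (0 < Im tau)%R -> (0 < Im b)%R -> summable zl (rho tau b).
Proof.
  intros Ht Hb. destruct (rq_bounded tau Ht) as [K HK].
  apply (one_sided_summable _ (K * qpoch_majorant (ee (tau - b)) (ee tau)) (Cmod (ee b))).
  - split; [apply Cmod_ge_0|now apply Cmod_ee_tau_lt_1].
  - intros k Hk. now apply rho_neg.
  - intros k. unfold rho. rewrite !Cmod_mult, <- Cmod_pow, ee_pow.
    replace (K * qpoch_majorant (ee (tau - b)) (ee tau) * Cmod (ee (IZC (Z.of_nat k) * b)))%R
      with (K * Cmod (ee (IZC (Z.of_nat k) * b)) * qpoch_majorant (ee (tau - b)) (ee tau))%R by ring.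
    apply Rmult_le_compat.
    + apply Rmult_le_pos; apply Cmod_ge_0.
    + apply Cmod_ge_0.
    + apply Rmult_le_compat_r; [apply Cmod_ge_0|apply HK].
    + apply qpoch_le_majorant. now apply Cmod_ee_tau_lt_1.
Qed.

(** Only poles with k >= 0 occur because rho_k = 0 for k < 0. In particular w = tau is admissible
    although it is a lattice point, and [Csum_rho] evaluates there. *)
Definition off_poles (tau w : C) : Prop := forall k, (0 <= k)%Z -> 1 - ee (w + IZC k * tau) <> 0.

Lemma off_poles_shift (tau w : C) (n : Z) :
  (0 <= n)%Z -> off_poles tau w -> off_poles tau (w + IZC n * tau).
Proof.
  intros Hn H k Hk. replace (w + IZC n * tau + IZC k * tau) with (w + IZC (n + k) * tau).
  - apply H. lia.
  - rewrite IZC_plus. ring.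
Qed.

Lemma off_poles_lattice (tau w : C) : ~ in_lattice tau w -> off_poles tau w.
Proof. intros H k _. now apply one_minus_ee_neq_0. Qed.

Definition simple_fractions (tau b w : C) : C :=
  Csum zl (fun k => rho tau b k * / (1 - ee (w + IZC k * tau))).

Lemma simple_fractions_bound (tau b w : C) : (0 < Im tau)%R ->
  off_poles tau w -> exists K, (0 <= K)%R /\ forall n k, (0 <= n)%Z ->
  (Cmod (rho tau b k * / (1 - ee (w + IZC n * tau + IZC k * tau))) <= K * Cmod (rho tau b k))%R.
Proof.
  intros Ht Hw. destruct (inv_one_minus_ee_bounded tau w Ht) as [K HK].
  exists K. split.
  - eapply Rle_trans; [apply Cmod_ge_0|apply (HK 0%Z)]. apply Hw. lia.
  - intros n k Hn. destruct (Z_lt_le_dec k 0) as [Hk|Hk].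
    + rewrite rho_neg by assumption. rewrite Cmult_0_l, Cmod_0. lra.
    + rewrite Cmod_mult, Rmult_comm. apply Rmult_le_compat_r; [apply Cmod_ge_0|].
      replace (w + IZC n * tau + IZC k * tau) with (w + IZC (n + k) * tau)
        by (rewrite IZC_plus; ring).
      apply HK. apply Hw. lia.
Qed.

Lemma rsummable_scal {I : Type} (E : nat -> list I) (K : R) (g : I -> R) :
  (0 <= K)%R -> rsummable E g -> rsummable E (fun i => K * g i)%R.
Proof.
  intros HK [Hg [B HB]]. split.
  - intros i. now apply Rmult_le_pos.
  - exists (K * B)%R. intros M. rewrite rsum_scal. now apply Rmult_le_compat_l.
Qed.

Lemma simple_fractions_summable (tau b w : C) : (0 < Im tau)%R -> (0 < Im b)%R ->
  off_poles tau w -> summable zl (fun k => rho tau b k * / (1 - ee (w + IZC k * tau))).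
Proof.
  intros Ht Hb Hw. destruct (simple_fractions_bound tau b w Ht Hw) as [K [HK H]].
  apply (dominated_summable zl _ (fun k => K * Cmod (rho tau b k))%R).
  - intros M k _. specialize (H 0%Z k (Z.le_refl 0)).
    replace (w + IZC 0 * tau + IZC k * tau) with (w + IZC k * tau) in H by (unfold IZC; ring).
    exact H.
  - apply rsummable_scal; [assumption|]. now apply rho_summable.
Qed.

(** With x = e(w) and g_k = x (1 - q^k) rho_k / (1 - x q^k), the left side is the sum of rho_k - g_k
    and, by the recursion for rho, the right side is the sum of rho_k - g_(k+1). *)
Lemma simple_fractions_step (tau b w : C) : (0 < Im tau)%R -> (0 < Im b)%R -> off_poles tau w ->
  (1 - ee w) * simple_fractions tau b w = (1 - ee (w + b)) * simple_fractions tau b (w + tau).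
Proof.
  intros Ht Hb Hw.
  pose proof (rho_summable tau b Ht Hb) as Hr.
  assert (Hw1 : off_poles tau (w + tau)).
  { replace (w + tau) with (w + IZC 1 * tau) by (unfold IZC; ring).
    apply off_poles_shift; [lia|assumption]. }
  pose proof (simple_fractions_summable tau b w Ht Hb Hw) as Hs.
  pose proof (simple_fractions_summable tau b (w + tau) Ht Hb Hw1) as Hs1.
  set (g := fun k => rho tau b k - (1 - ee w) * (rho tau b k * / (1 - ee (w + IZC k * tau)))).
  assert (Hg : forall k, g k = ee w * (1 - ee (IZC k * tau)) * rho tau b k
     * / (1 - ee (w + IZC k * tau))).
  { intros k. unfold g. destruct (Z_lt_le_dec k 0) as [Hk|Hk].
    - rewrite rho_neg by assumption. ring.
    - pose proof (Hw k Hk) as Hn. rewrite ee_plus in *. field. assumption. }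
  assert (Hsg : summable zl g).
  { unfold g. apply (dominated_summable zl _
      (fun k => Cmod (rho tau b k) + Cmod ((1 - ee w) * (rho tau b k * / (1 - ee (w + IZC k * tau)))))%R).
    - intros M k _. eapply Rle_trans; [apply Cmod_triangle|]. rewrite Cmod_opp. lra.
    - destruct Hr as [_ [B HB]]. destruct (summable_scal zl (1 - ee w) _ Hs) as [_ [B' HB']].
      split.
      + intros k. apply Rplus_le_le_0_compat; apply Cmod_ge_0.
      + exists (B + B')%R. intros M. specialize (HB M). specialize (HB' M). clear - HB HB'.
        eapply Rle_trans; [|apply Rplus_le_compat; [exact HB|exact HB']]. right. clear.
        induction (zl M) as [|k l IH]; simpl; [ring|rewrite IH; ring]. }
  assert (E1 : (1 - ee w) * simple_fractions tau b w = Csum zl (rho tau b) - Csum zl g).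
  { unfold simple_fractions. rewrite <- Csum_scal by auto using exhaustion_zl.
    rewrite <- Csum_minus by auto using exhaustion_zl. apply Csum_ext. intros k. unfold g. ring. }
  assert (E2 : (1 - ee (w + b)) * simple_fractions tau b (w + tau)
     = Csum zl (rho tau b) - Csum zl (fun k => g (k + 1)%Z)).
  { unfold simple_fractions. rewrite <- Csum_scal by auto using exhaustion_zl.
    rewrite <- Csum_minus by auto using exhaustion_zl, summable_shift. apply Csum_ext. intros k.
    rewrite Hg.
    replace (ee w * (1 - ee (IZC (k + 1) * tau)) * rho tau b (k + 1))
      with (ee w * ((1 - ee (IZC (k + 1) * tau)) * rho tau b (k + 1))) by ring.
    rewrite rho_succ by assumption.
    replace (w + tau + IZC k * tau) with (w + IZC (k + 1) * tau)
      by (rewrite IZC_plus; unfold IZC; ring).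
    destruct (Z_lt_le_dec k 0) as [Hk|Hk].
    - rewrite rho_neg by assumption. ring.
    - pose proof (Hw (k + 1)%Z ltac:(lia)) as Hn. rewrite !ee_plus in *. field. assumption. }
  rewrite E1, E2, Csum_shift by assumption. reflexivity.
Qed.

Lemma simple_fractions_limit (tau b w : C) : (0 < Im tau)%R -> (0 < Im b)%R -> off_poles tau w ->
  Ctends (fun n => simple_fractions tau b (w + IZC (Z.of_nat n) * tau)) (Csum zl (rho tau b)).
Proof.
  intros Ht Hb Hw. destruct (simple_fractions_bound tau b w Ht Hw) as [K [HK H]].
  pose proof (Cmod_ee_tau_lt_1 tau Ht) as Hq.
  apply (tannery zl _ _ (fun k => K * Cmod (rho tau b k))%R).
  - apply exhaustion_zl.
  - apply rsummable_scal; [assumption|]. now apply rho_summable.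
  - intros n M k _. apply H. lia.
  - intros M k _. destruct (Z_lt_le_dec k 0) as [Hk|Hk].
    + apply (Ctends_ext (fun _ => 0)).
      * intros n. rewrite rho_neg by assumption. ring.
      * rewrite rho_neg by assumption. apply Ctends_const.
    + apply (Ctends_squeeze _ _ (fun n =>
        (K * Cmod (rho tau b k) * Cmod (ee (w + IZC k * tau))) * Cmod (ee tau) ^ n)%R).
      * intros n. set (n' := Z.of_nat n).
        pose proof (off_poles_shift tau w n' (Zle_0_nat n) Hw k Hk) as Hn0.
        replace (rho tau b k * / (1 - ee (w + IZC n' * tau + IZC k * tau)) - rho tau b k)
          with (rho tau b k * / (1 - ee (w + IZC n' * tau + IZC k * tau)) *
                ee (w + IZC n' * tau + IZC k * tau)) by (field; assumption).
        rewrite Cmod_mult.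
        replace (ee (w + IZC n' * tau + IZC k * tau)) with (ee (w + IZC k * tau) * ee tau ^ n) at 2
          by (rewrite ee_pow, <- ee_plus; f_equal; unfold n'; ring).
        rewrite (Cmod_mult (ee (w + IZC k * tau))), Cmod_pow, (Rmult_assoc (K * _)).
        apply Rmult_le_compat_r.
        -- apply Rmult_le_pos; [apply Cmod_ge_0|apply pow_le, Cmod_ge_0].
        -- apply H. apply Zle_0_nat.
      * apply geometric_tends_0. split; [apply Cmod_ge_0|assumption].
Qed.

(** Iterating the step carries x to x q^n, where all denominators tend to 1 and only the sum of the
    rho_k remains. *)
Lemma simple_fractions_ph (tau b w : C) : (0 < Im tau)%R -> (0 < Im b)%R -> off_poles tau w ->
  ph tau w * simple_fractions tau b w = ph tau (w + b) * Csum zl (rho tau b).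
Proof.
  intros Ht Hb Hw.
  assert (A : forall n, qpoch (ee w) (ee tau) n * simple_fractions tau b w =
     qpoch (ee (w + b)) (ee tau) n * simple_fractions tau b (w + IZC (Z.of_nat n) * tau)).
  { induction n as [|n IH].
    - unfold qpoch. simpl. do 2 f_equal. unfold IZC. ring.
    - unfold qpoch in *. simpl cprod. rewrite !ee_pow, <- !ee_plus.
      match goal with |- ?p * ?x * ?h = _ => replace (p * x * h) with (x * (p * h)) by ring end.
      rewrite IH.
      match goal with |- ?x * (?p * ?h) = _ => replace (x * (p * h)) with (p * (x * h)) by ring end.
      rewrite simple_fractions_step
        by (try apply off_poles_shift; assumption || apply Zle_0_nat).
      replace (w + IZC (Z.of_nat n) * tau + b) with (w + b + IZC (Z.of_nat n) * tau) by ring.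
      replace (w + IZC (Z.of_nat n) * tau + tau) with (w + IZC (Z.of_nat (S n)) * tau).
      + ring.
      + replace (Z.of_nat (S n)) with (Z.of_nat n + 1)%Z by lia. rewrite IZC_plus. unfold IZC. ring. }
  pose proof (Cmod_ee_tau_lt_1 tau Ht) as Hq.
  apply (Ctends_unique (fun n => qpoch (ee w) (ee tau) n * simple_fractions tau b w)).
  - apply Ctends_mult; [now apply qpoch_tends|apply Ctends_const].
  - eapply Ctends_ext; [intros n; symmetry; exact (A n)|].
    apply Ctends_mult; [now apply qpoch_tends|now apply simple_fractions_limit].
Qed.

(* The normalization comes from comparing both sides at the pole [w = 0]. *)
Lemma Csum_rho (tau b : C) : (0 < Im tau)%R -> (0 < Im b)%R ->
  ph tau b * Csum zl (rho tau b) = ph tau tau.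
Proof.
  intros Ht Hb.
  assert (Hoff : off_poles tau tau).
  { intros k Hk. apply ee_upper_neq_1. rewrite Im_plus, Im_IZC_mult.
    apply IZR_le in Hk. nra. }
  pose proof (rho_summable tau b Ht Hb) as Hr.
  (* At w = tau the fractions telescope: (1 - a) rho_k / (1 - q^(k+1)) = rho_k - rho_(k+1) for k >=
     0. The indicator at k = -1 compensates the term - rho_0. *)
  assert (E : (1 - ee b) * simple_fractions tau b tau = 1).
  { unfold simple_fractions.
    rewrite <- Csum_scal by auto using exhaustion_zl, simple_fractions_summable.
    transitivity (Csum zl (fun k => rho tau b k - rho tau b (k + 1)%Z + (if Z.eqb k (-1) then 1 else 0))).
    - apply Csum_ext. intros k. replace (tau + IZC k * tau) with (IZC (k + 1) * tau)
        by (rewrite IZC_plus; unfold IZC; ring).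
      destruct (Z.eqb_spec k (-1)) as [->|Hk1].
      + rewrite (rho_neg tau b (-1)) by (assumption || lia). simpl. rewrite rho_0 by assumption. ring.
      + destruct (Z_lt_le_dec k 0) as [Hk|Hk].
        * rewrite !rho_neg by (assumption || lia). ring.
        * assert (Hn : 1 - ee (IZC (k + 1) * tau) <> 0).
          { apply ee_upper_neq_1. rewrite Im_IZC_mult. apply Rmult_lt_0_compat; [|assumption].
            apply IZR_lt. lia. }
          replace (rho tau b (k + 1)) with
            ((1 - ee (IZC (k + 1) * tau)) * rho tau b (k + 1) * / (1 - ee (IZC (k + 1) * tau)))
            by (field; assumption).
          rewrite rho_succ by assumption. field. assumption.
    - assert (S1 := summable_shift 1 _ Hr).
      assert (S2 : summable zl (fun k => if Z.eqb k (-1) then 1 else 0)).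
      { apply (summable_finite _ (-1)). intros n Hn. destruct (Z.eqb_spec n (-1)); tauto. }
      pose proof (Ctends_plus _ _ _ _ (Ctends_minus _ _ _ _
        (summable_tends zl _ exhaustion_zl Hr) (summable_tends zl _ exhaustion_zl S1))
        (summable_tends zl _ exhaustion_zl S2)) as T.
      rewrite Csum_shift, Csum_single in T by assumption.
      replace (Csum zl (rho tau b) - Csum zl (rho tau b) + 1) with (RtoC 1) in T by ring.
      apply Csum_eq. eapply Ctends_ext; [|exact T].
      intros M. cbv beta. rewrite lsum_plus, lsum_minus. reflexivity. }
  pose proof (simple_fractions_ph tau b tau Ht Hb Hoff) as P.
  rewrite (ph_step tau b) by assumption. rewrite (Cplus_comm b tau).
  replace ((1 - ee b) * ph tau (tau + b) * Csum zl (rho tau b))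
    with ((1 - ee b) * (ph tau (tau + b) * Csum zl (rho tau b))) by ring.
  rewrite <- P.
  replace ((1 - ee b) * (ph tau tau * simple_fractions tau b tau))
    with (ph tau tau * ((1 - ee b) * simple_fractions tau b tau)) by ring.
  rewrite E. ring.
Qed.

(** * The one-variable generalized mu-function *)

Definition qratio (tau b w : C) : C := ph tau (w + b) / ph tau w.

Definition mu_term (tau b u v : C) (n : Z) : C :=
  qratio tau b (u + IZC n * tau) * theta_term tau (tau - v) n.

(** This is [hat_mu] for N = 1 and b = alpha tau, stripped of exponential prefactors and with
    [theta] in place of [vtheta]. *)
Definition mu (tau b u v : C) : C := Csum zl (mu_term tau b u v) / theta tau v.

Lemma ph_lattice_neq_0 (tau u : C) : (0 < Im tau)%R -> ~ in_lattice tau u -> ph tau u <> 0.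
Proof.
  intros Ht Hu. apply ph_neq_0; [assumption|]. intros j. now apply one_minus_ee_neq_0.
Qed.

Lemma qratio_step (tau b w : C) : (0 < Im tau)%R -> 1 - ee w <> 0 -> ph tau (w + tau) <> 0 ->
  qratio tau b w = (1 - ee (w + b)) / (1 - ee w) * qratio tau b (w + tau).
Proof.
  intros Ht Hw Hp. unfold qratio.
  rewrite (ph_step tau w), (ph_step tau (w + b)) by assumption.
  replace (w + b + tau) with (w + tau + b) by ring. field. split; assumption.
Qed.

Lemma qpoch_majorant_mono (x y q : C) : (Cmod q < 1)%R -> (Cmod x <= Cmod y)%R ->
  (qpoch_majorant x q <= qpoch_majorant y q)%R.
Proof.
  intros Hq H. unfold qpoch_majorant.
  assert (A : (Cmod x / (1 - Cmod q) <= Cmod y / (1 - Cmod q))%R).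
  { apply Rmult_le_compat_r; [left; apply Rinv_0_lt_compat; lra|assumption]. }
  destruct A as [A|A]; [left; now apply exp_increasing|rewrite A; lra].
Qed.

(* Bounded for [n >= 0]; for [n < 0] each step to the left multiplies by a bounded factor. *)
Lemma qratio_exp_bounded (tau b u : C) : (0 < Im tau)%R -> ~ in_lattice tau u ->
  exp_bounded (fun n => qratio tau b (u + IZC n * tau)).
Proof.
  intros Ht Hu.
  pose proof (Cmod_ee_tau_lt_1 tau Ht) as Hq.
  pose proof (ph_lattice_neq_0 tau u Ht Hu) as Hpu.
  assert (Hpn : forall n, ph tau (u + IZC n * tau) <> 0).
  { intros n. apply ph_lattice_neq_0; [assumption|]. now apply lattice_shift. }
  set (K := (qpoch_majorant (ee (u + b)) (ee tau) * (qpoch_majorant (ee u) (ee tau) / Cmod (ph tau u)))%R).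
  assert (Hpos : forall n : nat, (Cmod (qratio tau b (u + IZC (Z.of_nat n) * tau)) <= K)%R).
  { intros n. unfold qratio, Cdiv. rewrite Cmod_mult. apply Rmult_le_compat; try apply Cmod_ge_0.
    - unfold ph. eapply Rle_trans; [now apply qpoch_inf_le_majorant|].
      apply qpoch_majorant_mono; [assumption|].
      replace (u + IZC (Z.of_nat n) * tau + b) with (u + b + IZC (Z.of_nat n) * tau) by ring.
      rewrite ee_plus, Cmod_mult. rewrite <- (Rmult_1_r (Cmod (ee (u + b)))) at 2.
      apply Rmult_le_compat_l; [apply Cmod_ge_0|]. apply Cmod_ee_le_1.
      rewrite Im_IZC_mult. apply Rmult_le_pos; [apply IZR_le; lia|lra].
    - replace (/ ph tau (u + IZC (Z.of_nat n) * tau)) with (qpoch (ee u) (ee tau) n / ph tau u).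
      + unfold Cdiv. rewrite Cmod_mult, Cmod_inv by assumption.
        apply Rmult_le_compat_r; [left; now apply Rinv_0_lt_compat, Cmod_gt_0|].
        now apply qpoch_le_majorant.
      + specialize (Hpn (Z.of_nat n)).
        assert (E : ph tau u = qpoch (ee u) (ee tau) n * ph tau (u + IZC (Z.of_nat n) * tau)).
        { unfold ph. rewrite (qpoch_inf_split _ _ n Hq), ee_pow, <- ee_plus. reflexivity. }
        rewrite E in Hpu |- *. field. split; [assumption|].
        intros H0. apply Hpu. rewrite H0. ring. }
  destruct (inv_one_minus_ee_bounded tau u Ht) as [K1 HK1].
  assert (HK1' : forall n, (Cmod (/ (1 - ee (u + IZC n * tau))) <= K1)%R).
  { intros n. apply HK1. now apply one_minus_ee_neq_0. }
  assert (HK10 : (0 <= K1)%R) by (eapply Rle_trans; [apply Cmod_ge_0|apply (HK1' 0%Z)]).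
  set (A := (1 + Cmod (ee b) + Cmod (1 - ee b) * K1)%R).
  assert (HA : (1 <= A)%R).
  { unfold A. pose proof (Cmod_ge_0 (ee b)). pose proof (Cmod_ge_0 (1 - ee b)). nra. }
  assert (HK : (0 <= K)%R) by (eapply Rle_trans; [apply Cmod_ge_0|apply (Hpos 0%nat)]).
  assert (Hneg : forall n : nat, (Cmod (qratio tau b (u + IZC (- Z.of_nat n) * tau)) <= K * A ^ n)%R).
  { induction n as [|n IH].
    - specialize (Hpos 0%nat). simpl in *. lra.
    - set (w := u + IZC (- Z.of_nat (S n)) * tau).
      assert (Hw : w + tau = u + IZC (- Z.of_nat n) * tau).
      { unfold w. replace (- Z.of_nat n)%Z with (- Z.of_nat (S n) + 1)%Z by lia.
        rewrite IZC_plus. unfold IZC. ring. }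
      assert (Hn0 : 1 - ee w <> 0) by now apply one_minus_ee_neq_0.
      rewrite qratio_step by (assumption || (rewrite Hw; apply Hpn)).
      rewrite Hw, Cmod_mult. simpl.
      replace (K * (A * A ^ n))%R with (A * (K * A ^ n))%R by ring.
      apply Rmult_le_compat; try apply Cmod_ge_0; [|exact IH].
      (* Written as a + (1 - a) / (1 - x), the factor is bounded because 1/(1 - x) is; this is the
         origin of the constant A. *)
      replace ((1 - ee (w + b)) / (1 - ee w)) with (ee b + (1 - ee b) * / (1 - ee w))
        by (rewrite ee_plus; field; assumption).
      eapply Rle_trans; [apply Cmod_triangle|]. rewrite Cmod_mult. unfold A.
      assert (Cmod (1 - ee b) * Cmod (/ (1 - ee w)) <= Cmod (1 - ee b) * K1)%R.
      { apply Rmult_le_compat_l; [apply Cmod_ge_0|]. apply HK1'. }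
      lra. }
  exists K, A. split; [assumption|]. intros n. unfold zpow.
  destruct (Z_le_gt_dec 0 n) as [Hn|Hn].
  - replace n with (Z.of_nat (Z.to_nat n)) at 1 by lia. eapply Rle_trans; [apply Hpos|].
    assert (1 <= A ^ Z.abs_nat n)%R by now apply pow_R1_Rle. nra.
  - replace n with (- Z.of_nat (Z.abs_nat n))%Z at 1 by lia. apply Hneg.
Qed.

Lemma mu_term_superexp (tau b u v : C) : (0 < Im tau)%R -> ~ in_lattice tau u ->
  superexp_small (mu_term tau b u v).
Proof.
  intros Ht Hu.
  apply (superexp_ext (fun n => theta_term tau (tau - v) n * qratio tau b (u + IZC n * tau))).
  { intros n. unfold mu_term. ring. }
  apply superexp_mult; [now apply theta_term_superexp|now apply qratio_exp_bounded].
Qed.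

Lemma theta_term_neq_0 (tau v : C) (k : Z) : theta_term tau v k <> 0.
Proof. apply ee_neq_0. Qed.

(* Each fraction of the partial fraction expansion contributes an Appell-Lerch sum. *)
Lemma mu_appell (tau b u v : C) : (0 < Im tau)%R -> (0 < Im b)%R ->
  ~ in_lattice tau u -> ~ in_lattice tau v ->
  Ctends (fun M => ph tau b / ph tau tau * lsum (zl M) (fun k =>
      rho tau b k * (appell tau u (v + IZC k * tau) / theta tau (v + IZC k * tau))))
    (mu tau b u v).
Proof.
  intros Ht Hb Hu Hv.
  set (t := fun n => theta_term tau (tau - v) n).
  pose proof (superexp_summable _ (theta_term_superexp tau (tau - v) Ht)) as Hst.
  pose proof (rho_summable tau b Ht Hb) as Hr.
  pose proof (theta_neq_0 tau v Ht Hv) as Nv.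
  pose proof (ph_upper_neq_0 tau tau Ht Ht) as Nt.
  (* The double series after expanding every ratio into fractions. It is dominated by K |t_n|
     |rho_k|, so the two summations may be exchanged. *)
  set (f := fun n k => t n * (rho tau b k * / (1 - ee (u + IZC n * tau + IZC k * tau)))).
  destruct (inv_one_minus_ee_bounded tau u Ht) as [K HK].
  assert (HK' : forall n, (Cmod (/ (1 - ee (u + IZC n * tau))) <= K)%R).
  { intros n. apply HK. now apply one_minus_ee_neq_0. }
  assert (HK0 : (0 <= K)%R) by (eapply Rle_trans; [apply Cmod_ge_0|apply (HK' 0%Z)]).
  destruct Hr as [Hr0 [B HB]]. assert (Hr : summable zl (rho tau b)) by (split; eauto).
  assert (HB0 : (0 <= B)%R) by (eapply Rle_trans; [apply (rsum_nonneg (zl 0)), Hr0|apply HB]).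
  assert (F : Ctends (fun M => lsum (zl M) (fun k => Csum zl (fun n => f n k)))
     (Csum zl (fun n => Csum zl (f n)))).
  { apply (Csum_fubini_Z f (fun n => (K * B) * Cmod (t n))%R).
    - apply rsummable_scal; [nra|]. exact Hst.
    - intros n M. apply Rle_trans with (rsum (zl M) (fun k => (Cmod (t n) * K) * Cmod (rho tau b k)))%R.
      + apply rsum_le. intros k _. unfold f. rewrite !Cmod_mult, Rmult_assoc.
        apply Rmult_le_compat_l; [apply Cmod_ge_0|]. rewrite Rmult_comm.
        apply Rmult_le_compat_r; [apply Cmod_ge_0|].
        replace (u + IZC n * tau + IZC k * tau) with (u + IZC (n + k) * tau)
          by (rewrite IZC_plus; ring). apply HK'.
      + rewrite rsum_scal. replace (K * B * Cmod (t n))%R with (Cmod (t n) * K * B)%R by ring.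
        apply Rmult_le_compat_l; [|apply HB]. apply Rmult_le_pos; [apply Cmod_ge_0|assumption]. }
  assert (E : mu tau b u v = ph tau b / (ph tau tau * theta tau v) * Csum zl (fun n => Csum zl (f n))).
  { unfold mu.
    replace (Csum zl (mu_term tau b u v)) with (ph tau b / ph tau tau * Csum zl (fun n => Csum zl (f n))).
    - field. split; assumption.
    - assert (Hin : forall n, ph tau b / ph tau tau * Csum zl (f n) = mu_term tau b u v n).
      { intros n. unfold f, mu_term.
        assert (Hl : ~ in_lattice tau (u + IZC n * tau)) by now apply lattice_shift.
        pose proof (off_poles_lattice tau _ Hl) as Ho.
        rewrite Csum_scal by auto using exhaustion_zl, simple_fractions_summable.
        change (Csum zl (fun i => rho tau b i * / (1 - ee (u + IZC n * tau + IZC i * tau))))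
          with (simple_fractions tau b (u + IZC n * tau)).
        pose proof (simple_fractions_ph tau b _ Ht Hb Ho) as P.
        pose proof (ph_lattice_neq_0 tau _ Ht Hl) as Np.
        unfold qratio.
        replace (ph tau (u + IZC n * tau + b)) with
          (ph tau b * (ph tau (u + IZC n * tau + b) * Csum zl (rho tau b)) / ph tau tau).
        + rewrite <- P. fold (t n). field. split; assumption.
        + rewrite <- (Csum_rho tau b Ht Hb) in Nt |- *. field.
          split; intros H0; apply Nt; rewrite H0; ring. }
      apply Ctends_unique with (s := fun M => lsum (zl M) (mu_term tau b u v)).
      + eapply Ctends_ext; [|apply Ctends_scal, summable_tends; [apply exhaustion_zl|]].
        * intros M. cbv beta. rewrite <- lsum_scal. apply lsum_ext. intros n _. apply Hin.
        * apply (dominated_summable zl _ (fun n => (K * B) * Cmod (t n))%R).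
          -- intros M n _. apply Csum_Cmod_le; [apply exhaustion_zl|]. intros M'.
             apply Rle_trans with (rsum (zl M') (fun k => (Cmod (t n) * K) * Cmod (rho tau b k)))%R.
             ++ apply rsum_le. intros k _. unfold f. rewrite !Cmod_mult, Rmult_assoc.
                apply Rmult_le_compat_l; [apply Cmod_ge_0|]. rewrite Rmult_comm.
                apply Rmult_le_compat_r; [apply Cmod_ge_0|].
                replace (u + IZC n * tau + IZC k * tau) with (u + IZC (n + k) * tau)
                  by (rewrite IZC_plus; ring). apply HK'.
             ++ rewrite rsum_scal. replace (K * B * Cmod (t n))%R with (Cmod (t n) * K * B)%R by ring.
                apply Rmult_le_compat_l; [|apply HB]. apply Rmult_le_pos; [apply Cmod_ge_0|assumption].
          -- apply rsummable_scal; [nra|]. exact Hst.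
      + apply summable_tends; [apply exhaustion_zl|]. now apply superexp_summable, mu_term_superexp. }
  rewrite E. eapply Ctends_ext; [|apply Ctends_scal, F].
  intros M. cbv beta.
  rewrite <- !lsum_scal. apply lsum_ext. intros k _.
  assert (Hvk : ~ in_lattice tau (v + IZC k * tau)) by now apply lattice_shift.
  pose proof (theta_neq_0 tau _ Ht Hvk) as Nvk.
  (* Shifting n by k frees the denominator of k and turns v into v + k tau. The factor
     [theta_term tau v k] that this produces is the multiplier of theta, and cancels against it. *)
  assert (G : Csum zl (fun n => f n k) = rho tau b k * (theta_term tau v k * appell tau u (v + IZC k * tau))).
  { pose proof (appell_term_summable tau u (v + IZC k * tau) Ht Hu) as Ha.
    unfold appell. rewrite <- (Csum_shift k _ Ha).
    rewrite <- !Csum_scal; try apply exhaustion_zl.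
    - apply Csum_ext. intros n. unfold f, t, appell_term.
      replace (u + IZC n * tau + IZC k * tau) with (u + IZC (n + k) * tau) by (rewrite IZC_plus; ring).
      replace (theta_term tau (tau - v) n) with
        (theta_term tau v k * theta_term tau (tau - (v + IZC k * tau)) (n + k)).
      + ring.
      + unfold theta_term. rewrite <- ee_plus.
        match goal with |- ee ?x = ee ?y => replace x with (y + IZC k) end.
        * rewrite ee_plus, ee_IZC. ring.
        * rewrite IZC_plus. field.
    - apply summable_scal. now apply (summable_shift k _ Ha).
    - now apply (summable_shift k _ Ha). }
  rewrite G, (theta_shift tau v k) by assumption.
  field. repeat split; auto using theta_term_neq_0.
Qed.

(** The series 1phi1(q/a; 0; q; a e(w)): [theta_term] carries its sign and its q^(k(k-1)/2). *)
Definition phi_series (tau b w : C) : C := Csum zl (fun k => rho tau b k * theta_term tau w k).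

Lemma phi_term_superexp (tau b w : C) : (0 < Im tau)%R ->
  superexp_small (fun k => rho tau b k * theta_term tau w k).
Proof.
  intros Ht. apply (superexp_ext (fun k => theta_term tau w k * rho tau b k)).
  { intros. ring. }
  apply superexp_mult; [now apply theta_term_superexp|now apply rho_exp_bounded].
Qed.

Definition theta_quotient (tau u v z : C) : C :=
  theta tau z * theta tau (v + z - u)
  / (theta tau u * theta tau (z - u) * theta tau v * theta tau (v + z)).

(** Two multipliers from the denominator against one from the numerator leave a single Gaussian, at
    the argument v + (v + z) - (v + z - u) = u + v. It becomes the Gaussian of 1phi1. *)
Lemma theta_quotient_shift (tau u v z : C) (k : Z) : (0 < Im tau)%R ->
  ~ in_lattice tau u -> ~ in_lattice tau (u - z) ->
  ~ in_lattice tau v -> ~ in_lattice tau (v + z) ->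
  theta_quotient tau u (v + IZC k * tau) z = theta_quotient tau u v z * theta_term tau (u + v) k.
Proof.
  intros Ht Hu Huz Hv Hvz. unfold theta_quotient.
  replace (v + IZC k * tau + z - u) with (v + z - u + IZC k * tau) by ring.
  replace (v + IZC k * tau + z) with (v + z + IZC k * tau) by ring.
  pose proof (theta_neq_0 tau u Ht Hu) as Nu.
  pose proof (theta_neq_0 tau _ Ht (lattice_opp_sub _ _ _ Huz)) as Nzu.
  pose proof (theta_neq_0 tau _ Ht (lattice_shift tau v k Hv)) as Nv.
  pose proof (theta_neq_0 tau _ Ht (lattice_shift tau _ k Hvz)) as Nvz.
  rewrite (theta_shift tau v k), (theta_shift tau (v + z) k), (theta_shift tau (v + z - u) k)
    by assumption.
  replace (theta_term tau (u + v) k) with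
    (theta_term tau v k * theta_term tau (v + z) k / theta_term tau (v + z - u) k).
  - field. repeat split; auto using theta_term_neq_0.
  - unfold theta_term. unfold Cdiv at 1. rewrite <- ee_opp, <- !ee_plus. f_equal. field.
Qed.

(** [appell_diff] is applied to each fraction, at v + k tau. Its (q;q)_oo^3 meets the 1/(q;q)_oo of
    the expansion, which leaves two powers. *)
Lemma mu_diff_upper (tau b u v z : C) : (0 < Im tau)%R -> (0 < Im b)%R ->
  ~ in_lattice tau u -> ~ in_lattice tau (u - z) ->
  ~ in_lattice tau v -> ~ in_lattice tau (v + z) ->
  mu tau b u v - mu tau b (u - z) (v + z) =
  ph tau b * ph tau tau * ph tau tau * theta_quotient tau u v z * phi_series tau b (u + v).
Proof.
  intros Ht Hb Hu Huz Hv Hvz.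
  pose proof (Ctends_minus _ _ _ _ (mu_appell tau b u v Ht Hb Hu Hv)
     (mu_appell tau b (u - z) (v + z) Ht Hb Huz Hvz)) as T.
  pose proof (ph_upper_neq_0 tau tau Ht Ht) as Nt.
  eapply Ctends_unique; [exact T|].
  eapply Ctends_ext; [|apply Ctends_scal, summable_tends;
    [apply exhaustion_zl|now apply superexp_summable, phi_term_superexp]].
  intros M. cbv beta. rewrite <- !lsum_scal, <- lsum_minus. apply lsum_ext. intros k _.
  replace (v + z + IZC k * tau) with (v + IZC k * tau + z) by ring.
  set (vk := v + IZC k * tau).
  assert (Hvk : ~ in_lattice tau vk) by now apply lattice_shift.
  assert (Hvzk : ~ in_lattice tau (vk + z)).
  { unfold vk. replace (v + IZC k * tau + z) with (v + z + IZC k * tau) by ring.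
    now apply lattice_shift. }
  transitivity (ph tau b / ph tau tau * rho tau b k *
    (appell tau u vk / theta tau vk - appell tau (u - z) (vk + z) / theta tau (vk + z))).
  - replace (theta_quotient tau u v z) with (theta_quotient tau u vk z / theta_term tau (u + v) k).
    + rewrite appell_diff by assumption.
      replace (ph tau tau * ph tau tau * ph tau tau * theta tau z * theta tau (vk + z - u)
         / (theta tau u * theta tau (z - u) * theta tau vk * theta tau (vk + z)))
        with (ph tau tau * ph tau tau * ph tau tau * theta_quotient tau u vk z)
        by (unfold theta_quotient, Cdiv; ring).
      field. split; auto using theta_term_neq_0.
    + unfold vk. rewrite theta_quotient_shift by assumption. field. apply theta_term_neq_0.
  - ring.
Qed.

(** With x = e(u), the factor 1 - a x q^n splits the sum in two. In the second part q^n is absorbed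
    by v -> v - tau, and theta(v - tau) = - e(v - tau) theta(v) accounts for the sign and for e(v -
    tau). *)
Lemma mu_contiguous (tau b u v : C) : (0 < Im tau)%R ->
  ~ in_lattice tau u -> ~ in_lattice tau v ->
  mu tau b u v = mu tau (b + tau) u v + ee (b + u + v - tau) * mu tau (b + tau) u (v - tau).
Proof.
  intros Ht Hu Hv.
  assert (Hvt : ~ in_lattice tau (v - tau)).
  { replace (v - tau) with (v + IZC (-1) * tau) by (unfold IZC; ring). now apply lattice_shift. }
  pose proof (theta_neq_0 tau v Ht Hv) as Nv.
  pose proof (theta_neq_0 tau _ Ht Hvt) as Nvt.
  assert (S : Csum zl (mu_term tau b u v) = Csum zl (mu_term tau (b + tau) u v)
     - ee (u + b) * Csum zl (mu_term tau (b + tau) u (v - tau))).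
  { rewrite <- Csum_scal by auto using exhaustion_zl, superexp_summable, mu_term_superexp.
    rewrite <- Csum_minus
      by auto using exhaustion_zl, superexp_summable, mu_term_superexp, summable_scal.
    apply Csum_ext. intros n. unfold mu_term, qratio.
    rewrite (ph_step tau (u + IZC n * tau + b)) by assumption.
    replace (u + IZC n * tau + (b + tau)) with (u + IZC n * tau + b + tau) by ring.
    replace (theta_term tau (tau - (v - tau)) n) with (ee (IZC n * tau) * theta_term tau (tau - v) n)
      by (unfold theta_term; rewrite <- ee_plus; f_equal; field).
    replace (u + IZC n * tau + b) with (u + b + IZC n * tau) by ring.
    rewrite (ee_plus (u + b)). unfold Cdiv. ring. }
  unfold mu. rewrite S.
  rewrite (theta_step tau (v - tau)) in Nvt |- * by assumption.
  replace (v - tau + tau) with v in * by ring.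
  replace (b + u + v - tau) with ((u + b) + (v - tau)) by ring. rewrite (ee_plus (u + b)).
  field. split; auto using ee_neq_0.
Qed.

(** Raising b by tau replaces q/a by 1/a in rho; the two products of length n differ only in their
    end factors. *)
Lemma qpoch_one_minus_inv (a q : C) (n : nat) : a <> 0 ->
  (1 - a) * qpoch (q / a) q n = (q ^ n - a) * qpoch (1 / a) q n.
Proof.
  intros Ha.
  assert (E : (1 - 1 / a) * qpoch (q / a) q n = qpoch (1 / a) q n * (1 - 1 / a * q ^ n)).
  { replace (q / a) with (1 / a * q) by (field; assumption).
    rewrite <- qpoch_S_left. reflexivity. }
  replace ((1 - a) * qpoch (q / a) q n) with (- a * ((1 - 1 / a) * qpoch (q / a) q n))
    by (field; assumption).
  rewrite E. field. assumption.
Qed.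

(** Holds term by term: the right side contains (aq)^k (1/a;q)_k (1 - a q^(-k)), with q^(-k) coming
    from w - tau, and [qpoch_one_minus_inv] trades q^k - a for 1 - a. *)
Lemma phi_contiguous (tau b w : C) : (0 < Im tau)%R ->
  (1 - ee b) * phi_series tau b w =
  phi_series tau (b + tau) w - ee b * phi_series tau (b + tau) (w - tau).
Proof.
  intros Ht. unfold phi_series.
  rewrite <- !Csum_scal by auto using exhaustion_zl, superexp_summable, phi_term_superexp.
  rewrite <- Csum_minus
    by auto using exhaustion_zl, superexp_summable, phi_term_superexp, summable_scal.
  apply Csum_ext. intros k.
  destruct (Z_lt_le_dec k 0) as [Hk|Hk].
  { rewrite !rho_neg by assumption. ring. }
  replace (theta_term tau (w - tau) k) with (theta_term tau w k * ee (- (IZC k * tau)))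
    by (unfold theta_term; rewrite <- ee_plus; f_equal; ring).
  replace (theta_term tau w k * ee (- (IZC k * tau))) with (theta_term tau w k / ee (IZC k * tau))
    by (rewrite ee_opp; reflexivity).
  unfold rho.
  replace (tau - (b + tau)) with (- b) by ring.
  replace (ee (IZC k * (b + tau))) with (ee (IZC k * b) * ee (IZC k * tau))
    by (rewrite <- ee_plus; f_equal; ring).
  pose proof (qpoch_one_minus_inv (ee b) (ee tau) (Z.to_nat k) (ee_neq_0 b)) as Q.
  rewrite <- ee_minus, ee_pow, Z2Nat.id in Q by assumption.
  replace (1 / ee b) with (ee (- b)) in Q by (rewrite ee_opp; unfold Cdiv; ring).
  transitivity (rq tau k * ee (IZC k * b) * theta_term tau w k *
    ((1 - ee b) * qpoch (ee (tau - b)) (ee tau) (Z.to_nat k))); [ring|rewrite Q].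
  field. apply ee_neq_0.
Qed.

(** Induction on the number of steps b -> b + tau that bring b into the upper half-plane. A step
    uses the identity at v and at v - tau; the latter multiplies the theta quotient by - e(tau - u -
    v), which turns e(b + u + v - tau) into - e(b), as [phi_contiguous] requires. *)
Lemma mu_diff (tau b u v z : C) : (0 < Im tau)%R ->
  ~ in_lattice tau u -> ~ in_lattice tau (u - z) ->
  ~ in_lattice tau v -> ~ in_lattice tau (v + z) ->
  mu tau b u v - mu tau b (u - z) (v + z) =
  ph tau b * ph tau tau * ph tau tau * theta_quotient tau u v z * phi_series tau b (u + v).
Proof.
  intros Ht.
  assert (A : forall n b u v z, (0 < Im b + INR n * Im tau)%R ->
    ~ in_lattice tau u -> ~ in_lattice tau (u - z) ->
    ~ in_lattice tau v -> ~ in_lattice tau (v + z) ->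
    mu tau b u v - mu tau b (u - z) (v + z) =
    ph tau b * ph tau tau * ph tau tau * theta_quotient tau u v z * phi_series tau b (u + v)).
  { clear b u v z. induction n as [|n IH]; intros b u v z Hn Hu Huz Hv Hvz.
    - apply mu_diff_upper; try assumption. simpl in Hn. lra.
    - assert (Hvt : ~ in_lattice tau (v - tau)).
      { replace (v - tau) with (v + IZC (-1) * tau) by (unfold IZC; ring). now apply lattice_shift. }
      assert (Hvzt : ~ in_lattice tau (v - tau + z)).
      { replace (v - tau + z) with (v + z + IZC (-1) * tau) by (unfold IZC; ring).
        now apply lattice_shift. }
      assert (Hb : (0 < Im (b + tau) + INR n * Im tau)%R).
      { rewrite Im_plus. rewrite S_INR in Hn. lra. }
      pose proof (IH (b + tau) u v z Hb Hu Huz Hv Hvz) as I1.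
      pose proof (IH (b + tau) u (v - tau) z Hb Hu Huz Hvt Hvzt) as I2.
      replace (theta_quotient tau u (v - tau) z)
        with (theta_quotient tau u v z * - ee (tau - (u + v))) in I2.
      2:{ replace (v - tau) with (v + IZC (-1) * tau) by (unfold IZC; ring).
          rewrite theta_quotient_shift by assumption. f_equal. unfold theta_term.
          replace (IZC (-1) / 2 + tau * IZC (-1) * (IZC (-1) - 1) / 2 + IZC (-1) * (u + v))
            with (- (1 / 2) + (tau - (u + v))) by (unfold IZC; field).
          rewrite ee_plus, ee_opp, ee_half. field. }
      rewrite (mu_contiguous tau b u v), (mu_contiguous tau b (u - z) (v + z)) by assumption.
      replace (b + (u - z) + (v + z) - tau) with (b + u + v - tau) by ring.
      replace (v + z - tau) with (v - tau + z) by ring.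
      transitivity ((mu tau (b + tau) u v - mu tau (b + tau) (u - z) (v + z)) +
        ee (b + u + v - tau) *
        (mu tau (b + tau) u (v - tau) - mu tau (b + tau) (u - z) (v - tau + z))); [ring|].
      rewrite I1, I2, (ph_step tau b) by assumption.
      replace (u + (v - tau)) with (u + v - tau) by ring.
      replace (b + u + v - tau) with (b + - (tau - (u + v))) by ring.
      rewrite (ee_plus b), ee_opp.
      transitivity (ph tau (b + tau) * ph tau tau * ph tau tau * theta_quotient tau u v z *
        ((1 - ee b) * phi_series tau b (u + v))); [|ring].
      rewrite phi_contiguous by assumption. field. apply ee_neq_0. }
  destruct (INR_unbounded (- Im b / Im tau)) as [n Hn].
  apply (A n). apply (Rmult_gt_compat_r (Im tau)) in Hn; [|lra].
  replace (- Im b / Im tau * Im tau)%R with (- Im b)%R in Hn by (field; lra). lra.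
Qed.

(** * Reduction of the multivariable case to one variable *)

Lemma cprod_S_left (n : nat) (f : nat -> C) : cprod (S n) f = f O * cprod n (fun i => f (S i)).
Proof.
  induction n as [|n IH]; [simpl; ring|].
  change (cprod (S (S n)) f) with (cprod (S n) f * f (S n)). rewrite IH. simpl. ring.
Qed.

Lemma cprod_ext (n : nat) (f g : nat -> C) : (forall i, (i < n)%nat -> f i = g i) -> cprod n f = cprod n g.
Proof.
  induction n as [|n IH]; simpl; intros H; [reflexivity|]. rewrite IH, H; auto with arith.
Qed.

Lemma csum_ext (n : nat) (f g : nat -> C) : (forall i, (i < n)%nat -> f i = g i) -> csum n f = csum n g.
Proof.
  induction n as [|n IH]; simpl; intros H; [reflexivity|]. rewrite IH, H; auto with arith.
Qed.

Lemma cprod_mult (n : nat) (f g : nat -> C) : cprod n (fun i => f i * g i) = cprod n f * cprod n g.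
Proof. induction n as [|n IH]; simpl; [ring|rewrite IH; ring]. Qed.

Lemma cprod_neq_0 (n : nat) (f : nat -> C) : (forall i, (i < n)%nat -> f i <> 0) -> cprod n f <> 0.
Proof.
  induction n as [|n IH]; simpl; intros H.
  - intros E. injection E. lra.
  - apply Cmult_neq_0; auto with arith.
Qed.

Lemma cprod_inv (n : nat) (f : nat -> C) : (forall i, (i < n)%nat -> f i <> 0) ->
  cprod n (fun i => / f i) = / cprod n f.
Proof.
  induction n as [|n IH]; simpl; intros H; [field|].
  rewrite IH by auto with arith. field. split; [apply H; lia|].
  apply cprod_neq_0. auto with arith.
Qed.

Lemma cprod_ee (n : nat) (x : nat -> C) : cprod n (fun i => ee (x i)) = ee (csum n x).
Proof. induction n as [|n IH]; simpl; [now rewrite ee_0|rewrite IH, ee_plus; reflexivity]. Qed.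

Lemma csum_plus (n : nat) (f g : nat -> C) : csum n (fun i => f i + g i) = csum n f + csum n g.
Proof. induction n as [|n IH]; simpl; [ring|rewrite IH; ring]. Qed.

Lemma csum_scal (n : nat) (c : C) (f : nat -> C) : csum n (fun i => c * f i) = c * csum n f.
Proof. induction n as [|n IH]; simpl; [ring|rewrite IH; ring]. Qed.

Lemma csum_S_left (n : nat) (f : nat -> C) : csum (S n) f = f O + csum n (fun i => f (S i)).
Proof.
  induction n as [|n IH]; [simpl; ring|].
  change (csum (S (S n)) f) with (csum (S n) f + f (S n)). rewrite IH. simpl. ring.
Qed.

Lemma csum_add (a b : nat) (f : nat -> C) :
  csum (a + b) f = csum a f + csum b (fun i => f (a + i)%nat).
Proof.
  induction b as [|b IH].
  - rewrite Nat.add_0_r. simpl. ring.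
  - rewrite Nat.add_succ_r. simpl. rewrite IH. ring.
Qed.

Lemma lsum_swap {I J : Type} (l : list I) (l' : list J) (f : I -> J -> C) :
  lsum l (fun i => lsum l' (f i)) = lsum l' (fun j => lsum l (fun i => f i j)).
Proof.
  induction l as [|i l IH]; simpl.
  - induction l' as [|j l' IH]; simpl; [reflexivity|rewrite <- IH; ring].
  - rewrite IH, <- lsum_plus. reflexivity.
Qed.

(** Box sums truncate all coordinates at M, the sums in the conclusion only the last k; the product
    majorant makes both have the same limit. *)
Lemma boxsum_fubini (k : nat) (f : list Z -> C) (g : Z -> R) (h : list Z -> R) :
  rsummable zl g -> rsummable (box k) h ->
  (forall m l, (Cmod (f (m :: l)) <= g m * h l)%R) ->
  Ctends (fun M => lsum (box k M) (fun l => Csum zl (fun m => f (m :: l)))) (Zk_sum (S k) f).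
Proof.
  intros [Hg [B HB]] Hh Hf. pose proof Hh as [Hh0 _].
  assert (HB0 : (0 <= B)%R) by (eapply Rle_trans; [apply (rsum_nonneg (zl 0)), Hg|apply HB]).
  assert (Hb : forall l M, (rsum (zl M) (fun m => Cmod (f (m :: l))) <= B * h l)%R).
  { intros l M. apply Rle_trans with (rsum (zl M) (fun m => h l * g m)%R).
    - apply rsum_le. intros m _. rewrite Rmult_comm. apply Hf.
    - rewrite rsum_scal, Rmult_comm. apply Rmult_le_compat_r; auto. }
  assert (Hs : forall l, summable zl (fun m => f (m :: l))).
  { intros l. split; [intros; apply Cmod_ge_0|]. exists (B * h l)%R. apply Hb. }
  assert (D : forall n, dominated (box k) (fun l => lsum (zl n) (fun m => f (m :: l)))
     (fun l => B * h l)%R).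
  { intros n M l _. eapply Rle_trans; [|apply (Hb l n)]. apply lsum_Cmod_le. intros; lra. }
  assert (T : forall M l, In l (box k M) ->
    Ctends (fun n => lsum (zl n) (fun m => f (m :: l))) (Csum zl (fun m => f (m :: l)))).
  { intros M l _. apply summable_tends; [apply exhaustion_zl|apply Hs]. }
  pose proof (rsummable_scal (box k) B h HB0 Hh) as HBh.
  assert (E : Zk_sum (S k) f = Csum (box k) (fun l => Csum zl (fun m => f (m :: l)))).
  { apply Clim_eq.
    eapply Ctends_ext; [|apply (tannery_diagonal (box k)
      (fun n l => lsum (zl n) (fun m => f (m :: l))) _ _ (exhaustion_box k) HBh D T)].
    intros M. cbv beta. simpl. rewrite zsum_lsum, lsum_swap. apply lsum_ext. intros m _.
    now rewrite boxsum_lsum. }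
  rewrite E. apply summable_tends; [apply exhaustion_box|].
  exact (limit_summable (box k) (fun n l => lsum (zl n) (fun m => f (m :: l))) _ _ HBh D T).
Qed.

Definition box_prod (k : nat) (w : nat -> Z -> C) (l : list Z) : C :=
  cprod k (fun i => w i (nj l (S i))).

Lemma box_prod_cons (k : nat) (w : nat -> Z -> C) (m : Z) (l : list Z) :
  box_prod (S k) w (m :: l) = w O m * box_prod k (fun i => w (S i)) l.
Proof.
  unfold box_prod. rewrite cprod_S_left. f_equal. apply cprod_ext. intros i _.
  unfold nj. simpl. now rewrite Nat.sub_0_r.
Qed.

Lemma zpow_add_le (A : R) (m n : Z) : (1 <= A)%R -> (zpow A (m + n) <= zpow A m * zpow A n)%R.
Proof.
  intros HA. unfold zpow. rewrite <- pow_add. apply Rle_pow; [assumption|lia].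
Qed.

Lemma zpow_pos (A : R) (n : Z) : (0 <= A)%R -> (0 <= zpow A n)%R.
Proof. intros HA. now apply pow_le. Qed.

Lemma superexp_weighted_summable (f : Z -> C) (A : R) : (1 <= A)%R -> superexp_small f ->
  rsummable zl (fun n => Cmod (f n) * zpow A n)%R.
Proof.
  intros HA Hf. split.
  { intros n. apply Rmult_le_pos; [apply Cmod_ge_0|apply zpow_pos; lra]. }
  assert (S : superexp_small (fun n => f n * RtoC (zpow A n))).
  { apply superexp_mult; [assumption|]. exists 1%R, A. split; [assumption|].
    intros n. rewrite Cmod_R, Rabs_pos_eq by (apply zpow_pos; lra). lra. }
  destruct (superexp_summable _ S) as [_ [B HB]]. exists B. intros M.
  eapply Rle_trans; [|apply (HB M)]. apply rsum_le. intros n _.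
  rewrite Cmod_mult, Cmod_R, Rabs_pos_eq by (apply zpow_pos; lra). lra.
Qed.

(** The weight prepares for the q-Pochhammer ratio, which couples the coordinates through their sum.
    Since [zpow A] is submultiplicative, its growth splits into one factor per coordinate, each
    beaten by the decay of [w i]. *)
Lemma box_prod_summable (k : nat) (w : nat -> Z -> C) (A : R) : (1 <= A)%R ->
  (forall i, superexp_small (w i)) ->
  rsummable (box k) (fun l => Cmod (box_prod k w l) * zpow A (abs_n l))%R.
Proof.
  intros HA. revert w. induction k as [|k IH]; intros w Hw.
  - split; [intros l; apply Rmult_le_pos; [apply Cmod_ge_0|apply zpow_pos; lra]|].
    exists 1%R. intros M. simpl. unfold box_prod, zpow. simpl. rewrite Cmod_1. lra.
  - split; [intros l; apply Rmult_le_pos; [apply Cmod_ge_0|apply zpow_pos; lra]|].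
    destruct (IH (fun i => w (S i)) (fun i => Hw (S i))) as [Hh [B HB]].
    destruct (superexp_weighted_summable (w O) A HA (Hw O)) as [Hg [B' HB']].
    assert (HB0 : (0 <= B)%R) by (eapply Rle_trans; [apply (rsum_nonneg (box k 0)), Hh|apply HB]).
    exists (B * B')%R. intros M. simpl box. rewrite rsum_flat_map.
    apply Rle_trans with (rsum (zl M) (fun m => B * (Cmod (w O m) * zpow A m)))%R.
    + apply rsum_le. intros m _. rewrite rsum_map.
      apply Rle_trans with (rsum (box k M) (fun l => (Cmod (w O m) * zpow A m) *
        (Cmod (box_prod k (fun i => w (S i)) l) * zpow A (abs_n l))))%R.
      * apply rsum_le. intros l _. rewrite box_prod_cons, Cmod_mult.
        change (abs_n (m :: l)) with (m + abs_n l)%Z.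
        pose proof (zpow_add_le A m (abs_n l) HA).
        assert (0 <= Cmod (w O m) * Cmod (box_prod k (fun i => w (S i)) l))%R
          by (apply Rmult_le_pos; apply Cmod_ge_0).
        apply (Rmult_le_compat_l _ _ _ H0) in H. lra.
      * rewrite rsum_scal, Rmult_comm. apply Rmult_le_compat_r; [apply Hg|apply HB].
    + rewrite rsum_scal. now apply Rmult_le_compat_l.
Qed.

(** * The summand of [hat_mu] in terms of the one-variable functions *)

Definition vconst (tau : C) : C := - Ci * ee (tau / 8).

Lemma vconst_neq_0 (tau : C) : vconst tau <> 0.
Proof.
  apply Cmult_neq_0; [|apply ee_neq_0]. intros E. apply (f_equal Im) in E.
  unfold Ci, Copp, Im, RtoC in E. simpl in E. lra.
Qed.

Lemma vtheta_theta (tau u : C) : vtheta u tau = vconst tau * ee (- u / 2) * theta tau u.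
Proof.
  unfold vtheta, theta, vconst, ph. change Defs.Ci with Ci. rewrite qpow_ee, !qq_ee.
  replace (cexp (- CPI * Ci * u)) with (ee (- u / 2)) by (unfold ee; f_equal; field).
  replace (cexp (2 * CPI * Ci * u)) with (ee u) by reflexivity.
  replace (cexp (-2 * CPI * Ci * u)) with (ee (- u)) by (unfold ee; f_equal; ring).
  replace (/ 8 * tau) with (tau / 8) by (unfold Cdiv; ring).
  unfold Cminus. rewrite (ee_plus tau). ring.
Qed.

Lemma vtheta_neq_0 (tau u : C) : (0 < Im tau)%R -> ~ in_lattice tau u -> vtheta u tau <> 0.
Proof.
  intros Ht Hu. rewrite vtheta_theta. apply Cmult_neq_0; [apply Cmult_neq_0|].
  - apply vconst_neq_0.
  - apply ee_neq_0.
  - now apply theta_neq_0.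
Qed.

(** The index is off by two: i = 0 stands for n_2 and u_2, since n_1 and u_1 are left to the
    one-variable function. *)
Definition mu_weight (tau : C) (u : nat -> C) (i : nat) (m : Z) : C :=
  theta_term tau (tau - u (S (S i))) m / vtheta (u (S (S i))) tau.

Definition hat_term (N : nat) (u : nat -> C) (alpha tau : C) (n : list Z) : C :=
  cexp (CPI * Defs.Ci * u O)
  * qpoch_inf (cexp (2 * CPI * Defs.Ci * u O) * qpow tau (alpha + IZC (abs_n n))) (qq tau)
  / qpoch_inf (cexp (2 * CPI * Defs.Ci * u O) * qpow tau (IZC (abs_n n))) (qq tau)
  * cprod N (fun i =>
      let j := S i in
      let m := nj n j in
      signZ m * cexp (- 2 * CPI * Defs.Ci * IZC m * u j)
      * qpow tau (IZC m * IZC (m + 1) / 2) / vtheta (u j) tau).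

Lemma hat_mu_hat_term (N : nat) (u : nat -> C) (alpha tau : C) :
  hat_mu N u alpha tau =
  cexp (CPI * Ci * (alpha - 1) * csum (S N) u) * Zk_sum N (hat_term N u alpha tau).
Proof. reflexivity. Qed.

(** The coordinates interact only through their sum in the q-Pochhammer ratio. With the tail l
    fixed, its sum moves into u_0 and everything else factors. *)
Lemma hat_term_cons (k : nat) (u : nat -> C) (alpha tau : C) (m : Z) (l : list Z) :
  hat_term (S k) u alpha tau (m :: l) =
  ee (u O / 2) / vtheta (u 1%nat) tau * box_prod k (mu_weight tau u) l
  * mu_term tau (alpha * tau) (u O + IZC (abs_n l) * tau) (u 1%nat) m.
Proof.
  assert (W : forall i m, signZ m * cexp (- 2 * CPI * Defs.Ci * IZC m * u i)
      * qpow tau (IZC m * IZC (m + 1) / 2) / vtheta (u i) tau =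
      theta_term tau (tau - u i) m / vtheta (u i) tau).
  { intros i m'. f_equal. change Defs.Ci with Ci. rewrite signZ_ee, qpow_ee.
    replace (cexp (-2 * CPI * Ci * IZC m' * u i)) with (ee (- IZC m' * u i))
      by (unfold ee; f_equal; ring).
    unfold theta_term. rewrite <- !ee_plus. f_equal. rewrite IZC_plus. unfold IZC. field. }
  unfold hat_term. cbv zeta. rewrite cprod_S_left.
  rewrite (cprod_ext k _ (fun i => mu_weight tau u i (nj l (S i)))).
  2:{ intros i _. rewrite W. unfold mu_weight, nj. simpl. now rewrite Nat.sub_0_r. }
  fold (box_prod k (mu_weight tau u) l). rewrite W.
  change (nj (m :: l) 1) with m. change (abs_n (m :: l)) with (m + abs_n l)%Z.
  unfold mu_term, qratio, ph. change Defs.Ci with Ci.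
  replace (cexp (CPI * Ci * u O)) with (ee (u O / 2)) by (unfold ee; f_equal; field).
  change (cexp (2 * CPI * Ci * u O)) with (ee (u O)).
  rewrite !qpow_ee, qq_ee, <- !ee_plus.
  replace (u O + (alpha + IZC (m + abs_n l)) * tau)
    with (u O + IZC (abs_n l) * tau + IZC m * tau + alpha * tau) by (rewrite IZC_plus; ring).
  replace (u O + IZC (m + abs_n l) * tau)
    with (u O + IZC (abs_n l) * tau + IZC m * tau) by (rewrite IZC_plus; ring).
  unfold Cdiv. ring.
Qed.

Lemma mu_weight_superexp (tau : C) (u : nat -> C) (i : nat) : (0 < Im tau)%R ->
  superexp_small (mu_weight tau u i).
Proof.
  intros Ht.
  apply (superexp_ext (fun m => / vtheta (u (S (S i))) tau * theta_term tau (tau - u (S (S i))) m)).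
  { intros m. unfold mu_weight, Cdiv. ring. }
  now apply superexp_scal, theta_term_superexp.
Qed.

(** The prefactors e(u_0/2) and 1/vtheta(u_1) combine into e((u_0 + u_1)/2) / (vconst theta(u_1)).
    Apart from [mu], only u_0 + u_1 and the u_j with j >= 2 then occur, so the sums for u and for
    its z-shift can be subtracted term by term. *)
Lemma hat_mu_tends (k : nat) (u : nat -> C) (alpha tau : C) : (0 < Im tau)%R ->
  ~ in_lattice tau (u O) -> ~ in_lattice tau (u 1%nat) ->
  Ctends (fun M => lsum (box k M) (fun l =>
      ee ((u O + u 1%nat) / 2) / vconst tau * box_prod k (mu_weight tau u) l
      * mu tau (alpha * tau) (u O + IZC (abs_n l) * tau) (u 1%nat)))
    (Zk_sum (S k) (hat_term (S k) u alpha tau)).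
Proof.
  intros Ht Hu0 Hu1.
  (* One pair K, A serves every l, because moving u_0 by a multiple of tau only shifts the index of
     the ratio. *)
  destruct (qratio_exp_bounded tau (alpha * tau) (u O) Ht Hu0) as [K [A [HA HK]]].
  assert (HK0 : (0 <= K)%R) by exact (bound_const_nonneg _ _ _ HK).
  set (c := ee (u O / 2) / vtheta (u 1%nat) tau).
  eapply Ctends_ext; [|apply (boxsum_fubini k (hat_term (S k) u alpha tau)
    (fun m => Cmod (theta_term tau (tau - u 1%nat) m) * zpow A m)%R
    (fun l => (Cmod c * K) * (Cmod (box_prod k (mu_weight tau u) l) * zpow A (abs_n l)))%R)].
  - intros M. cbv beta. apply lsum_ext. intros l _.
    assert (Hl : ~ in_lattice tau (u O + IZC (abs_n l) * tau)) by now apply lattice_shift.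
    rewrite (Csum_ext zl _ _ (fun m => hat_term_cons k u alpha tau m l)).
    rewrite Csum_scal by auto using exhaustion_zl, superexp_summable, mu_term_superexp.
    unfold mu. rewrite vtheta_theta.
    pose proof (theta_neq_0 tau _ Ht Hu1) as N1.
    pose proof (vconst_neq_0 tau) as Nc.
    replace ((u O + u 1%nat) / 2) with (u O / 2 - (- u 1%nat / 2)) by field.
    rewrite ee_minus. field. repeat split; auto using ee_neq_0.
  - apply superexp_weighted_summable; [assumption|]. now apply theta_term_superexp.
  - apply rsummable_scal; [apply Rmult_le_pos; [apply Cmod_ge_0|assumption]|].
    apply box_prod_summable; [assumption|]. intros i. now apply mu_weight_superexp.
  - intros m l. rewrite hat_term_cons. fold c. unfold mu_term.
    rewrite !Cmod_mult.
    replace (u O + IZC (abs_n l) * tau + IZC m * tau) with (u O + IZC (m + abs_n l) * tau)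
      by (rewrite IZC_plus; ring).
    pose proof (HK (m + abs_n l)%Z) as H1. cbv beta in H1.
    pose proof (zpow_add_le A m (abs_n l) HA) as H2.
    set (x := Cmod c) in *. set (y := Cmod (box_prod k (mu_weight tau u) l)) in *.
    set (t := Cmod (theta_term tau (tau - u 1%nat) m)) in *.
    assert (Hxyt : (0 <= x * y * t)%R)
      by (apply Rmult_le_pos; [apply Rmult_le_pos|]; apply Cmod_ge_0).
    set (r := Cmod (qratio _ _ _)) in *.
    assert (H3 : (r <= K * (zpow A m * zpow A (abs_n l)))%R).
    { eapply Rle_trans; [exact H1|]. now apply Rmult_le_compat_l. }
    apply (Rmult_le_compat_l _ _ _ Hxyt) in H3. lra.
Qed.

(** Shifting u again leaves one Gaussian at u + v. With s the sum of n_2, ..., n_N it supplies the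
    all-ones part of the quadratic form, while the weights supply the identity part. *)
Lemma theta_quotient_shift_left (tau u v z : C) (s : Z) : (0 < Im tau)%R ->
  ~ in_lattice tau u -> ~ in_lattice tau (u - z) ->
  ~ in_lattice tau v -> ~ in_lattice tau (v + z) ->
  theta_quotient tau (u + IZC s * tau) v z = theta_quotient tau u v z * theta_term tau (u + v) s.
Proof.
  intros Ht Hu Huz Hv Hvz. unfold theta_quotient.
  replace (v + z - (u + IZC s * tau)) with (v + z - u + IZC (- s) * tau) by (rewrite IZC_opp; ring).
  replace (z - (u + IZC s * tau)) with (z - u + IZC (- s) * tau) by (rewrite IZC_opp; ring).
  pose proof (theta_neq_0 tau _ Ht (lattice_shift tau u s Hu)) as Nu.
  pose proof (theta_neq_0 tau _ Ht (lattice_shift tau _ (- s) (lattice_opp_sub _ _ _ Huz))) as Nzu.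
  pose proof (theta_neq_0 tau _ Ht Hv) as Nv.
  pose proof (theta_neq_0 tau _ Ht Hvz) as Nvz.
  rewrite (theta_shift tau u s), (theta_shift tau (z - u) (- s)), (theta_shift tau (v + z - u) (- s))
    by assumption.
  replace (theta_term tau (u + v) s) with
    (theta_term tau u s * theta_term tau (z - u) (- s) / theta_term tau (v + z - u) (- s)).
  - field. repeat split; auto using theta_term_neq_0.
  - unfold theta_term. unfold Cdiv at 1. rewrite <- ee_opp, <- !ee_plus. f_equal.
    rewrite IZC_opp. field.
Qed.

Lemma abs_n_csum (k : nat) (l : list Z) : List.length l = k ->
  IZC (abs_n l) = csum k (fun i => IZC (nj l (S i))).
Proof.
  revert k. induction l as [|m l IH]; intros k <-; [reflexivity|].
  change (abs_n (m :: l)) with (m + abs_n l)%Z. simpl List.length.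
  rewrite IZC_plus, csum_S_left. f_equal. rewrite (IH _ eq_refl). apply csum_ext. intros i _.
  unfold nj. simpl. now rewrite Nat.sub_0_r.
Qed.

Lemma csum_delta (k a : nat) (c : C) : (a < k)%nat ->
  csum k (fun b => if Nat.eqb a b then c else 0) = c.
Proof.
  assert (Z0 : forall n, (n <= a)%nat -> csum n (fun b => if Nat.eqb a b then c else 0) = 0).
  { induction n as [|n IH]; intros Hn; [reflexivity|]. simpl. rewrite IH by lia.
    destruct (Nat.eqb_spec a n); [lia|ring]. }
  induction k as [|k IH]; intros Hk; [lia|]. simpl. destruct (Nat.eqb_spec a k) as [->|Hak].
  - rewrite Z0 by lia. ring.
  - rewrite IH by lia. ring.
Qed.

(** The matrix [hatS] is the identity plus the matrix of ones. *)
Lemma quadS_eq (k : nat) (l : list Z) : List.length l = k ->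
  quadS k l = IZC (abs_n l) * IZC (abs_n l) + csum k (fun i => IZC (nj l (S i)) * IZC (nj l (S i))).
Proof.
  intros Hl. rewrite (abs_n_csum k l Hl). unfold quadS.
  set (x := fun i => IZC (nj l (S i))).
  transitivity (csum k (fun a => csum k x * x a + x a * x a)).
  - apply csum_ext. intros a Ha.
    transitivity (csum k (fun b => x a * x b + (if Nat.eqb a b then x a * x a else 0))).
    + apply csum_ext. intros b _. unfold hatS. simpl. fold (x a) (x b).
      destruct (Nat.eqb_spec a b) as [->|_]; unfold IZC; ring.
    + rewrite csum_plus, csum_scal, csum_delta by assumption. ring.
  - rewrite csum_plus, csum_scal. reflexivity.
Qed.

(** With s the sum of l, s^2/2 from [theta_term] and n_j^2/2 from each weight give half the
    quadratic form; the linear terms tau s/2 and - tau s/2 cancel; the signs contribute e(s/2)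
    twice, that is e(s) = 1. *)
Lemma box_prod_weight (k : nat) (u : nat -> C) (tau w : C) (l : list Z) : (0 < Im tau)%R ->
  (forall i, (i < k)%nat -> ~ in_lattice tau (u (S (S i)))) -> List.length l = k ->
  box_prod k (mu_weight tau u) l * theta_term tau w (abs_n l) =
  / cprod k (fun i => vtheta (u (S (S i))) tau) *
  (qpow tau (quadS k l / 2) *
   cprod k (fun i => cexp (2 * CPI * Ci * IZC (nj l (S i)) * (w - u (S (S i)))))).
Proof.
  intros Ht Hu Hl. unfold box_prod, mu_weight, Cdiv.
  rewrite cprod_mult, cprod_inv by (intros i Hi; now apply vtheta_neq_0, Hu).
  set (x := fun i => IZC (nj l (S i))).
  rewrite (cprod_ext k (fun i => cexp _) (fun i => ee (w * x i + - (x i * u (S (S i)))))).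
  2:{ intros i _. unfold ee, x. f_equal. ring. }
  unfold theta_term at 1. rewrite !cprod_ee, qpow_ee.
  match goal with |- ee ?a * ?d * ?t = ?d * (ee ?b * ee ?c) =>
    transitivity (d * (ee a * t)); [ring|f_equal; unfold theta_term; rewrite <- !ee_plus] end.
  rewrite quadS_eq by assumption.
  change (csum k (fun i => IZC (nj l (S i)) * IZC (nj l (S i)))) with (csum k (fun i => x i * x i)).
  rewrite (csum_ext k (fun i => x i / 2 + _ + _)
    (fun i => (1 / 2 + tau / 2) * x i + (tau / 2) * (x i * x i) + (-(1)) * (x i * u (S (S i)))));
    [|intros i _; unfold x; field].
  rewrite (csum_ext k (fun i => w * x i + _)
    (fun i => w * x i + (-(1)) * (x i * u (S (S i))))); [|intros i _; ring].
  rewrite !csum_plus, !csum_scal.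
  assert (Hs : csum k x = IZC (abs_n l)) by (symmetry; now apply abs_n_csum).
  rewrite Hs.
  match goal with |- ee ?p = ee ?r => replace p with (IZC (abs_n l) + r) by field end.
  rewrite ee_plus, ee_IZC. ring.
Qed.

Lemma Ctends_tail (s : nat -> C) (l : C) : Ctends (fun n => s (S n)) l -> Ctends s l.
Proof.
  intros H eps He. destruct (H eps He) as [n0 Hn]. exists (S n0). intros n Hle.
  destruct n as [|n]; [lia|]. apply Hn. lia.
Qed.

Lemma rq_nat (tau : C) (n : nat) : (0 < Im tau)%R ->
  rq tau (Z.of_nat n) = / qpoch (ee tau) (ee tau) n.
Proof.
  intros Ht. pose proof (ph_upper_neq_0 tau tau Ht Ht) as Nt. unfold rq.
  assert (E : ph tau tau = qpoch (ee tau) (ee tau) n * ph tau (IZC (Z.of_nat n + 1) * tau)).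
  { unfold ph. rewrite (qpoch_inf_split _ _ n (Cmod_ee_tau_lt_1 tau Ht)), ee_pow, <- ee_plus.
    do 3 f_equal. rewrite IZC_plus. unfold IZC. ring. }
  rewrite E in Nt |- *. field.
  split; intros H0; apply Nt; rewrite H0; ring.
Qed.

Lemma phi11_series (tau alpha x : C) : (0 < Im tau)%R ->
  phi11 (qpow tau (1 - alpha)) (qq tau) (ee (alpha * tau + x)) = phi_series tau (alpha * tau) x.
Proof.
  (* The window from - M to M holds M vanishing terms and the M + 1 terms n = 0, ..., M, so it
     matches the partial sum of length S M; [Ctends_tail] absorbs this offset. *)
  intros Ht. apply Clim_eq. apply Ctends_tail.
  eapply Ctends_ext; [|apply summable_tends; [apply exhaustion_zl|
    apply superexp_summable, (phi_term_superexp tau (alpha * tau) x Ht)]].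
  intros M. cbv beta. rewrite <- zsum_lsum. unfold zsum.
  replace (2 * M + 1)%nat with (M + S M)%nat by lia. rewrite csum_add.
  rewrite (csum_ext M _ (fun _ => 0 * 0)).
  2:{ intros i Hi. rewrite rho_neg by (assumption || lia). ring. }
  rewrite csum_scal, Cmult_0_l, Cplus_0_l. apply csum_ext. intros n _.
  replace (Z.of_nat (M + n) - Z.of_nat M)%Z with (Z.of_nat n) by lia.
  unfold rho. rewrite Nat2Z.id, rq_nat by assumption.
  rewrite qpow_ee, qq_ee, signZ_ee, !ee_pow.
  replace ((1 - alpha) * tau) with (tau - alpha * tau) by ring.
  unfold theta_term, Cdiv.
  assert (Hn : IZC (Z.of_nat (n * (n - 1) / 2)) = IZC (Z.of_nat n) * (IZC (Z.of_nat n) - 1) / 2).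
  { assert (D : (n * (n - 1) = 2 * (n * (n - 1) / 2))%nat).
    { apply Nat.Div0.div_exact. destruct n as [|n]; [reflexivity|].
      replace (S n - 1)%nat with n by lia.
      destruct (Nat.Even_or_Odd n) as [[p ->]|[p ->]].
      - replace (S (2 * p) * (2 * p))%nat with (S (2 * p) * p * 2)%nat by lia. apply Nat.Div0.mod_mul.
      - replace (S (2 * p + 1) * (2 * p + 1))%nat with (S p * (2 * p + 1) * 2)%nat by lia.
        apply Nat.Div0.mod_mul. }
    set (d := (n * (n - 1) / 2)%nat) in *.
    assert (D' : (Z.of_nat n * (Z.of_nat n - 1) = Z.of_nat d + Z.of_nat d)%Z).
    { destruct n as [|n]; [simpl in *; lia|].
      replace (S n - 1)%nat with n in D by lia. nia. }
    apply (f_equal IZC) in D'. rewrite IZC_plus in D'.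
    replace (IZC (Z.of_nat d)) with ((IZC (Z.of_nat d) + IZC (Z.of_nat d)) / 2) by field.
    rewrite <- D'. unfold IZC. rewrite mult_IZR, minus_IZR, RtoC_mult, RtoC_minus. reflexivity. }
  rewrite Hn.
  set (N := IZC (Z.of_nat n)).
  set (P := qpoch (ee (tau - alpha * tau)) (ee tau) n).
  set (Q := / qpoch (ee tau) (ee tau) n).
  transitivity (P * Q * ee (N * (alpha * tau) + (N / 2 + tau * N * (N - 1) / 2 + N * x))).
  - rewrite (ee_plus (N * (alpha * tau))). unfold Cdiv. ring.
  - transitivity (P * Q * (ee (N / 2) * ee (N * (N - 1) / 2 * tau) * ee (N * (alpha * tau + x)))).
    + rewrite <- !ee_plus. do 2 f_equal. field.
    + unfold Cdiv. ring.
Qed.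

Theorem theorem1p1 (N : nat) (tau alpha z : C) (u : nat -> C) :
  (0 < Im tau)%R ->
  (1 <= N)%nat ->
  qpoch_inf (qpow tau (1 - alpha)) (qq tau) <> 0 ->
  (forall k, (k <= N)%nat -> ~ in_lattice tau (u k)) ->
  ~ in_lattice tau (z - u O) ->
  ~ in_lattice tau (z + u 1%nat) ->
  let q := qq tau in
  let U := csum (S N) u in
  let u' := fun k => match k with
                     | O => u O - z
                     | S O => u 1%nat + z
                     | _ => u k end in
  hat_mu N u alpha tau - hat_mu N u' alpha tau =
  cexp (CPI * Ci * (alpha - 1) * U + CPI * Ci * alpha * tau)
  * vtheta (alpha * tau) tau * vtheta z tau * vtheta (z - u O + u 1%nat) tau
  * qpoch_inf q q
  / (vtheta (z - u O) tau * vtheta (z + u 1%nat) tau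
     * cprod (S N) (fun k => vtheta (u k) tau)
     * qpoch_inf (qpow tau (1 - alpha)) q)
  * Zk_sum (N - 1) (fun n =>
      qpow tau (quadS (N - 1) n / 2)
      * cprod (N - 1) (fun i =>
          let j := S i in
          cexp (2 * CPI * Ci * IZC (nj n j) * (u O + u 1%nat - u (S j))))
      * phi11 (qpow tau (1 - alpha)) q
          (cexp (2 * CPI * Ci * (u O + u 1%nat + alpha * tau))
           * qpow tau (IZC (abs_n n)))).
Proof.
  intros Ht HN Hpoch Hu Hzu0 Hzu1 q U u'.
  destruct N as [|k]; [lia|]. replace (S k - 1)%nat with k by lia.
  assert (Hu0 : ~ in_lattice tau (u O)) by (apply Hu; lia).
  assert (Hu1 : ~ in_lattice tau (u 1%nat)) by (apply Hu; lia).
  assert (Hu0z : ~ in_lattice tau (u O - z)) by now apply lattice_opp_sub.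
  assert (Hu1z : ~ in_lattice tau (u 1%nat + z)) by now rewrite Cplus_comm.
  set (b := alpha * tau) in *.
  set (R := fun n => qpow tau (quadS k n / 2)
      * cprod k (fun i =>
          let j := S i in
          cexp (2 * CPI * Ci * IZC (nj n j) * (u O + u 1%nat - u (S j))))
      * phi11 (qpow tau (1 - alpha)) q
          (cexp (2 * CPI * Ci * (u O + u 1%nat + b)) * qpow tau (IZC (abs_n n)))).
  (* All factors independent of n, still in terms of [theta] and [ph]. *)
  set (c := ee ((u O + u 1%nat) / 2) / vconst tau * / cprod k (fun i => vtheta (u (S (S i))) tau)
     * (ph tau b * ph tau tau * ph tau tau * theta_quotient tau (u O) (u 1%nat) z)).
  assert (T : Ctends (fun M => c * lsum (box k M) R)
     (Zk_sum (S k) (hat_term (S k) u alpha tau) - Zk_sum (S k) (hat_term (S k) u' alpha tau))).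
  { eapply Ctends_ext; [|apply Ctends_minus;
      [now apply hat_mu_tends|now apply hat_mu_tends]].
    intros M. cbv beta. rewrite <- lsum_minus, <- lsum_scal. apply lsum_ext. intros l Hl.
    apply in_box in Hl. destruct Hl as [Hl _].
    set (s := abs_n l).
    change (box_prod k (mu_weight tau u') l) with (box_prod k (mu_weight tau u) l).
    change (u' O) with (u O - z). change (u' 1%nat) with (u 1%nat + z). fold b.
    replace (u O - z + (u 1%nat + z)) with (u O + u 1%nat) by ring.
    replace (u O - z + IZC s * tau) with (u O + IZC s * tau - z) by ring.
    assert (Hs : ~ in_lattice tau (u O + IZC s * tau)) by now apply lattice_shift.
    assert (Hsz : ~ in_lattice tau (u O + IZC s * tau - z)).
    { replace (u O + IZC s * tau - z) with (u O - z + IZC s * tau) by ring. now apply lattice_shift. }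
    set (e := ee ((u O + u 1%nat) / 2) / vconst tau).
    transitivity (e * box_prod k (mu_weight tau u) l *
      (mu tau b (u O + IZC s * tau) (u 1%nat) - mu tau b (u O + IZC s * tau - z) (u 1%nat + z))); [ring|].
    (* The identity is used at u_0 + s tau; moving the quotient back to u_0 costs [theta_term] at
       u_0 + u_1, which [box_prod_weight] merges with the weights. *)
    rewrite mu_diff, theta_quotient_shift_left by assumption.
    assert (P : box_prod k (mu_weight tau u) l * theta_term tau (u O + u 1%nat) s =
       / cprod k (fun i => vtheta (u (S (S i))) tau) *
       (qpow tau (quadS k l / 2) *
        cprod k (fun i => cexp (2 * CPI * Ci * IZC (nj l (S i)) * (u O + u 1%nat - u (S (S i))))))).
    { apply box_prod_weight; [assumption| |assumption]. intros i Hi. apply Hu. lia. }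
    unfold R. cbv zeta.
    replace (cexp (2 * CPI * Ci * (u O + u 1%nat + b)) * qpow tau (IZC (abs_n l)))
      with (ee (alpha * tau + (u O + IZC s * tau + u 1%nat))).
    2:{ rewrite qpow_ee. unfold ee. rewrite <- cexp_plus. f_equal. unfold b, s. ring. }
    unfold q. rewrite phi11_series by assumption. fold b.
    unfold c. fold e.
    match goal with |- ?e0 * ?B * (?X * (?Y * ?t) * ?f) = _ =>
      transitivity (e0 * X * Y * f * (B * t)); [ring|rewrite P; ring] end. }
  rewrite !hat_mu_hat_term.
  replace (csum (S (S k)) u') with U.
  2:{ unfold U. rewrite !csum_S_left. unfold u'. ring. }
  set (X := Zk_sum (S k) (hat_term (S k) u alpha tau)) in *.
  set (X' := Zk_sum (S k) (hat_term (S k) u' alpha tau)) in *.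
  assert (E : X - X' = c * Zk_sum k R).
  (* Convergence of the box sums of [R] is known only through [T], after multiplication by [c]. For
     nonzero [c] one divides; for c = 0, as when theta(z) = 0, both sides are 0 whatever value
     [Clim] takes. *)
  { destruct (Classical_Prop.classic (c = 0)) as [Hc|Hc].
    - rewrite Hc in *. rewrite Cmult_0_l. eapply Ctends_unique; [exact T|].
      apply (Ctends_ext (fun _ => 0)); [|apply Ctends_const]. intros M. ring.
    - replace (Zk_sum k R) with (/ c * (X - X')); [field; assumption|].
      symmetry. apply Clim_eq. eapply Ctends_ext; [|apply (Ctends_scal (/ c)), T].
      intros M. cbv beta. rewrite boxsum_lsum. field. assumption. }
  transitivity (cexp (CPI * Ci * (alpha - 1) * U) * (X - X')); [unfold U; ring|].
  rewrite E. fold b R. rewrite Cmult_assoc. f_equal.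
  rewrite !cprod_S_left.
  assert (Hpoch' : ph tau (tau - b) <> 0).
  { unfold ph, b. rewrite qpow_ee, qq_ee in Hpoch.
    replace (tau - alpha * tau) with ((1 - alpha) * tau) by ring. exact Hpoch. }
  replace (qpoch_inf (qpow tau (1 - alpha)) q) with (ph tau (tau - b)).
  2:{ unfold ph, q, b. rewrite qpow_ee, qq_ee. do 2 f_equal. ring. }
  replace (qpoch_inf q q) with (ph tau tau) by (unfold q, ph; now rewrite qq_ee).
  rewrite cexp_plus.
  replace (cexp (CPI * Ci * alpha * tau)) with (ee (b / 2)) by (unfold ee, b; f_equal; field).
  pose proof (cprod_neq_0 k (fun i => vtheta (u (S (S i))) tau)
    (fun i Hi => vtheta_neq_0 tau _ Ht (Hu (S (S i)) ltac:(lia)))) as NP.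
  unfold c. set (P := cprod k (fun i => vtheta (u (S (S i))) tau)) in *.
  rewrite !vtheta_theta.
  replace (z + u 1%nat) with (u 1%nat + z) by ring.
  replace (z - u O + u 1%nat) with (u 1%nat + z - u O) by ring.
  pose proof (theta_neq_0 tau _ Ht Hu0) as N0.
  pose proof (theta_neq_0 tau _ Ht Hu1) as N1.
  pose proof (theta_neq_0 tau _ Ht Hu1z) as N1z.
  pose proof (theta_neq_0 tau _ Ht Hzu0) as Nz0.
  pose proof (vconst_neq_0 tau) as Nc.
  (* The last factor is (q^(1-alpha);q)_oo and cancels against the denominator of the statement;
     [ph tau b] and one (q;q)_oo of [mu_diff] remain. *)
  replace (theta tau b) with (ph tau tau * ph tau b * ph tau (tau - b)) by reflexivity.
  unfold theta_quotient.
  (* Exponents are split so that e(u_0/2), e(u_1/2), e(z/2) and e(b/2) become independent atoms for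
     [field]. Outside [P], three [vtheta] above and four below account for the single 1/vconst in
     [c]. *)
  replace ((u O + u 1%nat) / 2) with (u O / 2 + u 1%nat / 2) by field.
  replace (- b / 2) with (- (b / 2)) by field.
  replace (- z / 2) with (- (z / 2)) by field.
  replace (- u O / 2) with (- (u O / 2)) by field.
  replace (- u 1%nat / 2) with (- (u 1%nat / 2)) by field.
  replace (- (u 1%nat + z) / 2) with (- (u 1%nat / 2 + z / 2)) by field.
  replace (- (u 1%nat + z - u O) / 2) with (u O / 2 + - (u 1%nat / 2 + z / 2)) by field.
  replace (- (z - u O) / 2) with (u O / 2 + - (z / 2)) by field.
  rewrite !ee_plus, !ee_opp, !ee_plus.
  field. repeat split; auto using ee_neq_0.
Qed.
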